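(* Let $\alpha>0$ and $\varphi(z)=\alpha(\log^+|z|)^2$. Then: (i) every $d_\rho$-separated sequence $\Lambda\subset\mathbb{C}$ with $D^-(\Lambda)>2\alpha$ is a set of sampling for $\mathcal{F}^2_\varphi$; (ii) if a sequence $\Lambda\subset\mathbb{C}$ is a set of sampling for $\mathcal{F}^2_\varphi$, then it is a finite union of $d_\rho$-separated subsequences and $\Lambda$ contains a $d_\rho$-separated sequence $\widetilde\Lambda$ such that $D^-(\widetilde\Lambda)\ge2\alpha$.
   Context: Here $\log^+ t=\max(\log t,0)$ and $m$ is planar Lebesgue measure. Sequences $\Lambda\subset\mathbb{C}$ are (countable) sets of distinct points. Put $d_\rho(z,w)=\sqrt{2\alpha}\,\frac{|z-w|}{\sqrt{2\alpha}+\min(|z|,|w|)}$; $\Lambda$ is $d_\rho$-separated if $\inf\{d_\rho(z,w):z,w\in\Lambda,\ z\neq w\}>0$. With $\mathcal{A}(r,R)=\{z: r\le|z|<R\}$, the lower density is $$D^-(\Lambda)=\liminf_{R\to+\infty}\liminf_{r\to+\infty}\frac{\operatorname{Card}(\Lambda\cap\mathcal{A}(r,Rr))}{\log R}.$$ $\mathcal{F}^2_\varphi$ is the Hilbert space of entire functions $f$ with $\|f\|_{\varphi,2}^2=\int_{\mathbb{C}}|f|^2e^{-2\varphi}\,dm<\infty$; $\mathbf{k}_z$ is its reproducing kernel at $z$. $\Lambda$ is (a set of) sampling for $\mathcal{F}^2_\varphi$ if there is $C>0$ with $C^{-1}\|f\|_{\varphi,2}^2\le\sum_{\lambda\in\Lambda}|f(\lambda)|^2/\mathbf{k}_\lambda(\lambda)\le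 C\|f\|_{\varphi,2}^2$ for all $f\in\mathcal{F}^2_\varphi$. *)

(* Defs.v *)
From HB Require Import structures.
From mathcomp Require Import all_boot all_order all_algebra.
From mathcomp Require Import complex.
From mathcomp Require Import all_classical all_reals all_analysis.
Import Order.TTheory GRing.Theory Num.Theory.
Import numFieldNormedType.Exports.

Set Implicit Arguments.
Unset Strict Implicit.
Unset Printing Implicit Defensive.

Local Open Scope classical_set_scope.
Local Open Scope ring_scope.
Local Open Scope complex_scope.

Section defs.
Variable R : realType.
Local Notation C := R[i].

(* R-valued modulus: the generic norm `|z| of z : R[i] lives in R[i]. *)
Definition cabs (z : C) : R := complex.Re `|z|.

(* The complex plane is identified with R * R through (x, y) |-> x +i* y. *)
Definition plane_measure :=
  ((@lebesgue_measure R) \x (@lebesgue_measure R))%E.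

(* \int_C g dm for nonnegative g *)
Definition plane_integral (g : C -> R) : \bar R :=
  (\int[plane_measure]_(p in setT) (g (p.1 +i* p.2))%:E)%E.

(* \int_C g dm for complex-valued g with integrable real and imaginary parts *)
Definition plane_cintegral (g : C -> C) : C :=
  fine (plane_integral (fun z => complex.Re (g z))) +i*
  fine (plane_integral (fun z => complex.Im (g z))).

(* The scalars being R[i], this derivability is complex differentiability. *)
Definition entire (f : C -> C) : Prop :=
  forall z : C, derivable (f : C^o -> C^o) z 1.

Definition fock_norm2 (phi : C -> R) (f : C -> C) : \bar R :=
  plane_integral (fun z => cabs (f z) ^+ 2 * expR (- (2 * phi z))).

Definition fock (phi : C -> R) : set (C -> C) :=
  [set f | entire f /\ (fock_norm2 phi f < +oo)%E].

Definition fock_dot (phi : C -> R) (f g : C -> C) : C :=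
  plane_cintegral (fun z => f z * (g z)^* * (expR (- (2 * phi z)))%:C).

Definition is_repro_kernel (phi : C -> R) (z : C) (k : C -> C) : Prop :=
  fock phi k /\ forall f, fock phi f -> f z = fock_dot phi f k.

(* The element k_z of the Fock space representing evaluation at z; the default
   value 0 is only taken when evaluation at z is not represented. *)
Definition repro_kernel (phi : C -> R) (z : C) : C -> C :=
  xget (fun=> 0) [set k | is_repro_kernel phi z k].

Definition sampling (phi : C -> R) (L : set C) : Prop :=
  exists2 c : R, 0 < c &
    forall f, fock phi f ->
      let S := (\esum_(l in L)
        (cabs (f l) ^+ 2 / complex.Re (repro_kernel phi l l))%:E)%E in
      (c^-1%:E * fock_norm2 phi f <= S)%E /\
      (S <= c%:E * fock_norm2 phi f)%E.

Definition logp (t : R) : R := Num.max (ln t) 0.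

Definition log2_weight (alpha : R) (z : C) : R := alpha * logp (cabs z) ^+ 2.

Definition drho (alpha : R) (z w : C) : R :=
  Num.sqrt (2 * alpha) *
  (cabs (z - w) / (Num.sqrt (2 * alpha) + Num.min (cabs z) (cabs w))).

(* The infimum is taken in \bar R, so that the empty set and singletons are
   separated. *)
Definition drho_separated (alpha : R) (L : set C) : Prop :=
  (0 < ereal_inf [set (drho alpha p.1 p.2)%:E |
                  p in [set p : C * C | [/\ L p.1, L p.2 & p.1 <> p.2]]])%E.

Definition annulus (r s : R) : set C := [set z | r <= cabs z < s].

Definition lower_density (L : set C) : \bar R :=
  limf_einf (fun s : R =>
    limf_einf (fun r : R =>
      (counting (L `&` annulus r (s * r)) / (ln s)%:E)%E)
      (pinfty_nbhs R))
    (pinfty_nbhs R).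

End defs.

(* Main.v *)
(** Power series and Parseval's identity (averaging over rotations by roots of
unity, then Fatou's lemma) identify the Fock space with a weighted l^2 space of
Taylor coefficients, with weights ||z^n||^2 comparable to
exp ((n + 1)^2 / (2 alpha)). In the variable tau = 2 alpha log^+ |z| the
normalized monomial z^n has a Gaussian profile centred at tau = n + 1, so that
sampling is a question about matrices with exponentially decaying entries, and
Schur's test applies: a bounded number of points per unit tau-interval is
equivalent to the upper sampling inequality, and D^-(L) / (2 alpha) is the
density of L in the variable tau.

If this density exceeds 1, L contains points l_k with tau(l_k) = sigma k + O(1)
and sigma < 1. Lagrange interpolation of polynomials at suitable blocks of
these points recovers the m-th coefficient through weights which decay like
exp (- c d^2), d being the distance to the node with tau close to m + 1; this
gives the lower inequality. Conversely, if L is sampling, let L' be a maximal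
eta-separated subset with eta small. If L' had too few points in some
tau-window, a nonzero polynomial with exponents in that window would vanish on
them, hence be small on all of L, contradicting the lower inequality. *)
Require Import Defs.
From HB Require Import structures.
From mathcomp Require Import all_boot all_order all_algebra.
From mathcomp Require Import complex.
From mathcomp Require Import all_classical all_reals all_analysis.
From mathcomp Require Import qpoly cyclic separable cyclotomic measurable_realfun.
From mathcomp Require Import ring lra zify.
Import Order.TTheory GRing.Theory Num.Theory.
Import numFieldNormedType.Exports.

Set Implicit Arguments.
Unset Strict Implicit.
Unset Printing Implicit Defensive.

Local Open Scope classical_set_scope.
Local Open Scope ring_scope.

(** The Gaussian profile of a monomial beats every exponential, and that surplus is spent: each
    argument fixes an exponential rate in advance, gives part of it away (2 out of 3 when a zero is
    moved to a nearby point, 1 out of 2 to make points outside a window negligible) and keeps rate 1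
    for Schur's test. The threshold on sigma reflects two competing Gaussians. In units of 1/(2
    alpha), the Lagrange product contributes - sigma d^2/2 to the exponent, while a node at distance
    about sigma d from the critical value of tau costs + sigma^2 d^2/2 through its kernel
    normalization. The sufficiency estimate is proved for Taylor polynomials only. For general f the
    upper inequality is applied to the remainder, whose norm is exactly what the polynomial is
    missing, so the two estimates close up without any limit of sampling sums. Polar coordinates and
    the value 2 pi i are avoided: monomial norms are compared with areas of squares, rotations are
    products of shears, and Taylor coefficients are normalized by the integral of dz/z over a
    square, of which only the nonvanishing is used. *)

Section modulus.
Variable R : realType.
Local Notation C := R[i].
Implicit Types (z w : C) (x y : R).

Lemma cabsE z : cabs z = Num.sqrt (complex.Re z ^+ 2 + complex.Im z ^+ 2).
Proof. by case: z. Qed.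

Lemma normr_cabs z : `|z| = (cabs z)%:C%C.
Proof. by rewrite /cabs normc_def. Qed.

Lemma cabs_ge0 z : 0 <= cabs z.
Proof. by rewrite cabsE sqrtr_ge0. Qed.

Lemma cabsM z w : cabs (z * w) = cabs z * cabs w.
Proof. by apply: complexI; rewrite rmorphM /= -!normr_cabs normrM. Qed.

Lemma cabs0 : cabs (0 : C) = 0.
Proof. by rewrite /cabs normr0. Qed.

Lemma cabs1 : cabs (1 : C) = 1.
Proof. by rewrite /cabs normr1. Qed.

Lemma cabsN z : cabs (- z) = cabs z.
Proof. by rewrite /cabs normrN. Qed.

Lemma cabs_conj z : cabs (z^*)%C = cabs z.
Proof. by rewrite /cabs normcJ. Qed.

Lemma cabsB z w : cabs (z - w) = cabs (w - z).
Proof. by rewrite -cabsN opprB. Qed.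

Lemma cabsX z n : cabs (z ^+ n) = cabs z ^+ n.
Proof. by elim: n => [|n IH]; rewrite ?expr0 ?cabs1// !exprS cabsM IH. Qed.

Lemma cabs_eq0 z : (cabs z == 0) = (z == 0).
Proof.
apply/eqP/eqP => [h|->]; last exact: cabs0.
by apply/eqP; rewrite -normr_eq0 normr_cabs h.
Qed.

Lemma cabs_gt0 z : (0 < cabs z) = (z != 0).
Proof. by rewrite lt_neqAle cabs_ge0 andbT eq_sym cabs_eq0. Qed.

Lemma cabsV z : cabs z^-1 = (cabs z)^-1.
Proof.
have [->|z0] := eqVneq z 0; first by rewrite invr0 cabs0 invr0.
apply: (mulfI (x := cabs z)); first by rewrite cabs_eq0.
by rewrite -cabsM !mulfV ?cabs1// cabs_eq0.
Qed.

Lemma ler_cabsD z w : cabs (z + w) <= cabs z + cabs w.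
Proof. by rewrite -lecR rmorphD /= -!normr_cabs ler_normD. Qed.

Lemma ler_cabsB z w : cabs (z - w) <= cabs z + cabs w.
Proof. by rewrite -(cabsN w) ler_cabsD. Qed.

Lemma lerB_cabsD z w : cabs z - cabs w <= cabs (z + w).
Proof.
rewrite lerBlDr; have := ler_cabsD (z + w) (- w).
by rewrite addrK cabsN.
Qed.

Lemma lerB_cabs z w : cabs z - cabs w <= cabs (z - w).
Proof. by rewrite -(cabsN w) lerB_cabsD. Qed.

Lemma ler_cabs_sum I (r : seq I) (P : pred I) (F : I -> C) :
  cabs (\sum_(i <- r | P i) F i) <= \sum_(i <- r | P i) cabs (F i).
Proof.
elim/big_rec2: _ => [|i y1 y2 _ h]; first by rewrite cabs0.
by rewrite (le_trans (ler_cabsD _ _))// lerD2l.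
Qed.

Lemma cabs_prod I (r : seq I) (P : pred I) (F : I -> C) :
  cabs (\prod_(i <- r | P i) F i) = \prod_(i <- r | P i) cabs (F i).
Proof.
by elim/big_rec2: _ => [|i y1 y2 _ h]; rewrite ?cabs1// cabsM h.
Qed.

Lemma cabs_real x : cabs (x%:C%C : C) = `|x|.
Proof. by rewrite cabsE /= expr0n addr0 sqrtr_sqr. Qed.

Lemma cabs_i : cabs ('i%C : C) = 1.
Proof. by rewrite cabsE /= expr0n expr1n add0r sqrtr1. Qed.

Lemma cabs_natr n : cabs (n%:R : C) = n%:R.
Proof. by rewrite -(rmorph_nat (real_complex R)) cabs_real ger0_norm. Qed.

Lemma cabs_sqr z : cabs z ^+ 2 = complex.Re z ^+ 2 + complex.Im z ^+ 2.
Proof. by rewrite cabsE sqr_sqrtr// addr_ge0// sqr_ge0. Qed.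

Lemma cabs_sqrC z : (cabs z ^+ 2)%:C%C = z * (z^*)%C.
Proof. by rewrite rmorphXn /= -normr_cabs sqr_normc. Qed.

Lemma Re_le_cabs z : `|complex.Re z| <= cabs z.
Proof. by rewrite -lecR -normr_cabs normc_ge_Re. Qed.

Lemma Im_le_cabs z : `|complex.Im z| <= cabs z.
Proof.
by rewrite cabsE -sqrtr_sqr ler_wsqrtr// lerDr sqr_ge0.
Qed.

Lemma cabs_le_ReIm z : cabs z <= `|complex.Re z| + `|complex.Im z|.
Proof.
rewrite {1}(complexE z); apply: (le_trans (ler_cabsD _ _)).
by rewrite cabsM cabs_i mul1r !cabs_real.
Qed.

Lemma ReD z w : complex.Re (z + w) = complex.Re z + complex.Re w.
Proof. by case: z w => [? ?] [? ?]. Qed.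
Lemma ImD z w : complex.Im (z + w) = complex.Im z + complex.Im w.
Proof. by case: z w => [? ?] [? ?]. Qed.
Lemma ReN z : complex.Re (- z) = - complex.Re z.
Proof. by case: z. Qed.
Lemma ImN z : complex.Im (- z) = - complex.Im z.
Proof. by case: z. Qed.
Lemma Re_mul z w : complex.Re (z * w) =
  complex.Re z * complex.Re w - complex.Im z * complex.Im w.
Proof. by case: z w => [? ?] [? ?]. Qed.
Lemma Im_mul z w : complex.Im (z * w) =
  complex.Re z * complex.Im w + complex.Im z * complex.Re w.
Proof. by case: z w => [? ?] [? ?]. Qed.
Lemma ReC x : complex.Re (x%:C%C : C) = x. Proof. by []. Qed.
Lemma ImC x : complex.Im (x%:C%C : C) = 0. Proof. by []. Qed.
Lemma ReZ x z : complex.Re (x%:C%C * z) = x * complex.Re z.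
Proof. by rewrite Re_mul ReC ImC mul0r subr0. Qed.
Lemma ImZ x z : complex.Im (x%:C%C * z) = x * complex.Im z.
Proof. by rewrite Im_mul ReC ImC mul0r addr0. Qed.
Lemma ReJ z : complex.Re (z^*)%C = complex.Re z. Proof. by case: z. Qed.
Lemma ImJ z : complex.Im (z^*)%C = - complex.Im z. Proof. by case: z. Qed.
Lemma Re_sum I (r : seq I) (P : pred I) (F : I -> C) :
  complex.Re (\sum_(i <- r | P i) F i) = \sum_(i <- r | P i) complex.Re (F i).
Proof. exact: (big_morph _ ReD). Qed.
Lemma Im_sum I (r : seq I) (P : pred I) (F : I -> C) :
  complex.Im (\sum_(i <- r | P i) F i) = \sum_(i <- r | P i) complex.Im (F i).
Proof. exact: (big_morph _ ImD). Qed.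

Lemma eqC_ReIm z w :
  complex.Re z = complex.Re w -> complex.Im z = complex.Im w -> z = w.
Proof. by case: z w => [? ?] [? ?] /= -> ->. Qed.

(** Complex differentiability with real epsilons and the real modulus [cabs]. Multiplying out the
    difference quotient removes the case distinction at h = 0. *)
Definition cderiv (f : C -> C) z d := forall e, 0 < e -> exists2 r, 0 < r &
  forall h, cabs h < r -> cabs (f (z + h) - f z - d * h) <= e * cabs h.

Lemma derivable_cderiv (f : C -> C) z :
  derivable (f : C^o -> C^o) z 1 <-> exists d, cderiv f z d.
Proof.
split.
  move=> /cvg_ex[/= d] /cvgrPdist_le H; exists d => e e0.
  have /H : 0 < (e%:C%C : C) by rewrite ltcR.
  rewrite near_withinE => /nbhs_ballP[r /= r0 Hr].
  (* The order of R[i] compares only numbers with equal imaginary parts, so a positive radius in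
     R[i] is real and descends to R. *)
  have : r \is Num.real by rewrite gtr0_real.
  case/complex_realP => r' rr'; subst r; exists r'; first by rewrite ltcR in r0.
  move=> h hr; have [->|h0] := eqVneq h 0.
    by rewrite addr0 subrr mulr0 subrr cabs0 mulr0.
  have := Hr h; rewrite /ball/= sub0r normrN normr_cabs ltcR => /(_ hr h0).
  rewrite normr_cabs lecR => {}Hr.
  have {}Hr : cabs (d - h^-1 * (f (h * 1 + z) - f z)) <= e by exact: Hr.
  have -> : f (z + h) - f z - d * h = - (d - h^-1 * (f (h * 1 + z) - f z)) * h.
    rewrite opprB mulrBl mulrAC mulVf// mul1r mulr1.
    by rewrite [h + z]addrC.
  by rewrite cabsM cabsN ler_wpM2r// cabs_ge0.
case=> d H; apply/cvg_ex; exists d; apply/cvgrPdist_le => e e0.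
have : e \is Num.real by rewrite gtr0_real.
case/complex_realP => e' ee'; subst e; move: e0; rewrite ltcR => e0.
have [r r0 Hr] := H _ e0.
rewrite near_withinE; apply/nbhs_ballP; exists (r%:C%C : C) => /=; first by rewrite ltcR.
move=> h; rewrite /ball/= sub0r normrN normr_cabs ltcR => /Hr hr h0.
rewrite normr_cabs lecR -(ler_pM2r (x := cabs h)) ?cabs_gt0//.
rewrite (_ : cabs _ = cabs (d - h^-1 * (f (h * 1 + z) - f z)))//.
rewrite -cabsM -cabsN (le_trans _ hr)//.
by rewrite mulr1 -mulNr opprB mulrBl mulrAC mulVf// mul1r [h + z]addrC.
Qed.

Lemma entireP (f : C -> C) : entire f <-> forall z, exists d, cderiv f z d.
Proof. by split=> H z; apply/derivable_cderiv. Qed.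

End modulus.

(** * Cauchy's theorem on rectangles *)

Section segment_integral.
Variable R : realType.
Local Notation C := R[i].
Local Notation mu := (@lebesgue_measure R).
Implicit Types (a b c d x y : R) (u v : R -> C).

Definition rint a b (u : R -> R) : R := \int[mu]_(x in `[a, b]) u x.

(** The base point lies in the segment but the nearby point may leave it. This two-sided form is
    what continuity of the plane function provides, and it restricts to subsegments for free. *)
Definition cont_on a b u := forall x, a <= x <= b ->
  forall e, 0 < e -> exists2 r, 0 < r &
    forall y, `|y - x| < r -> cabs (u y - u x) <= e.

Lemma cont_on_within a b u (p : C -> R) : cont_on a b u ->
  (forall z w, `|p z - p w| <= cabs (z - w)) ->
  {within `[a, b], continuous (p \o u)}.
Proof.
move=> H Hp; apply: continuous_in_subspaceT => x.
rewrite inE /= in_itv /= => /H Hx.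
apply/cvgrPdist_le => e e0; have [r r0 Hr] := Hx _ e0.
apply/nbhs_ballP; exists r => //= y; rewrite /ball /= distrC => /Hr h.
by rewrite distrC (le_trans (Hp _ _)).
Qed.

Lemma cont_on_intRe a b u : cont_on a b u ->
  mu.-integrable `[a, b] (EFin \o (fun x => complex.Re (u x))).
Proof.
move=> H; apply: continuous_compact_integrable; first exact: segment_compact.
by apply: (cont_on_within H) => z w; rewrite -ReN -ReD Re_le_cabs.
Qed.

Lemma cont_on_intIm a b u : cont_on a b u ->
  mu.-integrable `[a, b] (EFin \o (fun x => complex.Im (u x))).
Proof.
move=> H; apply: continuous_compact_integrable; first exact: segment_compact.
by apply: (cont_on_within H) => z w; rewrite -ImN -ImD Im_le_cabs.
Qed.

Definition cint a b u : C :=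
  (rint a b (fun x => complex.Re (u x)) +i* rint a b (fun x => complex.Im (u x)))%C.

Lemma cont_onZ a b u k : cont_on a b u -> cont_on a b (fun x => k * u x).
Proof.
move=> Hu x Hx e e0.
have k0 : 0 < cabs k + 1 by rewrite ltr_wpDl// cabs_ge0.
have [r r0 Hr] := Hu x Hx _ (divr_gt0 e0 k0).
exists r => // y /Hr h; rewrite -mulrBr cabsM.
apply: (@le_trans _ _ ((cabs k + 1) * (e / (cabs k + 1)))).
  by rewrite ler_pM ?cabs_ge0// lerDl.
by rewrite mulrC divfK// gt_eqF.
Qed.

Lemma cintD a b u v : cont_on a b u -> cont_on a b v ->
  cint a b (fun x => u x + v x) = cint a b u + cint a b v.
Proof.
move=> Hu Hv; apply: eqC_ReIm.
  rewrite ReD /= /rint -RintegralD//; try exact: cont_on_intRe.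
  by apply: eq_Rintegral => x _; rewrite ReD.
rewrite ImD /= /rint -RintegralD//; try exact: cont_on_intIm.
by apply: eq_Rintegral => x _; rewrite ImD.
Qed.

Lemma cintZ a b u k : cont_on a b u ->
  cint a b (fun x => k * u x) = k * cint a b u.
Proof.
move=> Hu; have HR := cont_on_intRe Hu; have HI := cont_on_intIm Hu.
have HZ p (f : R -> R) : mu.-integrable `[a, b] (EFin \o f) ->
  mu.-integrable `[a, b] (EFin \o (fun x => p * f x)).
  move=> h; suff : mu.-integrable `[a, b] (fun x => p%:E * (EFin \o f) x)%E.
    by apply: eq_integrable.
  exact: integrableZl.
have Zl := fun p f h => @RintegralZl _ _ _ mu `[a, b] f p (measurable_itv _) h.
apply: eqC_ReIm.
  rewrite Re_mul /= /rint -(Zl _ _ HR) -(Zl _ _ HI).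
  rewrite -RintegralB//; try exact: HZ.
  by apply: eq_Rintegral => x _; rewrite Re_mul.
rewrite Im_mul /= /rint -(Zl _ _ HR) -(Zl _ _ HI).
rewrite -RintegralD//; try exact: HZ.
by apply: eq_Rintegral => x _; rewrite Im_mul.
Qed.

Lemma eq_cint a b u v : (forall x, a <= x <= b -> u x = v x) ->
  cint a b u = cint a b v.
Proof.
move=> H; congr (_ +i* _)%C; apply: eq_Rintegral => x;
  by rewrite inE/= in_itv/= => /H ->.
Qed.

Lemma rint_cst a b k : a <= b -> rint a b (fun=> k) = k * (b - a).
Proof.
move=> ab; rewrite /rint Rintegral_cst//= lebesgue_measure_itv/= lte_fin.
case: ltP => //= ba; rewrite (_ : b = a) ?subrr//.
by apply/eqP; rewrite eq_le ab ba.
Qed.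

Lemma cint_cst a b k : a <= b -> cint a b (fun=> k) = k * (b - a)%:C%C.
Proof.
by move=> ab; apply: eqC_ReIm; rewrite ?Re_mul ?Im_mul /= rint_cst// mulr0 ?subr0 ?add0r.
Qed.

Lemma rint_split a b c (u : R -> R) : a <= c -> c <= b ->
  mu.-integrable `[a, b] (EFin \o u) ->
  rint a b u = rint a c u + rint c b u.
Proof.
move=> ac cb Hu; have := @Rintegral_itvB R u (BLeft a) (BRight b) c Hu.
rewrite !bnd_simp => /(_ ac cb) H.
rewrite /rint; apply/eqP; rewrite addrC -subr_eq H; apply/eqP.
apply: Rintegral_itv_obnd_cbnd; apply: integrableS Hu => //.
by apply: subset_itvr; rewrite bnd_simp.
Qed.

Lemma cint_split a b c u : a <= c -> c <= b -> cont_on a b u ->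
  cint a b u = cint a c u + cint c b u.
Proof.
move=> ac cb Hu; apply: eqC_ReIm; rewrite ?ReD ?ImD /=; apply: rint_split => //.
  exact: cont_on_intRe.
exact: cont_on_intIm.
Qed.

Lemma rint_bound a b M (u : R -> R) : a <= b ->
  mu.-integrable `[a, b] (EFin \o u) ->
  (forall x, a <= x <= b -> `|u x| <= M) -> `|rint a b u| <= M * (b - a).
Proof.
move=> ab Hu HM; rewrite (le_trans (le_normr_Rintegral _ _))//.
rewrite -(rint_cst M ab); apply: le_Rintegral => //.
- exact: integrable_norm.
- apply: continuous_compact_integrable; first exact: segment_compact.
  by apply: continuous_subspaceT => x; apply: cst_continuous.
Qed.

(** The factor 2 comes from bounding real and imaginary parts separately; all later uses tolerate a
    constant. *)
Lemma cint_bound a b M u : a <= b -> cont_on a b u ->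
  (forall x, a <= x <= b -> cabs (u x) <= M) ->
  cabs (cint a b u) <= M * (b - a) *+ 2.
Proof.
move=> ab Hu HM; rewrite (le_trans (cabs_le_ReIm _))// mulr2n lerD//=.
  apply: rint_bound => //; first exact: cont_on_intRe.
  by move=> x /HM; apply: le_trans; exact: Re_le_cabs.
apply: rint_bound => //; first exact: cont_on_intIm.
by move=> x /HM; apply: le_trans; exact: Im_le_cabs.
Qed.

Lemma rint_lower a b m (u : R -> R) : a <= b ->
  mu.-integrable `[a, b] (EFin \o u) ->
  (forall x, a <= x <= b -> m <= u x) -> m * (b - a) <= rint a b u.
Proof.
move=> ab Hu HM; rewrite -(rint_cst m ab); apply: le_Rintegral => //.
  apply: continuous_compact_integrable; first exact: segment_compact.
  by apply: continuous_subspaceT => x; apply: cst_continuous.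
Qed.

End segment_integral.

Section goursat.
Variable R : realType.
Local Notation C := R[i].
Implicit Types (a b c d x y : R) (f g : C -> C) (z w : C).

Definition ccont g z := forall e, 0 < e -> exists2 r, 0 < r &
  forall h, cabs h < r -> cabs (g (z + h) - g z) <= e.

Lemma cderiv_ccont g z (d : C) : cderiv g z d -> ccont g z.
Proof.
move=> H e e0; have [r r0 Hr] := H 1 ltr01.
have k0 : 0 < cabs d + 1 by rewrite ltr_wpDl// cabs_ge0.
exists (Num.min r (e / (cabs d + 1))); first by rewrite lt_min r0 divr_gt0.
move=> h; rewrite lt_min => /andP[/Hr h1]; rewrite ltr_pdivlMr// => h2.
rewrite -[X in cabs X](subrK (d * h)) (le_trans (ler_cabsD _ _))//.
rewrite cabsM (le_trans _ (ltW h2))// mulrDr mulr1 addrC mulrC.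
by rewrite lerD2l -[leRHS]mul1r.
Qed.

Lemma ccontD f g z : ccont f z -> ccont g z -> ccont (fun z => f z + g z) z.
Proof.
move=> Hu Hv e e0.
have e20 : 0 < e / 2 by rewrite divr_gt0.
have [r r0 Hr] := Hu _ e20; have [s s0 Hs] := Hv _ e20.
exists (Num.min r s); first by rewrite lt_min r0.
move=> y; rewrite lt_min => /andP[/Hr h1 /Hs h2].
by rewrite opprD addrACA (le_trans (ler_cabsD _ _))// [e]splitr lerD.
Qed.

Lemma ccontZ k g z : ccont g z -> ccont (fun z => k * g z) z.
Proof.
move=> Hu e e0.
have k0 : 0 < cabs k + 1 by rewrite ltr_wpDl// cabs_ge0.
have [r r0 Hr] := Hu _ (divr_gt0 e0 k0).
exists r => // y /Hr h; rewrite -mulrBr cabsM.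
apply: (@le_trans _ _ ((cabs k + 1) * (e / (cabs k + 1)))).
  by rewrite ler_pM ?cabs_ge0// lerDl.
by rewrite mulrC divfK// gt_eqF.
Qed.

Lemma ccont_cst k z : ccont (fun=> k) z.
Proof. by move=> e e0; exists 1 => // h _; rewrite subrr cabs0 ltW. Qed.

Lemma ccont_id z : ccont id z.
Proof. by move=> e e0; exists e => // h /ltW; rewrite addrAC subrr add0r. Qed.

Definition rect a b c d := [set z : C | a <= complex.Re z <= b /\ c <= complex.Im z <= d].

Definition hseg g a b y := cint a b (fun x => g (x +i* y)%C).
Definition vseg g c d x := cint c d (fun y => g (x +i* y)%C).

(** The contour integral of g dz along the boundary of a rectangle, counterclockwise; on vertical
    sides dz = i dy. *)
Definition bd g a b c d : C :=
  hseg g a b c - hseg g a b d + 'i%C * (vseg g c d b - vseg g c d a).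

Lemma hseg_cont g a b y : (forall x, a <= x <= b -> ccont g (x +i* y)%C) ->
  cont_on a b (fun x => g (x +i* y)%C).
Proof.
move=> H x Hx e e0; have [r r0 Hr] := H x Hx e e0; exists r => // t tx.
have -> : (t +i* y = (x +i* y) + (t - x)%:C)%C.
  by apply: eqC_ReIm; rewrite ?ReD ?ImD /= ?addr0// addrC subrK.
by apply: Hr; rewrite cabs_real.
Qed.

Lemma vseg_cont g c d x : (forall y, c <= y <= d -> ccont g (x +i* y)%C) ->
  cont_on c d (fun y => g (x +i* y)%C).
Proof.
move=> H y Hy e e0; have [r r0 Hr] := H y Hy e e0; exists r => // t ty.
have -> : (x +i* t = (x +i* y) + 'i * (t - y)%:C)%C.
  by apply: eqC_ReIm; rewrite ?ReD ?ImD ?Re_mul ?Im_mul /=; ring.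
by apply: Hr; rewrite cabsM cabs_i mul1r cabs_real.
Qed.

Definition rcont g a b c d := [/\ a <= b, c <= d &
  forall z, rect a b c d z -> ccont g z].

Definition bdry a b c d := [set z : C | rect a b c d z /\
  (complex.Re z \in [:: a; b] \/ complex.Im z \in [:: c; d])].

(** Continuity is required on the four sides only, so that integrands with a pole inside the
    rectangle, such as 1/(z - w), are covered. *)
Definition bcont g a b c d := [/\ a <= b, c <= d &
  forall z, bdry a b c d z -> ccont g z].

Lemma rcontW g a b c d : rcont g a b c d -> bcont g a b c d.
Proof. by case=> ? ? h; split=> // z [/h]. Qed.

Section boundary_integral.
Variables (g : C -> C) (a b c d : R).
Hypothesis H : bcont g a b c d.

Lemma bcont_h y : y \in [:: c; d] -> cont_on a b (fun x => g (x +i* y)%C).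
Proof.
case: H => ab cd h Hy; apply: hseg_cont => x Hx; apply: h; split; last by right.
by move: Hy; rewrite !inE => /orP[]/eqP ->; rewrite /rect /= lexx ?cd.
Qed.

Lemma bcont_v x : x \in [:: a; b] -> cont_on c d (fun y => g (x +i* y)%C).
Proof.
case: H => ab cd h Hx; apply: vseg_cont => y Hy; apply: h; split; last by left.
by move: Hx; rewrite !inE => /orP[]/eqP ->; rewrite /rect /= lexx ?ab.
Qed.

Let cc : c \in [:: c; d]. Proof. by rewrite !inE eqxx. Qed.
Let cd : d \in [:: c; d]. Proof. by rewrite !inE eqxx orbT. Qed.
Let aa : a \in [:: a; b]. Proof. by rewrite !inE eqxx. Qed.
Let ab : b \in [:: a; b]. Proof. by rewrite !inE eqxx orbT. Qed.

(** The integral along the cut appears with both signs and cancels formally, so continuity on the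
    outer boundary suffices even if the cut meets a singularity. *)
Lemma bd_splitx m : a <= m <= b -> bd g a b c d = bd g a m c d + bd g m b c d.
Proof.
move=> /andP[am mb]; rewrite /bd /hseg.
rewrite (cint_split am mb (bcont_h cc)) (cint_split am mb (bcont_h cd)); ring.
Qed.

Lemma bd_splity m : c <= m <= d -> bd g a b c d = bd g a b c m + bd g a b m d.
Proof.
move=> /andP[am mb]; rewrite /bd /vseg.
rewrite (cint_split am mb (bcont_v aa)) (cint_split am mb (bcont_v ab)); ring.
Qed.

Lemma bdZ k : bd (fun z => k * g z) a b c d = k * bd g a b c d.
Proof.
rewrite /bd /hseg /vseg (cintZ _ (bcont_h cc)) (cintZ _ (bcont_h cd)).
by rewrite (cintZ _ (bcont_v aa)) (cintZ _ (bcont_v ab)); ring.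
Qed.

Lemma bd_bound M : (forall z, bdry a b c d z -> cabs (g z) <= M) ->
  cabs (bd g a b c d) <= 4 * M * ((b - a) + (d - c)).
Proof.
case: (H) => ab' cd' _ HM.
have Hh y : y \in [:: c; d] -> cabs (hseg g a b y) <= M * (b - a) *+ 2.
  move=> Hy; apply: cint_bound => //; first exact: bcont_h.
  move=> x Hx; apply: HM; split; last by right.
  by move: Hy; rewrite !inE => /orP[]/eqP ->; rewrite /rect /= lexx ?cd'.
have Hv x : x \in [:: a; b] -> cabs (vseg g c d x) <= M * (d - c) *+ 2.
  move=> Hx; apply: cint_bound => //; first exact: bcont_v.
  move=> y Hy; apply: HM; split; last by left.
  by move: Hx; rewrite !inE => /orP[]/eqP ->; rewrite /rect /= lexx ?ab'.
rewrite (le_trans (ler_cabsD _ _))// cabsM cabs_i mul1r.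
have := ler_cabsB (hseg g a b c) (hseg g a b d).
have := ler_cabsB (vseg g c d b) (vseg g c d a).
have := Hh _ cc; have := Hh _ cd; have := Hv _ aa; have := Hv _ ab.
rewrite !mulr2n; clear Hh Hv HM; lra.
Qed.

End boundary_integral.

Lemma bcontD f g a b c d : bcont f a b c d -> bcont g a b c d ->
  bcont (fun z => f z + g z) a b c d.
Proof. by case=> ? ? h1 [_ _ h2]; split=> // z Hz; apply: ccontD; auto. Qed.

Lemma bcontZ k g a b c d : bcont g a b c d -> bcont (fun z => k * g z) a b c d.
Proof. by case=> ? ? h1; split=> // z Hz; apply: ccontZ; auto. Qed.

Lemma bdD f g a b c d : bcont f a b c d -> bcont g a b c d ->
  bd (fun z => f z + g z) a b c d = bd f a b c d + bd g a b c d.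
Proof.
move=> Hf Hg; rewrite /bd /hseg /vseg.
have cc : c \in [:: c; d] by rewrite !inE eqxx.
have cd : d \in [:: c; d] by rewrite !inE eqxx orbT.
have aa : a \in [:: a; b] by rewrite !inE eqxx.
have ab : b \in [:: a; b] by rewrite !inE eqxx orbT.
rewrite (cintD (bcont_h Hf cc) (bcont_h Hg cc)).
rewrite (cintD (bcont_h Hf cd) (bcont_h Hg cd)).
rewrite (cintD (bcont_v Hf aa) (bcont_v Hg aa)).
by rewrite (cintD (bcont_v Hf ab) (bcont_v Hg ab)); ring.
Qed.

Lemma bcont_cst k a b c d : a <= b -> c <= d -> bcont (fun=> k) a b c d.
Proof. by move=> ab cd; split=> // z _; exact: ccont_cst. Qed.

Lemma bcont_id a b c d : a <= b -> c <= d -> bcont id a b c d.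
Proof. by move=> ab cd; split=> // z _; exact: ccont_id. Qed.

Lemma bd_cst k a b c d : a <= b -> c <= d -> bd (fun=> k) a b c d = 0.
Proof. by move=> ab cd; rewrite /bd /hseg /vseg !cint_cst// !subrr mulr0 addr0. Qed.

Lemma bd_id a b c d : a <= b -> c <= d -> bd id a b c d = 0.
Proof.
move=> ab' cd'.
have Hid := bcont_id ab' cd'.
have cc : c \in [:: c; d] by rewrite !inE eqxx.
have cd : d \in [:: c; d] by rewrite !inE eqxx orbT.
have aa : a \in [:: a; b] by rewrite !inE eqxx.
have ab : b \in [:: a; b] by rewrite !inE eqxx orbT.
have -> : bd id a b c d = hseg id a b c + (-1) * hseg id a b d +
  'i%C * (vseg id c d b + (-1) * vseg id c d a) by rewrite /bd; ring.
rewrite /hseg /vseg -(cintZ _ (bcont_h Hid cd)) -(cintZ _ (bcont_v Hid aa)).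
rewrite -(cintD (bcont_h Hid cc) (cont_onZ _ (bcont_h Hid cd))).
rewrite -(cintD (bcont_v Hid ab) (cont_onZ _ (bcont_v Hid aa))).
rewrite (@eq_cint R a b _ (fun=> 'i%C * (c - d)%:C%C)); last first.
  by move=> x _; apply: eqC_ReIm; rewrite ?ReD ?ImD ?Re_mul ?Im_mul /=; ring.
rewrite (@eq_cint R c d _ (fun=> (b - a)%:C%C)); last first.
  by move=> x _; apply: eqC_ReIm; rewrite ?ReD ?ImD ?Re_mul ?Im_mul /=; ring.
by rewrite !cint_cst// !rmorphB /=; ring.
Qed.

Lemma rcont_sub g a b c d a' b' c' d' : rcont g a b c d ->
  a <= a' -> a' <= b' -> b' <= b -> c <= c' -> c' <= d' -> d' <= d ->
  rcont g a' b' c' d'.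
Proof.
case=> _ _ h; move=> h1 h2 h3 h4 h5 h6; split=> // z [/andP[? ?] /andP[? ?]].
by apply: h; split; apply/andP; split; lra.
Qed.

(** Bisection step of Goursat's argument: the four quarter contours add up to the whole one, and
    each quarter has a quarter of the squared size (w + h)^2. If none exceeded the bound at rate e,
    neither would their sum. *)
Lemma quarter g (e a c w h : R) : rcont g a (a + w) c (c + h) ->
  e * (w + h) ^+ 2 < cabs (bd g a (a + w) c (c + h)) ->
  exists p : R * R, [/\ a <= p.1, p.1 + w / 2 <= a + w, c <= p.2,
    p.2 + h / 2 <= c + h &
    e * (w / 2 + h / 2) ^+ 2 < cabs (bd g p.1 (p.1 + w / 2) p.2 (p.2 + h / 2))].
Proof.
move=> H; case: (H) => ab' cd' _ Hlt; apply: contrapT => /forallNP Hn.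
have Hp x y : a <= x -> x + w / 2 <= a + w -> c <= y -> y + h / 2 <= c + h ->
    cabs (bd g x (x + w / 2) y (y + h / 2)) <= e * (w / 2 + h / 2) ^+ 2.
  move=> h1 h2 h3 h4; rewrite leNgt; apply/negP => h5; apply: (Hn (x, y)).
  by split.
have [w0 h0] : 0 <= w /\ 0 <= h by split; lra.
move: Hlt; rewrite (bd_splitx (rcontW H) (m := a + w / 2)); last by apply/andP; split; lra.
have H1 : rcont g a (a + w / 2) c (c + h) by apply: (rcont_sub H); lra.
have H2 : rcont g (a + w / 2) (a + w) c (c + h) by apply: (rcont_sub H); lra.
rewrite (bd_splity (rcontW H1) (m := c + h / 2)); last by apply/andP; split; lra.
rewrite (bd_splity (rcontW H2) (m := c + h / 2)); last by apply/andP; split; lra.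
have e1 : a + w = (a + w / 2) + w / 2 by field.
have e2 : c + h = (c + h / 2) + h / 2 by field.
rewrite e1 e2.
have [s1 s2 s3 s4] : [/\ a <= a + w / 2, a + w / 2 <= a + w, c <= c + h / 2 &
  c + h / 2 <= c + h] by split; lra.
have s5 : a + w / 2 + w / 2 <= a + w by rewrite -e1.
have s6 : c + h / 2 + h / 2 <= c + h by rewrite -e2.
have := Hp _ _ (lexx _) s2 (lexx _) s4; have := Hp _ _ s1 s5 (lexx _) s4.
have := Hp _ _ (lexx _) s2 s3 s6; have := Hp _ _ s1 s5 s3 s6.
rewrite -e1 -e2.
set p1 := bd _ _ _ _ _; set p2 := bd _ _ _ _ _; set p3 := bd _ _ _ _ _.
set p4 := bd _ _ _ _ _.
have -> : e * (w + h) ^+ 2 = e * (w / 2 + h / 2) ^+ 2 *+ 4 by field.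
have := ler_cabsD (p4 + p2) (p3 + p1).
have := ler_cabsD p4 p2; have := ler_cabsD p3 p1.
clear; lra.
Qed.

End goursat.

Section goursat_theorem.
Variable R : realType.
Local Notation C := R[i].
Implicit Types (a b c d x y : R) (f g : C -> C) (z : C).

(** Contour integrals of affine functions vanish, so g may be replaced by its deviation from the
    tangent map at p. The deviation is at most (e/4)(w + h), and [bd_bound] contributes the factor 4
    (w + h). *)
Lemma bd_local g (e : R) p (d : C) : 0 < e -> cderiv g p d ->
  exists2 r, 0 < r & forall a (w : R) c (h : R), rcont g a (a + w) c (c + h) ->
    rect a (a + w) c (c + h) p -> w + h < r ->
    cabs (bd g a (a + w) c (c + h)) <= e * (w + h) ^+ 2.
Proof.
move=> e0 H; have e40 : 0 < e / 4 by rewrite divr_gt0.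
have [r r0 Hr] := H _ e40; exists r => // a w c h Hg [Hp1 Hp2] whr.
case: (Hg) => aw ch _.
have [w0 h0] : 0 <= w /\ 0 <= h by split; lra.
have Hk k := bcont_cst k aw ch.
have Hl : bcont (fun z => d * z) a (a + w) c (c + h) by exact/bcontZ/bcont_id.
pose l z := d * z + (g p - d * p).
have Hll : bcont l a (a + w) c (c + h) by exact: bcontD Hl (Hk _).
have HNl : bcont (fun z => -1 * l z) a (a + w) c (c + h) by exact: bcontZ.
have Hm : bcont (fun z => g z + -1 * l z) a (a + w) c (c + h).
  exact: bcontD (rcontW Hg) HNl.
have l0 : bd l a (a + w) c (c + h) = 0.
  rewrite /l (bdD Hl (Hk _)) bd_cst// addr0.
  by rewrite (bdZ (bcont_id aw ch)) bd_id// mulr0.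
have -> : bd g a (a + w) c (c + h) =
    bd (fun z => g z + -1 * l z) a (a + w) c (c + h).
  by rewrite (bdD (rcontW Hg) HNl) (bdZ Hll) l0 mulr0 addr0.
have := @bd_bound R _ _ _ _ _ Hm (e / 4 * (w + h)).
have -> : 4 * (e / 4 * (w + h)) * (a + w - a + (c + h - c)) = e * (w + h) ^+ 2.
  by field.
apply => z [[Hz1 Hz2] _]; have := Hr (z - p); rewrite (addrC p) subrK => Hz.
have -> : g z + -1 * l z = g z - g p - d * (z - p) by rewrite /l; ring.
have zp : cabs (z - p) <= w + h.
  apply: (le_trans (cabs_le_ReIm _)); rewrite ReD ReN ImD ImN.
  by apply: lerD; rewrite ler_norml; apply/andP; split; lra.
rewrite (le_trans (Hz _))//; first exact: le_lt_trans whr.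
by rewrite ler_wpM2l// ltW.
Qed.

(** An integral exceeding e (w + h)^2 persists under repeated quartering. The nested rectangles
    shrink to a point, where differentiability contradicts the persistence through [bd_local]. *)
Lemma goursat g a (w : R) c (h : R) : rcont g a (a + w) c (c + h) ->
  (forall z, rect a (a + w) c (c + h) z -> exists d : C, cderiv g z d) ->
  bd g a (a + w) c (c + h) = 0.
Proof.
move=> H Hd; apply/eqP; rewrite -cabs_eq0; apply/eqP.
case: (H) => aw ch _.
have [w0 h0] : 0 <= w /\ 0 <= h by split; lra.
suff Hs : forall e, 0 < e -> cabs (bd g a (a + w) c (c + h)) <= e * (w + h) ^+ 2.
  apply/eqP; rewrite eq_le cabs_ge0 andbT; apply/ler_addgt0Pl => e e0.
  have k0 : 0 < (w + h) ^+ 2 + 1 by rewrite ltr_wpDl// sqr_ge0.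
  rewrite addr0 (le_trans (Hs _ (divr_gt0 e0 k0)))//.
  by rewrite mulrAC ler_pdivrMr// ler_wpM2l ?lerDl// ltW.
move=> e e0; rewrite leNgt; apply/negP => Hlt.
pose W n := w / 2 ^+ n; pose Hh n := h / 2 ^+ n.
pose good n (q : R * R) := [/\ a <= q.1, q.1 + W n <= a + w, c <= q.2,
  q.2 + Hh n <= c + h &
  e * (W n + Hh n) ^+ 2 < cabs (bd g q.1 (q.1 + W n) q.2 (q.2 + Hh n))].
have WS n : W n.+1 = W n / 2 by rewrite /W exprSr invfM mulrA.
have HS n : Hh n.+1 = Hh n / 2 by rewrite /Hh exprSr invfM mulrA.
have W0 n : 0 <= W n by rewrite divr_ge0// exprn_ge0.
have H0 n : 0 <= Hh n by rewrite divr_ge0// exprn_ge0.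
have step n q : good n q -> exists q', [/\ q.1 <= q'.1,
    q'.1 + W n.+1 <= q.1 + W n, q.2 <= q'.2, q'.2 + Hh n.+1 <= q.2 + Hh n
    & good n.+1 q'].
  case=> g1 g2 g3 g4 g5.
  have Hq : rcont g q.1 (q.1 + W n) q.2 (q.2 + Hh n).
    by apply: (rcont_sub H) => //; rewrite lerDl.
  have [q' [k1 k2 k3 k4 k5]] := quarter Hq g5.
  exists q'; rewrite /good !WS !HS; split => //.
  by split => //; [exact: le_trans k1|exact: le_trans k2 _|exact: le_trans k3
    |exact: le_trans k4 _].
(* The default value [q] is never taken along the sequence, since [step] provides a successor of
   every good corner. *)
pose nxt n q := xget q [set q' | [/\ q.1 <= q'.1,
    q'.1 + W n.+1 <= q.1 + W n, q.2 <= q'.2, q'.2 + Hh n.+1 <= q.2 + Hh n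
    & good n.+1 q']].
pose Q := fix Q n := if n is m.+1 then nxt m (Q m) else (a, c).
have Qg n : good n (Q n).
  elim: n => [|n IH] /=.
    by rewrite /good /W /Hh expr0 !divr1; split.
  rewrite /nxt; case: xgetP => [q' _ []//|Hn].
  by have [q' Hq'] := step _ _ IH; case: (Hn q' Hq').
have Qs n : [/\ (Q n).1 <= (Q n.+1).1, (Q n.+1).1 + W n.+1 <= (Q n).1 + W n,
    (Q n).2 <= (Q n.+1).2 & (Q n.+1).2 + Hh n.+1 <= (Q n).2 + Hh n].
  rewrite /= /nxt; case: xgetP => [q' _ []//|Hn].
  by have [q' Hq'] := step _ _ (Qg n); case: (Hn q' Hq').
have nested (u V : nat -> R) : (forall n, 0 <= V n) ->
    (forall n, u n <= u n.+1) -> (forall n, u n.+1 + V n.+1 <= u n + V n) ->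
    exists x, forall n, u n <= x <= u n + V n.
  move=> V0 u1 u2.
  have mono n k : u n <= u (n + k)%N.
    by elim: k => [|k IH]; rewrite ?addn0// addnS (le_trans IH).
  have mono2 n k : u (n + k)%N + V (n + k)%N <= u n + V n.
    by elim: k => [|k IH]; rewrite ?addn0// addnS (le_trans _ IH).
  have ub n m : u m <= u n + V n.
    have [nm|/ltnW mn] := leqP n m.
      by rewrite (le_trans _ (mono2 n (m - n)%N))// subnKC// lerDl.
    by rewrite (le_trans (mono m (n - m)%N))// subnKC// lerDl.
  exists (sup (range u)) => n; apply/andP; split.
    by apply: ub_le_sup; [exists (u 0%N + V 0%N) => _ [m _ <-]|exists n].
  by apply: ge_sup; [exists (u 0%N), 0%N|move=> _ [m _ <-]].
have [x Hx] := @nested (fun n => (Q n).1) W W0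
  (fun n => let: And4 h _ _ _ := Qs n in h)
  (fun n => let: And4 _ h _ _ := Qs n in h).
have [y Hy] := @nested (fun n => (Q n).2) Hh H0
  (fun n => let: And4 _ _ h _ := Qs n in h)
  (fun n => let: And4 _ _ _ h := Qs n in h).
have Hxy : rect a (a + w) c (c + h) (x +i* y)%C.
  split => /=.
    by have := Hx 0%N; rewrite /= /W expr0 divr1.
  by have := Hy 0%N; rewrite /= /Hh expr0 divr1.
have [d Hdp] := Hd _ Hxy.
have [r r0 Hr] := bd_local e0 Hdp.
(* The size at level n is (w + h)/2^n, and 2^n > n: an integer bound of (w + h)/r is deep enough. *)
have [n Hn] : exists n, W n + Hh n < r.
  pose n := Num.bound ((w + h) / r); exists n.
  rewrite -mulrDl ltr_pdivrMr ?exprn_gt0// mulrC -ltr_pdivrMr//.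
  rewrite (lt_trans (archi_boundP _)) ?divr_ge0 ?addr_ge0 ?(ltW r0)//.
  by rewrite -natrX ltr_nat ltn_expl.
have [g1 g2 g3 g4] := Qg n; apply/negP; rewrite -leNgt.
apply: Hr => //.
by apply: (rcont_sub H) => //; rewrite lerDl.
Qed.

End goursat_theorem.

(** * Rules for the complex derivative *)

Section cderiv_rules.
Variable R : realType.
Local Notation C := R[i].
Implicit Types (f g : C -> C) (z w d : C).

Lemma cderiv_near f g z d (r : R) : 0 < r ->
  (forall h, cabs h < r -> f (z + h) = g (z + h)) -> cderiv f z d -> cderiv g z d.
Proof.
move=> r0 fg Hf e e0; have [s s0 Hs] := Hf e e0.
exists (Num.min r s); first by rewrite lt_min r0.
move=> h; rewrite lt_min => /andP[hr /Hs hs].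
by rewrite -fg// -[g z](_ : f z = _)// -[z]addr0 fg// cabs0.
Qed.

Lemma cderiv_cst k z : cderiv (fun=> k) z 0.
Proof.
by move=> e e0; exists 1 => // h _; rewrite subrr mul0r subr0 cabs0
  mulr_ge0 ?cabs_ge0// ltW.
Qed.

Lemma cderivD f g z d d' : cderiv f z d -> cderiv g z d' ->
  cderiv (fun z => f z + g z) z (d + d').
Proof.
move=> Hf Hg e e0; have e2 : 0 < e / 2 by rewrite divr_gt0.
have [r r0 Hr] := Hf _ e2; have [s s0 Hs] := Hg _ e2.
exists (Num.min r s); first by rewrite lt_min r0.
move=> h; rewrite lt_min => /andP[/Hr h1 /Hs h2].
rewrite (_ : _ - _ = f (z + h) - f z - d * h + (g (z + h) - g z - d' * h));
  last by ring.
rewrite (le_trans (ler_cabsD _ _))// (le_trans (lerD h1 h2))//.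
by rewrite -mulrDl -splitr.
Qed.

Lemma ccont_cabs_lt f z : ccont f z -> exists2 r : R, 0 < r &
  forall h, cabs h < r -> cabs (f (z + h)) <= cabs (f z) + 1.
Proof.
move=> /(_ 1 ltr01)[r r0 Hr]; exists r => // h /Hr h1.
by rewrite -[X in cabs X](subrK (f z)) (le_trans (ler_cabsD _ _))// addrC lerD2l.
Qed.

Lemma cderivM f g z d d' : cderiv f z d -> cderiv g z d' ->
  cderiv (fun z => f z * g z) z (d * g z + f z * d').
Proof.
move=> Hf Hg e e0; have [r1 r10 Hb] := ccont_cabs_lt (cderiv_ccont Hf).
(* [K] dominates each of the three factors f(z + h), d' and g(z) that multiply a small quantity in
   the decomposition below; each of the three products then costs e/3. *)
pose K := cabs (f z) + 1 + (cabs d' + cabs (g z)) + 1.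
have K0 : 0 < K by rewrite /K ltr_wpDl// !addr_ge0 ?cabs_ge0.
have e3 : 0 < e / 3 / K by rewrite !divr_gt0.
have [r2 r20 H2] := Hf _ e3; have [r3 r30 H3] := Hg _ e3.
have [r4 r40 H4] := cderiv_ccont Hf e3.
exists (Num.min (Num.min r1 r2) (Num.min r3 r4)); first by rewrite !lt_min r10 r20 r30.
move=> h; rewrite !lt_min => /andP[/andP[/Hb h1 /H2 h2] /andP[/H3 h3 /H4 h4]].
rewrite (_ : _ - _ = f (z + h) * (g (z + h) - g z - d' * h) +
  d' * h * (f (z + h) - f z) + g z * (f (z + h) - f z - d * h)); last by ring.
have B (x y : R) : 0 <= x -> x <= K -> y <= e / 3 / K * cabs h ->
    x * y <= e / 3 * cabs h.
  move=> x0 xK yh; rewrite (le_trans (ler_wpM2l x0 yh))//.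
  rewrite mulrA ler_wpM2r ?cabs_ge0// mulrCA -[leRHS]mulr1 ler_pM2l ?divr_gt0//.
  by rewrite ler_pdivrMr// mul1r.
rewrite (le_trans (ler_cabsD _ _))//.
have -> : e * cabs h = e / 3 * cabs h + e / 3 * cabs h + e / 3 * cabs h by field.
rewrite lerD//; last first.
  rewrite cabsM B ?cabs_ge0// /K; have := cabs_ge0 (f z); have := cabs_ge0 d'.
  by lra.
rewrite (le_trans (ler_cabsD _ _))// lerD// !cabsM.
  rewrite B ?cabs_ge0// (le_trans h1)// /K.
  by have := cabs_ge0 (g z); have := cabs_ge0 d'; lra.
rewrite -mulrA B ?cabs_ge0//; last by rewrite mulrC ler_wpM2r ?cabs_ge0.
by rewrite /K; have := cabs_ge0 (g z); have := cabs_ge0 (f z); lra.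
Qed.

Lemma cderivV z : z != 0 -> cderiv (fun z => z^-1) z (- z ^- 2).
Proof.
move=> z0 e e0; have cz : 0 < cabs z by rewrite cabs_gt0.
exists (Num.min (cabs z / 2) (e * cabs z ^+ 3 / 2)).
  by rewrite lt_min !divr_gt0// mulr_gt0// exprn_gt0.
move=> h; rewrite lt_min => /andP[h1 h2].
have zh : cabs z / 2 <= cabs (z + h) by have := lerB_cabsD z h; lra.
have zh0 : z + h != 0 by rewrite -cabs_gt0 (lt_le_trans _ zh)// divr_gt0.
rewrite (_ : _ - _ = h * (h / (z ^+ 2 * (z + h)))); last first.
  by field; rewrite zh0 z0.
rewrite cabsM mulrC ler_wpM2r ?cabs_ge0// cabsM cabsV cabsM cabsX.
have p0 : 0 < cabs z ^+ 2 by rewrite exprn_gt0.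
rewrite ler_pdivrMr ?mulr_gt0 ?cabs_gt0// (le_trans (ltW h2))//.
apply: (le_trans _ (y := e * cabs z ^+ 2 * cabs (z + h))); last by rewrite -mulrA.
apply: le_trans (ler_wpM2l (ltW (mulr_gt0 e0 p0)) zh).
by rewrite le_eqVlt; apply/orP; left; apply/eqP; field.
Qed.

Lemma cderivB f z w d : cderiv f (z - w) d -> cderiv (fun z => f (z - w)) z d.
Proof.
move=> H e e0; have [r r0 Hr] := H e e0; exists r => // h /Hr.
by rewrite (addrAC z h).
Qed.

Lemma cderivXV n z : z != 0 -> exists d, cderiv (fun z => z ^- n) z d.
Proof.
move=> z0; elim: n => [|n [d IH]].
  exists 0; apply: (@cderiv_near (fun=> 1) _ _ _ 1) (cderiv_cst _ _) => //.
  by move=> h _; rewrite expr0 invr1.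
eexists; apply: (@cderiv_near (fun z => z ^- n * z^-1) _ _ _ 1) => //.
  by move=> h _; rewrite exprS invfM mulrC.
exact: (cderivM IH (cderivV z0)).
Qed.

End cderiv_rules.

Section cauchy.
Variable R : realType.
Local Notation C := R[i].
Implicit Types (f g : C -> C) (z w : C) (a b c d : R).

Definition cdiff g z := exists d : C, cderiv g z d.

Lemma cdiff_ccont g z : cdiff g z -> ccont g z.
Proof. by case=> d /cderiv_ccont. Qed.

Lemma goursat_rect g a b c d : a <= b -> c <= d ->
  (forall z, rect a b c d z -> cdiff g z) -> bd g a b c d = 0.
Proof.
move=> ab cd H; have := @goursat R g a (b - a) c (d - c).
rewrite !(addrC _ (_ - _)) !subrK; apply => //.
by split => // z /H /cdiff_ccont.
Qed.

(** Two vertical and two horizontal cuts split off four outer rectangles around the open hole. On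
    these the function is differentiable and Goursat applies; only the inner rectangle remains. *)
Lemma bd_nested g a b c d a' b' c' d' :
  a <= a' -> a' <= b' -> b' <= b -> c <= c' -> c' <= d' -> d' <= d ->
  (forall z, rect a b c d z ->
    ~ (a' < complex.Re z < b' /\ c' < complex.Im z < d') -> cdiff g z) ->
  bd g a b c d = bd g a' b' c' d'.
Proof.
move=> h1 h2 h3 h4 h5 h6 H.
have D a1 b1 c1 d1 : a <= a1 -> b1 <= b -> c <= c1 -> d1 <= d ->
    [\/ b1 <= a', b' <= a1, d1 <= c' | d' <= c1] ->
    forall z, rect a1 b1 c1 d1 z -> cdiff g z.
  move=> k1 k2 k3 k4 k5 z [/andP[z1 z2] /andP[z3 z4]]; apply: H.
    by split; apply/andP; split; lra.
  by case=> /andP[z5 z6] /andP[z7 z8]; case: k5 => ?; lra.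
(* The full-height rectangles met between successive vertical cuts. Their sides avoid the open hole,
   which gives the boundary continuity that the next splitting requires. *)
have B a1 b1 : a <= a1 -> a1 <= b1 -> b1 <= b ->
    [\/ (a1 = a) /\ (b1 = b), (a1 = a') /\ (b1 = b) | (a1 = a') /\ (b1 = b')] ->
    bcont g a1 b1 c d.
  move=> k1 k2 k3 k4; split => //; first lra.
  move=> z [[/andP[z1 z2] /andP[z3 z4]] z5]; apply/cdiff_ccont/H.
    by split; apply/andP; split; lra.
  move=> [/andP[z6 z7] /andP[z8 z9]].
  by case: z5; rewrite !inE => /orP[]/eqP; case: k4 => -[]; lra.
have E a1 b1 : a1 = a' -> b1 = b' -> bcont g a1 b1 c' d.
  move=> -> ->; split => //; first lra.
  move=> z [[/andP[z1 z2] /andP[z3 z4]] z5]; apply/cdiff_ccont/H.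
    by split; apply/andP; split; lra.
  move=> [/andP[z6 z7] /andP[z8 z9]].
  by case: z5; rewrite !inE => /orP[]/eqP; lra.
have B1 : bcont g a b c d by apply: B; [lra|lra|lra|constructor 1].
have B2 : bcont g a' b c d by apply: B; [lra|lra|lra|constructor 2].
have B3 : bcont g a' b' c d by apply: B; [lra|lra|lra|constructor 3].
have B4 := E _ _ erefl erefl.
rewrite (bd_splitx B1 (m := a')); last by apply/andP; split; lra.
rewrite (goursat_rect (a := a) (b := a')); [|lra|lra|by apply: D; try lra; constructor 1].
rewrite (bd_splitx B2 (m := b')); last by apply/andP; split; lra.
rewrite [X in _ + (_ + X)](goursat_rect (a := b') (b := b)); [|lra|lra|by apply: D; try lra; constructor 2].
rewrite (bd_splity B3 (m := c')); last by apply/andP; split; lra.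
rewrite (goursat_rect (c := c) (d := c')); [|lra|lra|by apply: D; try lra; constructor 3].
rewrite (bd_splity B4 (m := d')); last by apply/andP; split; lra.
rewrite [X in _ + (_ + (_ + X) + _)](goursat_rect (c := d') (d := d)); [|lra|lra|by apply: D; try lra; constructor 4].
by rewrite !add0r !addr0.
Qed.

End cauchy.

(** * Cauchy's formula and its expansion on squares *)

Section taylor.
Variable R : realType.
Local Notation C := R[i].
Implicit Types (f g : C -> C) (z w : C) (a b c d r rho : R).

Lemma cdiffM f g z : cdiff f z -> cdiff g z -> cdiff (fun z => f z * g z) z.
Proof. by case=> d Hd [d' Hd']; eexists; exact: cderivM Hd Hd'. Qed.

Lemma cdiffD f g z : cdiff f z -> cdiff g z -> cdiff (fun z => f z + g z) z.
Proof. by case=> d Hd [d' Hd']; eexists; exact: cderivD Hd Hd'. Qed.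

Lemma cdiff_cst k z : cdiff (fun=> k) z.
Proof. by eexists; exact: cderiv_cst. Qed.

Lemma cdiff_subV w z : z != w -> cdiff (fun z => (z - w)^-1) z.
Proof.
move=> zw; eexists; apply: (cderivB (f := fun z => z^-1)).
by apply: cderivV; rewrite subr_eq0.
Qed.

Lemma eq_bd f g a b c d : a <= b -> c <= d ->
  (forall z, bdry a b c d z -> f z = g z) -> bd f a b c d = bd g a b c d.
Proof.
move=> ab cd H.
have hE y : y \in [:: c; d] -> hseg f a b y = hseg g a b y.
  move=> Hy; apply: eq_cint => x Hx; apply: H; split; last by right.
  by move: Hy; rewrite !inE => /orP[]/eqP ->; rewrite /rect /= lexx ?cd.
have vE x : x \in [:: a; b] -> vseg f c d x = vseg g c d x.
  move=> Hx; apply: eq_cint => y Hy; apply: H; split; last by left.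
  by move: Hx; rewrite !inE => /orP[]/eqP ->; rewrite /rect /= lexx ?ab.
by rewrite /bd !hE ?vE// !inE eqxx ?orbT.
Qed.

Definition sq g rho : C := bd g (- rho) rho (- rho) rho.
Definition sqb rho := bdry (- rho) rho (- rho) rho : set C.

Lemma sqb_ge rho z : sqb rho z -> rho <= cabs z.
Proof.
case=> _ [] ; rewrite !inE => /orP[]/eqP h.
- by rewrite (le_trans _ (Re_le_cabs z))// h normrN ler_norm.
- by rewrite (le_trans _ (Re_le_cabs z))// h ler_norm.
- by rewrite (le_trans _ (Im_le_cabs z))// h normrN ler_norm.
- by rewrite (le_trans _ (Im_le_cabs z))// h ler_norm.
Qed.

Lemma sq_indep g r rho : 0 < r -> r <= rho ->
  (forall z, z != 0 -> cdiff g z) -> sq g rho = sq g r.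
Proof.
move=> r0 rr H; apply: bd_nested; try lra.
move=> z _ Hz; apply: H; apply/eqP => z0; apply: Hz; rewrite z0 /=.
by split; apply/andP; split; lra.
Qed.

Lemma cabs_lip z w : `|cabs z - cabs w| <= cabs (z - w).
Proof.
rewrite ler_norml lerB_cabs andbT lerNl opprB cabsB; exact: lerB_cabs.
Qed.

Lemma cont_on_bounded a b (u : R -> C) : a <= b -> cont_on a b u ->
  exists M : R, forall x, a <= x <= b -> cabs (u x) <= M.
Proof.
move=> ab Hu; have /(EVT_max ab)[x _ Hx] := cont_on_within Hu cabs_lip.
by exists (cabs (u x)) => y Hy; apply: Hx; rewrite in_itv.
Qed.

Lemma bcont_bounded g a b c d : bcont g a b c d ->
  exists2 M : R, 0 <= M & forall z, bdry a b c d z -> cabs (g z) <= M.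
Proof.
move=> H; case: (H) => ab cd _.
have [|M1 H1] := cont_on_bounded ab (bcont_h H (y := c) _).
  by rewrite !inE eqxx.
have [|M2 H2] := cont_on_bounded ab (bcont_h H (y := d) _).
  by rewrite !inE eqxx orbT.
have [|M3 H3] := cont_on_bounded cd (bcont_v H (x := a) _).
  by rewrite !inE eqxx.
have [|M4 H4] := cont_on_bounded cd (bcont_v H (x := b) _).
  by rewrite !inE eqxx orbT.
exists (`|M1| + `|M2| + `|M3| + `|M4|); first by rewrite !addr_ge0.
have N1 := ler_norm M1; have N2 := ler_norm M2; have N3 := ler_norm M3.
have N4 := ler_norm M4.
have P1 := normr_ge0 M1; have P2 := normr_ge0 M2; have P3 := normr_ge0 M3.
have P4 := normr_ge0 M4.
move=> [x y] [[/= Hx Hy] []]; rewrite !inE => /orP[]/eqP h; subst.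
- by have := H3 _ Hy; lra.
- by have := H4 _ Hy; lra.
- by have := H1 _ Hx; lra.
- by have := H2 _ Hx; lra.
Qed.

Lemma bcont_cdiff g a b c d : a <= b -> c <= d ->
  (forall z, bdry a b c d z -> cdiff g z) -> bcont g a b c d.
Proof. by move=> ab cd H; split => // z /H/cdiff_ccont. Qed.

Section formula.
Variables (f : C -> C) (w : C) (rho : R).
Hypothesis fd : forall z, cdiff f z.
Hypothesis wr : cabs w < rho.

Let rho0 : 0 < rho. Proof. exact: le_lt_trans (cabs_ge0 w) wr. Qed.
Let rhole : - rho <= rho. Proof. by rewrite lerNl; have := rho0; lra. Qed.

Let neqw z : sqb rho z -> z != w.
Proof.
by move=> /sqb_ge h; apply/eqP => zw; move: wr; rewrite -zw ltNge h.
Qed.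
Let neq0 z : sqb rho z -> z != 0.
Proof. by move=> /sqb_ge h; rewrite -cabs_gt0 (lt_le_trans rho0). Qed.

(** The difference quotient at w, completed by the derivative, is continuous at w and differentiable
    elsewhere. Its contour shrinks to arbitrarily small squares around w, where it stays bounded, so
    its integral is 0. The integral of 1/(z - w) is left unevaluated. *)
Lemma cauchy_sq : sq (fun z => f z * (z - w)^-1) rho =
  f w * sq (fun z => (z - w)^-1) rho.
Proof.
have [d Hd] := fd w.
pose G z := if z == w then d else (f z - f w) * (z - w)^-1.
have GE z : z != w -> G z = (f z - f w) * (z - w)^-1 by rewrite /G => /negbTE ->.
have Gd z : z != w -> cdiff G z.
  move=> zw; have : cdiff (fun z => (f z - f w) * (z - w)^-1) z.
    apply: cdiffM; last exact: cdiff_subV.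
    by apply: cdiffD; [exact: fd|exact: cdiff_cst].
  case=> e He; exists e; apply: (cderiv_near (r := cabs (z - w))) He.
    by rewrite cabs_gt0 subr_eq0.
  move=> h hz; rewrite GE//; apply/eqP => zhw.
  by move: hz; rewrite -zhw opprD addNKr cabsN ltxx.
have Gw : ccont G w.
  move=> e e0; have [r r0 Hr] := Hd e e0; exists r => // h /Hr.
  rewrite {2}/G eqxx; have [->|h0] := eqVneq h 0.
    by move=> _; rewrite addr0 /G eqxx subrr cabs0 ltW.
  rewrite GE; last by rewrite -subr_eq0 addrC addKr.
  rewrite -(ler_pM2r (x := (cabs h)^-1)) ?invr_gt0 ?cabs_gt0//.
  rewrite mulfK ?cabs_eq0// -cabsV -cabsM mulrBl mulfK//.
  by rewrite (addrC w) addrK.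
have Gc z : ccont G z.
  by have [->//|/Gd/cdiff_ccont] := eqVneq z w.
have G0 : sq G rho = 0.
  have [r1 r10 Hr1] := ccont_cabs_lt Gw.
  have wR := le_lt_trans (Re_le_cabs w) wr; rewrite ltr_norml in wR.
  have wI := le_lt_trans (Im_le_cabs w) wr; rewrite ltr_norml in wI.
  have /andP[wR1 wR2] := wR; have /andP[wI1 wI2] := wI.
  pose m := Num.min (r1 / 2) (Num.min (Num.min (complex.Re w + rho) (rho - complex.Re w))
     (Num.min (complex.Im w + rho) (rho - complex.Im w))).
  have m0 : 0 < m by rewrite !lt_min; do !(apply/andP; split); lra.
  have mP e : e <= m -> [/\ e <= r1 / 2, e <= complex.Re w + rho, e <= rho - complex.Re w,
      e <= complex.Im w + rho & e <= rho - complex.Im w].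
    by rewrite !le_min => /and3P[? /andP[? ?] /andP[? ?]]; split.
  apply/eqP; rewrite -cabs_eq0 eq_le cabs_ge0 andbT; apply/ler_addgt0Pl => e e0.
  rewrite addr0.
  (* On the square of half-side [q] around w, [bd_bound] gives 4 (|G w| + 1) times 4 q. *)
  pose K := 16 * (cabs (G w) + 1) + 1.
  have K0 : 0 < K by rewrite /K; have := cabs_ge0 (G w); lra.
  pose q := Num.min (m / 2) (e / K).
  have q0 : 0 < q by rewrite lt_min !divr_gt0.
  have [q1 q2 q3 q4 q5] : [/\ q < r1 / 2, q <= complex.Re w + rho, q <= rho - complex.Re w,
      q <= complex.Im w + rho & q <= rho - complex.Im w].
    have qm : q <= m / 2 by rewrite ge_min lexx.
    by have := mP m (lexx _); case=> *; split; lra.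
  have -> : sq G rho = bd G (complex.Re w - q) (complex.Re w + q)
      (complex.Im w - q) (complex.Im w + q).
    apply: bd_nested; try lra.
    move=> z _ Hz; apply: Gd; apply/eqP => zw; apply: Hz; rewrite zw.
    by split; apply/andP; split; lra.
  have Gb : bcont G (complex.Re w - q) (complex.Re w + q)
      (complex.Im w - q) (complex.Im w + q) by split => //; lra.
  apply: le_trans (bd_bound Gb (M := cabs (G w) + 1) _) _; last first.
    have : q * K <= e by rewrite -ler_pdivlMr// ge_min lexx orbT.
    by rewrite /K; have := cabs_ge0 (G w); nra.
  move=> z [[Hz1 Hz2] _]; have := Hr1 (z - w); rewrite (addrC w) subrK; apply.
  apply: (le_lt_trans (cabs_le_ReIm _)); rewrite ReD ReN ImD ImN.
  apply: (@le_lt_trans _ _ (q + q)); last lra.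
  by apply: lerD; rewrite ler_norml; apply/andP; split; lra.
have Vb : bcont (fun z => (z - w)^-1) (- rho) rho (- rho) rho.
  by apply: bcont_cdiff => // z /neqw; exact: cdiff_subV.
have Gb : bcont G (- rho) rho (- rho) rho by split.
rewrite /sq -(bdZ Vb) -[RHS]add0r -[X in X + _]G0 /sq -(bdD Gb (bcontZ _ Vb)).
apply: eq_bd => // z /neqw zw; rewrite GE//; ring.
Qed.

Let fN_cdiff N z : z != 0 -> cdiff (fun z => f z * z ^- N) z.
Proof. by move=> z0; apply: cdiffM (fd z) _; exact: cderivXV. Qed.

Let fNw N : bcont (fun z => f z * z ^- N * (z - w)^-1) (- rho) rho (- rho) rho.
Proof.
apply: bcont_cdiff => // z Hz; apply: cdiffM; first exact/fN_cdiff/neq0.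
exact/cdiff_subV/neqw.
Qed.

Let fN N : bcont (fun z => f z * z ^- N) (- rho) rho (- rho) rho.
Proof. by apply: bcont_cdiff => // z /neq0 Hz; exact/fN_cdiff. Qed.

(** Iterates 1/(z - w) = 1/z + w / (z (z - w)). Keeping the remainder explicit avoids exchanging a
    series with the contour integral. *)
Lemma cauchy_expand N : sq (fun z => f z * (z - w)^-1) rho =
  \sum_(n < N) sq (fun z => f z * z ^- n.+1) rho * w ^+ n +
  w ^+ N * sq (fun z => f z * z ^- N * (z - w)^-1) rho.
Proof.
elim: N => [|N IH].
  rewrite big_ord0 add0r mul1r; apply: eq_bd => // z _.
  by rewrite expr0 invr1 mulr1.
rewrite big_ord_recr/= IH -addrA; congr (_ + _).
rewrite exprSr [X in X + _]mulrC -mulrA -mulrDr; congr (_ * _).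
rewrite /sq -(bdZ (fNw N.+1)) -(bdD (fN _) (bcontZ _ (fNw N.+1))).
apply: eq_bd => // z Hz; have zw := neqw Hz; have z0 := neq0 Hz.
by rewrite !exprSr; field; rewrite subr_eq0 zw z0 expf_neq0.
Qed.

Lemma cauchy_coef_bound : exists2 M : R, 0 <= M &
  forall n, cabs (sq (fun z => f z * z ^- n) rho) <= M * rho ^- n.
Proof.
have Hf : bcont f (- rho) rho (- rho) rho.
  by apply: bcont_cdiff => // z _; exact: fd.
have [M M0 HM] := bcont_bounded Hf.
exists (16 * rho * M) => [|n]; first by rewrite !mulr_ge0// ltW.
apply: le_trans (bd_bound (fN n) (M := M * rho ^- n) _) _.
  move=> z Hz; rewrite cabsM ler_pM ?cabs_ge0 ?HM//.
  rewrite cabsV cabsX lef_pV2 ?posrE ?exprn_gt0 ?cabs_gt0 ?neq0//.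
  by rewrite lerXn2r ?nnegrE ?cabs_ge0 ?(ltW rho0)// sqb_ge.
by rewrite le_eqVlt; apply/orP; left; apply/eqP; ring.
Qed.

Lemma cauchy_remainder : exists M : R, forall N,
  cabs (w ^+ N * sq (fun z => f z * z ^- N * (z - w)^-1) rho) <=
  M * (cabs w / rho) ^+ N.
Proof.
have Hf : bcont f (- rho) rho (- rho) rho.
  by apply: bcont_cdiff => // z _; exact: fd.
have [M M0 HM] := bcont_bounded Hf.
exists (16 * rho * M / (rho - cabs w)) => n.
rewrite cabsM cabsX expr_div_n mulrCA ler_wpM2l ?exprn_ge0 ?cabs_ge0//.
apply: le_trans (bd_bound (fNw n) (M := M * rho ^- n / (rho - cabs w)) _) _.
  move=> z Hz; rewrite !cabsM ler_pM ?mulr_ge0 ?cabs_ge0//; last first.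
    rewrite cabsV lef_pV2 ?posrE ?subr_gt0 ?cabs_gt0 ?subr_eq0 ?neqw//.
    by apply: le_trans (lerB_cabs z w); rewrite lerD2r sqb_ge.
  rewrite ler_pM ?cabs_ge0 ?HM//.
  rewrite cabsV cabsX lef_pV2 ?posrE ?exprn_gt0 ?cabs_gt0 ?neq0//.
  by rewrite lerXn2r ?nnegrE ?cabs_ge0 ?(ltW rho0)// sqb_ge.
by rewrite le_eqVlt; apply/orP; left; apply/eqP; ring.
Qed.

End formula.
End taylor.

(** * Power series *)

Section power_series.
Variable R : realType.
Local Notation C := R[i].
Implicit Types (f g : C -> C) (z w : C) (r rho : R).

Definition cser (a : nat -> C) (l : C) :=
  (fun N => cabs (l - \sum_(n < N) a n)) @ \oo --> (0 : R).

Let one_cdiff z : cdiff (fun=> 1 : C) z := cdiff_cst 1 z.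

Lemma winding_indep n rho : 0 < rho ->
  sq (fun z => 1 * z ^- n) rho = sq (fun z : C => 1 * z ^- n) 1.
Proof.
move=> rho0; have H z : z != 0 -> cdiff (fun z => 1 * z ^- n) z.
  by move=> z0; apply: cdiffM (one_cdiff z) _; exact: cderivXV.
have [h|/ltW h] := leP 1 rho; first exact: sq_indep.
by apply/esym; exact: sq_indep.
Qed.

(** The integral is independent of the square, yet [bd_bound] makes it at most 16 rho^-(n+1) on the
    square of half-side rho; [rho] is taken large enough for this to be below e. *)
Lemma winding0 n : sq (fun z : C => 1 * z ^- n.+2) 1 = 0.
Proof.
apply/eqP; rewrite -cabs_eq0 eq_le cabs_ge0 andbT; apply/ler_addgt0Pl => e e0.
rewrite addr0; pose rho := 1 + 16 / e.
have rho1 : 1 <= rho by rewrite lerDl divr_ge0// ltW.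
have rho0 : 0 < rho by apply: lt_le_trans rho1.
have r0 : - rho <= rho by lra.
rewrite -(winding_indep _ rho0).
have zrho z : sqb rho z -> rho <= cabs z by exact: sqb_ge.
apply: le_trans (bd_bound (M := rho ^- n.+2) _ _) _.
- apply: bcont_cdiff => // z /zrho h.
  apply: cdiffM (one_cdiff z) _; apply: cderivXV.
  by rewrite -cabs_gt0 (lt_le_trans rho0).
- move=> z /zrho h; have z0 : 0 < cabs z by exact: lt_le_trans h.
  rewrite mul1r cabsV cabsX lef_pV2 ?posrE ?exprn_gt0//.
  by rewrite lerXn2r ?nnegrE ?(ltW rho0) ?(ltW z0).
have -> : 4 * rho ^- n.+2 * (rho - - rho + (rho - - rho)) = 16 / rho / rho ^+ n.
  by rewrite !exprS; field; rewrite ?expf_neq0 ?gt_eqF.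
rewrite ler_pdivrMr ?exprn_gt0// (@le_trans _ _ e)//; last first.
  by rewrite ler_peMr ?(ltW e0)// exprn_ege1.
by rewrite ler_pdivrMr// mulrDr mulr1 mulrCA mulfV ?gt_eqF// mulr1 lerDr ltW.
Qed.

Lemma rint_upper a b m (u : R -> R) : a <= b ->
  (@lebesgue_measure R).-integrable `[a, b] (EFin \o u) ->
  (forall x, a <= x <= b -> u x <= m) -> rint a b u <= m * (b - a).
Proof.
move=> ab Hu HM; rewrite -(rint_cst m ab); apply: le_Rintegral => //.
apply: continuous_compact_integrable; first exact: segment_compact.
by apply: continuous_subspaceT => x; apply: cst_continuous.
Qed.

(** Each side of the unit square contributes the integral of 1/(1 + x^2) over [-1, 1] to the
    imaginary part, with the same sign after orientation. As 1 + x^2 <= 2 there, the bound 1/2 on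
    the integrand already gives positivity. *)
Lemma winding1 : sq (fun z : C => 1 * z ^- 1) 1 != 0.
Proof.
have H : bcont (fun z : C => 1 * z ^- 1) (-1) 1 (-1) 1.
  apply: bcont_cdiff; [lra|lra|] => z /sqb_ge h.
  apply: cdiffM (one_cdiff z) _; apply: cderivXV.
  by rewrite -cabs_gt0 (lt_le_trans _ h).
have B (x : R) : -1 <= x <= 1 -> 1 / 2 <= 1 / (1 + x ^+ 2).
  move=> /andP[x1 x2]; rewrite ler_pdivlMr; last by rewrite ltr_wpDr ?sqr_ge0.
  by nra.
have I (x y : R) : ((x +i* y)^-1 = (x / (x ^+ 2 + y ^+ 2)) -i* (y / (x ^+ 2 + y ^+ 2)))%C.
  by [].
suff : 0 < complex.Im (sq (fun z : C => 1 * z ^- 1) 1).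
  by apply: contraL => /eqP ->; rewrite /= ltxx.
have l11 : (-1 : R) <= 1 by lra.
have := rint_lower l11 (cont_on_intIm (bcont_h H (y := -1) _)) (m := 1 / 2).
have := rint_upper l11 (cont_on_intIm (bcont_h H (y := 1) _)) (m := - (1 / 2)).
have := rint_lower l11 (cont_on_intRe (bcont_v H (x := 1) _)) (m := 1 / 2).
have := rint_upper l11 (cont_on_intRe (bcont_v H (x := -1) _)) (m := - (1 / 2)).
have in1 : (1 : R) \in [:: -1; 1] by rewrite !inE eqxx orbT.
have inN1 : (-1 : R) \in [:: -1; 1] by rewrite !inE eqxx.
move=> /(_ inN1) h1 /(_ in1) h2 /(_ in1) h3 /(_ inN1) h4.
have sqN : (-1 : R) ^+ 2 = 1 by rewrite sqrrN expr1n.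
have {}h1 := h1 (fun x Hx => _ (B x Hx)).
have {}h1 := h1 ltac:(by move=> x; rewrite expr1 I /= sqN ?(mul1r, mul0r, subr0, addr0) => h; lra).
have {}h2 := h2 (fun x Hx => _ (B x Hx)).
have {}h2 := h2 ltac:(by move=> x; rewrite expr1 I /= expr1n ?(mul1r, mul0r, subr0, addr0) => h; lra).
have {}h3 := h3 (fun x Hx => _ (B x Hx)).
have {}h3 := h3 ltac:(by move=> x; rewrite expr1 I /= expr1n addrC ?(mul1r, mul0r, subr0, addr0) => h; lra).
have {}h4 := h4 (fun x Hx => _ (B x Hx)).
have {}h4 := h4 ltac:(by move=> x; rewrite expr1 I /= sqN addrC ?(mulN1r, opprK, mul1r, mul0r, subr0, addr0) => h; lra).
rewrite /sq /bd ImD Im_mul ImD ImN ReD ReN /= mul0r add0r mul1r.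
move: h1 h2 h3 h4; lra.
Qed.

Lemma geometric_cvg (u : nat -> R) M q : 0 <= q -> q < 1 ->
  (forall n, 0 <= u n <= M * q ^+ n) -> u @ \oo --> (0 : R).
Proof.
move=> q0 q1 H; apply: (@squeeze_cvgr _ _ _ _ (fun=> 0) (fun n => M * q ^+ n)).
- by apply: nearW => n; exact: H.
- exact: cvg_cst.
- rewrite -(mulr0 M); apply: cvgMr; apply: cvg_expr.
  by rewrite ger0_norm.
Qed.

Lemma cser_geometric (a : nat -> C) l (M : R) q : 0 <= q -> q < 1 ->
  (forall N, cabs (l - \sum_(n < N) a n) <= M * q ^+ N) -> cser a l.
Proof.
by move=> q0 q1 H; apply: (geometric_cvg (M := M) q0 q1) => n;
  rewrite cabs_ge0 H.
Qed.

Lemma cvg0_unique (u : nat -> R) x : (forall n, x <= u n) -> u @ \oo --> (0 : R) ->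
  x <= 0.
Proof.
move=> H Hu; rewrite -(cvg_lim _ Hu)//; apply: limr_ge; first exact: cvgP Hu.
by apply: nearW.
Qed.

Lemma cser_unique (a : nat -> C) l l' : cser a l -> cser a l' -> l = l'.
Proof.
move=> h h'; apply/eqP; rewrite -subr_eq0 -cabs_eq0 eq_le cabs_ge0 andbT.
apply: (@cvg0_unique (fun N => cabs (l - \sum_(n < N) a n) + cabs (l' - \sum_(n < N) a n))).
  move=> n; set s := \sum_(_ < _) _.
  by rewrite (cabsB l') (le_trans _ (ler_cabsD _ _))// addrA subrK.
by rewrite -[X in _ --> X]addr0; apply: cvgD.
Qed.

(** Cauchy's formula expanded in powers of w, with [kap], the integral of dz/z, in the role of 2 pi
    i. Squares of every size yield the same coefficients, whence their decay faster than any
    geometric sequence. *)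
Lemma entire_pseries f : entire f -> exists a : nat -> C,
  (forall r, 0 < r -> exists M, forall n, cabs (a n) * r ^+ n <= M) /\
  (forall z, cser (fun n => a n * z ^+ n) (f z)).
Proof.
move=> /entireP fd.
pose kap := sq (fun z : C => 1 * z ^- 1) 1.
have kap0 : kap != 0 := winding1.
pose A n := sq (fun z => f z * z ^- n.+1) 1.
have AE n rho : 0 < rho -> sq (fun z => f z * z ^- n.+1) rho = A n.
  move=> rho0; have H z : z != 0 -> cdiff (fun z => f z * z ^- n.+1) z.
    by move=> z0; apply: cdiffM (fd z) _; exact: cderivXV.
  have [h|/ltW h] := leP 1 rho; first exact: sq_indep.
  by apply/esym; exact: sq_indep.
have kapE w rho : cabs w < rho -> sq (fun z => (z - w)^-1) rho = kap.
  move=> wr; have rho0 : 0 < rho by exact: le_lt_trans (cabs_ge0 w) wr.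
  have rr : - rho <= rho by lra.
  have -> : sq (fun z => (z - w)^-1) rho = sq (fun z => 1 * (z - w)^-1) rho.
    by apply: eq_bd => // z _; rewrite mul1r.
  have [M HM] := cauchy_remainder one_cdiff wr.
  (* Cauchy's expansion is applied to the constant function 1: by [winding0] only the term of index
     0 survives, so the integral of 1/(z - w) equals [kap] for every w inside. *)
  pose a n : C := if n is 0%N then kap else 0.
  apply: (@cser_unique a).
    apply: (cser_geometric (M := M) (q := cabs w / rho)).
    - by rewrite divr_ge0 ?cabs_ge0 ?ltW.
    - by rewrite ltr_pdivrMr// mul1r.
    move=> N; rewrite (cauchy_expand one_cdiff wr N).
    rewrite [X in X + _ - _](_ : _ = \sum_(n < N) a n); last first.
      apply: eq_bigr => -[[|n] /= _] _; rewrite (winding_indep _ rho0).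
        by rewrite mulr1.
      by rewrite winding0 mul0r.
    by rewrite addrC addKr.
  apply: (cser_geometric (M := cabs kap) (q := 0)) => // N.
  case: N => [|N]; first by rewrite big_ord0 subr0 expr0 mulr1.
  rewrite big_ord_recl /= big1// addr0 subrr cabs0.
  by rewrite mulr_ge0 ?cabs_ge0// exprn_ge0.
exists (fun n => A n / kap); split.
  move=> r r0; have r0' : cabs (0 : C) < r by rewrite cabs0.
  have [M M0 HM] := cauchy_coef_bound fd r0'.
  exists (M / r / cabs kap) => n; rewrite cabsM cabsV mulrAC.
  rewrite ler_wpM2r ?invr_ge0 ?cabs_ge0// -ler_pdivlMr ?exprn_gt0//.
  by rewrite -(AE _ _ r0) (le_trans (HM _))// exprS invfM mulrA.
move=> z; pose rho := cabs z + 1.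
have zr : cabs z < rho by rewrite ltrDl.
have rho0 : 0 < rho by exact: le_lt_trans (cabs_ge0 z) zr.
have [M HM] := cauchy_remainder fd zr.
apply: (cser_geometric (M := M / cabs kap) (q := cabs z / rho)).
- by rewrite divr_ge0 ?cabs_ge0 ?ltW.
- by rewrite ltr_pdivrMr// mul1r.
move=> N; have := cauchy_expand fd zr N.
rewrite (cauchy_sq fd zr) (kapE _ _ zr) => E.
have -> : f z - \sum_(n < N) A n / kap * z ^+ n =
    (z ^+ N * sq (fun z0 => f z0 * z0 ^- N * (z0 - z)^-1) rho) / kap.
  apply: (mulIf kap0); rewrite divfK// mulrBl E mulr_suml.
  rewrite [X in _ - X = _](_ : _ = \sum_(n < N) sq (fun z0 => f z0 * z0 ^- n.+1) rho * z ^+ n).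
    by rewrite addrAC subrr add0r.
  by apply: eq_bigr => n _; rewrite (AE _ _ rho0) mulrAC divfK.
by rewrite cabsM cabsV mulrAC ler_wpM2r ?invr_ge0 ?cabs_ge0.
Qed.

End power_series.

Section sums.
Variable R : realType.
Local Notation C := R[i].
Implicit Types (f g : C -> C) (z w : C) (r : R) (a b : nat -> C).

Lemma eq_cser a b l : a =1 b -> cser a l -> cser b l.
Proof. by move=> /funext ->. Qed.

Lemma cserD a b l m : cser a l -> cser b m -> cser (fun n => a n + b n) (l + m).
Proof.
move=> ha hb; have hab : (fun N => cabs (l - \sum_(n < N) a n) +
    cabs (m - \sum_(n < N) b n)) @ \oo --> (0 : R).
  by rewrite -[X in _ --> X]addr0; apply: cvgD.
apply: (squeeze_cvgr _ (@cvg_cst R 0 _ _ _) hab); apply: nearW => N.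
rewrite cabs_ge0 big_split/= opprD addrACA ler_cabsD//.
Qed.

Lemma cserZ k a l : cser a l -> cser (fun n => k * a n) (k * l).
Proof.
move=> h; rewrite /cser (_ : (fun _ => _) = (fun N => cabs k * cabs (l - \sum_(n < N) a n))).
  by rewrite -(mulr0 (cabs k)); apply: cvgMr.
by apply/funext => N; rewrite -mulr_sumr -mulrBr cabsM.
Qed.

Lemma cser_le a l (B : R) : cser a l -> (forall N, cabs (\sum_(n < N) a n) <= B) ->
  cabs l <= B.
Proof.
move=> h H; rewrite -subr_le0; apply: (@cvg0_unique R _ _ _ h) => N.
by rewrite lerBlDr (le_trans _ (lerD (lexx _) (H N)))// -{1}[l](subrK (\sum_(n < N) a n)) ler_cabsD.
Qed.

Lemma real_series_ex (u : nat -> R) M q : 0 <= q -> q < 1 ->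
  (forall n, `|u n| <= M * q ^+ n) ->
  exists l : R, (fun N => \sum_(n < N) u n) @ \oo --> l.
Proof.
move=> q0 q1 H; have : cvgn (series u).
  apply: normed_cvg; apply: (@series_le_cvg R _ (geometric M q)).
  - by move=> n; exact: normr_ge0.
  - by move=> n; apply: le_trans (H n); exact: normr_ge0.
  - by move=> n; exact: H.
  by apply: is_cvg_geometric_series; rewrite ger0_norm.
case/cvg_ex => l Hl; exists l.
rewrite (_ : (fun _ => _) = series u)//; apply/funext => N.
by rewrite seriesEnat /= big_mkord.
Qed.

Lemma cser_ReIm a l : (fun N => complex.Re (\sum_(n < N) a n)) @ \oo --> complex.Re l ->
  (fun N => complex.Im (\sum_(n < N) a n)) @ \oo --> complex.Im l -> cser a l.
Proof.
move=> h1 h2.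
have h : (fun N => `|complex.Re l - complex.Re (\sum_(n < N) a n)| +
   `|complex.Im l - complex.Im (\sum_(n < N) a n)|) @ \oo --> (0 : R).
  have H (u : nat -> R) m : u @ \oo --> m -> (fun n => `|m - u n|) @ \oo --> (0 : R).
    move=> hu; have := cvg_norm (cvgB (@cvg_cst R m _ _ _) hu).
    by rewrite subrr normr0 => hh; apply: hh.
  by rewrite -[X in _ --> X]addr0; apply: cvgD; exact: H.
apply: (squeeze_cvgr _ (@cvg_cst R 0 _ _ _) h); apply: nearW => N.
by rewrite cabs_ge0 (le_trans (cabs_le_ReIm _))// ReD ReN ImD ImN.
Qed.

Lemma cser_ex a M q : 0 <= q -> q < 1 ->
  (forall n, cabs (a n) <= M * q ^+ n) -> exists l, cser a l.
Proof.
move=> q0 q1 H.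
have [x Hx] : exists l : R, (fun N => \sum_(n < N) complex.Re (a n)) @ \oo --> l.
  by apply: (@real_series_ex (fun n => complex.Re (a n)) M q) => // n; apply: le_trans (Re_le_cabs _) (H n).
have [y Hy] : exists l : R, (fun N => \sum_(n < N) complex.Im (a n)) @ \oo --> l.
  by apply: (@real_series_ex (fun n => complex.Im (a n)) M q) => // n; apply: le_trans (Im_le_cabs _) (H n).
exists (x +i* y)%C; apply: cser_ReIm => /=.
  by under eq_fun do rewrite Re_sum.
by under eq_fun do rewrite Im_sum.
Qed.

(** Infinite radius of convergence, stated as boundedness of the terms at every radius. *)
Definition rapid a := forall r, 0 < r -> exists M, forall n, cabs (a n) * r ^+ n <= M.

Lemma geo_sum_le N : \sum_(n < N) (1 / 2 : R) ^+ n <= 2.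
Proof.
suff : \sum_(n < N) (1 / 2 : R) ^+ n = 2 - 2 * (1 / 2) ^+ N.
  by move=> ->; rewrite lerBlDr lerDl mulr_ge0// exprn_ge0.
elim: N => [|N IH]; first by rewrite big_ord0 expr0 mulr1 subrr.
by rewrite big_ord_recr/= IH exprS; field.
Qed.

Lemma rapid_bound a r : rapid a -> 0 < r ->
  exists2 M : R, 0 <= M & forall n, cabs (a n) * r ^+ n <= M * (1 / 2) ^+ n.
Proof.
move=> H r0; have [M HM] := H (r * 2) (mulr_gt0 r0 (ltr0n _ 2)).
exists M.
  by apply: le_trans (HM 0%N); rewrite mulr_ge0 ?cabs_ge0// exprn_ge0// mulr_ge0// ltW.
move=> n; have := HM n; rewrite exprMn mulrA expr_div_n expr1n mul1r.
by rewrite ler_pdivlMr// exprn_gt0.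
Qed.

Lemma rapid_ex a z : rapid a -> exists l, cser (fun n => a n * z ^+ n) l.
Proof.
move=> H; have r0 : 0 < cabs z + 1 by rewrite ltr_wpDl// cabs_ge0.
have [M M0 HM] := rapid_bound H r0.
apply: (@cser_ex _ M (1 / 2)); [lra|lra|] => n.
apply: le_trans (HM n); rewrite cabsM cabsX ler_wpM2l ?cabs_ge0//.
by rewrite lerXn2r ?nnegrE ?cabs_ge0 ?(ltW r0)// lerDl.
Qed.

Definition pval a z : C := xget 0 [set l | cser (fun n => a n * z ^+ n) l].

Lemma pvalP a z : rapid a -> cser (fun n => a n * z ^+ n) (pval a z).
Proof.
move=> H; rewrite /pval; case: xgetP => [//|Hn].
by have [l Hl] := rapid_ex z H; case: (Hn l Hl).
Qed.

Let npow z n : cabs (n%:R : C) * cabs z ^+ n.-1 <= (cabs z + 2) ^+ n.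
Proof.
have z0 := cabs_ge0 z.
rewrite cabs_natr; case: n => [|n]; first by rewrite mul0r expr0.
elim: n => [|n IH]; first by rewrite /= expr0 expr1; lra.
rewrite [leRHS]exprS.
have : n.+2%:R * cabs z ^+ n.+1 = cabs z * (n.+1%:R * cabs z ^+ n) + cabs z ^+ n.+1.
  by rewrite -natr1 exprS; ring.
rewrite /= => ->; rewrite [X in _ <= X]mulrDl lerD//; first exact: ler_wpM2l.
have : cabs z ^+ n.+1 <= (cabs z + 2) ^+ n.+1 by rewrite lerXn2r ?nnegrE//; lra.
by move=> /le_trans; apply; rewrite ler_peMl ?exprn_ge0//; lra.
Qed.

(** Second-order remainder of a monomial with the n-dependence absorbed into (|z| + 2)^n, which a
    rapid sequence can sum; this is what justifies termwise differentiation. *)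
Let taylor2 z h n : cabs h <= 1 ->
  cabs ((z + h) ^+ n - z ^+ n - n%:R * z ^+ n.-1 * h) <=
  cabs h ^+ 2 * (cabs z + 2) ^+ n.
Proof.
move=> h1; have z0 := cabs_ge0 z; have h0 := cabs_ge0 h.
elim: n => [|n IH].
  by rewrite !expr0 subrr !mul0r subrr cabs0 mulr1 sqr_ge0.
have -> : (z + h) ^+ n.+1 - z ^+ n.+1 - n.+1%:R * z ^+ n.+1.-1 * h =
    (z + h) * ((z + h) ^+ n - z ^+ n - n%:R * z ^+ n.-1 * h) +
    h ^+ 2 * (n%:R * z ^+ n.-1).
  case: n {IH} => [|n]; first by rewrite /= expr1 !expr0; ring.
  by rewrite /= !exprS -[n.+2%:R]natr1; ring.
rewrite (le_trans (ler_cabsD _ _))// (cabsM (z + h)) (cabsM (h ^+ 2)) (cabsM n%:R) !cabsX.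
have B : cabs (n%:R : C) * cabs z ^+ n.-1 <= (cabs z + 2) ^+ n.
  exact: npow.
have -> : cabs h ^+ 2 * (cabs z + 2) ^+ n.+1 =
    (cabs z + 1) * (cabs h ^+ 2 * (cabs z + 2) ^+ n) + cabs h ^+ 2 * (cabs z + 2) ^+ n.
  by rewrite [(cabs z + 2) ^+ n.+1]exprS; ring.
rewrite lerD//; last by rewrite ler_wpM2l ?sqr_ge0.
rewrite ler_pM ?cabs_ge0// (le_trans (ler_cabsD _ _))//; lra.
Qed.

Lemma pseries_entire a f : rapid a ->
  (forall z, cser (fun n => a n * z ^+ n) (f z)) -> entire f.
Proof.
move=> Ha Hf; apply/entireP => z.
have z0 := cabs_ge0 z.
have r0 : 0 < cabs z + 2 by lra.
have [M M0 HM] := rapid_bound Ha r0.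
have [d Hd] : exists d, cser (fun n => a n * (n%:R * z ^+ n.-1)) d.
  apply: (@cser_ex _ M (1 / 2)); [lra|lra|] => n.
  apply: le_trans (HM n); rewrite cabsM ler_wpM2l ?cabs_ge0//.
  by rewrite cabsM cabsX npow.
exists d => e e0.
pose K := M * 2 + 1; have K0 : 0 < K by rewrite /K; lra.
exists (Num.min 1 (e / K)); first by rewrite lt_min ltr01 divr_gt0.
move=> h; rewrite lt_min => /andP[/ltW h1]; rewrite ltr_pdivlMr// => h2.
have S : cser (fun n => a n * (z + h) ^+ n + (-1) * (a n * z ^+ n) +
    (- h) * (a n * (n%:R * z ^+ n.-1))) (f (z + h) - f z - d * h).
  have := cserD (cserD (Hf (z + h)) (cserZ (-1) (Hf z))) (cserZ (- h) Hd).
  by rewrite mulN1r [- h * d]mulNr [h * d]mulrC.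
apply: cser_le S _ => N; apply: le_trans (ler_cabs_sum _ _ _) _.
apply: (@le_trans _ _ (\sum_(n < N) cabs h ^+ 2 * (M * (1 / 2) ^+ n))).
  apply: ler_sum => n _.
  have -> : a n * (z + h) ^+ n + -1 * (a n * z ^+ n) + - h * (a n * (n%:R * z ^+ n.-1))
    = a n * ((z + h) ^+ n - z ^+ n - n%:R * z ^+ n.-1 * h) by ring.
  rewrite cabsM (le_trans (ler_wpM2l (cabs_ge0 _) (taylor2 z n h1)))//.
  by rewrite mulrCA ler_wpM2l ?sqr_ge0.
rewrite -mulr_sumr -mulr_sumr expr2 -mulrA mulrC ler_wpM2r ?cabs_ge0//.
apply: le_trans (ltW h2); rewrite ler_wpM2l ?cabs_ge0//.
by rewrite /K (le_trans (ler_wpM2l M0 (geo_sum_le N)))// lerDl.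
Qed.

End sums.

(** * Parseval's identity for radial weights *)

Section plane_rotation.
Variable R : realType.
Local Notation mu := (@lebesgue_measure R).
Local Open Scope ereal_scope.

(** Lebesgue measure is determined by its values on half-open intervals, where translation
    invariance is visible. *)
Lemma lebesgue_translation (c : R) (A : set R) : measurable A ->
  pushforward mu (fun x => x + c : measurableTypeR R)%R A = mu A.
Proof.
move=> mA; apply/esym.
have mf : measurable_fun setT (fun x : measurableTypeR R => x + c : measurableTypeR R)%R.
  exact: measurable_funD.
pose f_mix := isMeasurableFun.Build _ _ _ _ _ mf.
pose f_pack : {mfun _ >-> _} := HB.pack (fun x : measurableTypeR R => x + c : measurableTypeR R)%R f_mix.
apply: (@lebesgue_measure_unique R (pushforward mu f_pack)) => //= _ [[a b]] _ <-.
rewrite /pushforward.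
have -> : f_pack @^-1` `]a, b] = `](a - c)%R, (b - c)%R]%classic.
  by apply/seteqP; split => x /=; rewrite !in_itv /= ltrBlDr lerBrDr.
by rewrite !lebesgue_measure_itv/= !lte_fin ltrD2r -!EFinB; case: ifP => // _; congr (_%:E); ring.
Qed.

Lemma integral_translation (c : R) (f : R -> \bar R) : measurable_fun setT f ->
  (forall x, 0 <= f x) -> \int[mu]_x f (x + c)%R = \int[mu]_x f x.
Proof.
move=> mf f0.
have mphi : measurable_fun setT (fun x : measurableTypeR R => x + c : measurableTypeR R)%R.
  exact: measurable_funD.
have := @ge0_integral_pushforward _ _ _ _ R _ mphi mu setT f measurableT mf (fun y _ => f0 y).
rewrite preimage_setT => <-.
by apply: eq_measure_integral => //= A mA _; exact: lebesgue_translation.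
Qed.

Local Notation P := (measurableTypeR R * measurableTypeR R)%type.
Implicit Types F : P -> \bar R.

Lemma measurable_shear (p q r s : R) : measurable_fun setT
  (fun z : P => (p * z.1 + q * z.2, r * z.1 + s * z.2)%R : P).
Proof.
have h (a b : R) : measurable_fun setT (fun z : P => (a * z.1 + b * z.2)%R).
  by apply: measurable_funD; apply: measurable_funM.
apply/measurable_fun_pairP; split; exact: h.
Qed.

Lemma integral_shear1 (a : R) F : measurable_fun setT F -> (forall z, 0 <= F z) ->
  \int[@plane_measure R]_z F (z.1 + a * z.2, z.2)%R = \int[@plane_measure R]_z F z.
Proof.
move=> mF F0.
have ms : measurable_fun setT (fun z : P => F (z.1 + a * z.2, z.2)%R).
  apply: (measurableT_comp mF).
  have := measurable_shear 1 a 0 1; apply: eq_measurable_fun => z _ /=.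
  by rewrite !mul1r mul0r add0r.
rewrite /plane_measure (fubini_tonelli1 _ ms)// (fubini_tonelli1 _ mF)//.
rewrite (fubini_tonelli _ ms)// (fubini_tonelli _ mF)//.
apply: eq_integral => y _ /=.
apply: (@integral_translation (a * y)%R (fun x => F (x, y))) => //.
exact: measurableT_comp.
Qed.

Lemma integral_shear2 (a : R) F : measurable_fun setT F -> (forall z, 0 <= F z) ->
  \int[@plane_measure R]_z F (z.1, z.2 + a * z.1)%R = \int[@plane_measure R]_z F z.
Proof.
move=> mF F0.
have ms : measurable_fun setT (fun z : P => F (z.1, z.2 + a * z.1)%R).
  apply: (measurableT_comp mF).
  have := measurable_shear 1 0 a 1; apply: eq_measurable_fun => z _ /=.
  by rewrite !mul1r mul0r addr0 addrC.
rewrite /plane_measure (fubini_tonelli1 _ ms)// (fubini_tonelli1 _ mF)//.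
apply: eq_integral => x _ /=.
apply: (@integral_translation (a * x)%R (fun y => F (x, y))) => //.
exact: measurableT_comp.
Qed.

(* A rotation by an angle t <> pi is a product of three shears, with the
   coefficient -tan(t/2) = - s / (1 + c) in the first and in the last. *)
Lemma integral_rotation_shears (c s : R) F : (c ^+ 2 + s ^+ 2 = 1)%R -> (1 + c != 0)%R ->
  measurable_fun setT F -> (forall z, 0 <= F z) ->
  \int[@plane_measure R]_z F (c * z.1 - s * z.2, s * z.1 + c * z.2)%R =
  \int[@plane_measure R]_z F z.
Proof.
move=> cs c1 mF F0.
have s2 : (s ^+ 2 = (1 - c) * (1 + c))%R.
  have -> : ((1 - c) * (1 + c) = 1 - c ^+ 2)%R by ring.
  by rewrite -cs addrAC subrr add0r.
pose t : R := (- s / (1 + c))%R.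
pose F1 : P -> \bar R := fun z => F (z.1 + t * z.2, z.2)%R.
pose F2 : P -> \bar R := fun z => F1 (z.1, z.2 + s * z.1)%R.
have m1 : measurable_fun setT F1.
  apply: (measurableT_comp mF).
  have := measurable_shear 1 t 0 1; apply: eq_measurable_fun => z _ /=.
  by rewrite !mul1r mul0r add0r.
have m2 : measurable_fun setT F2.
  apply: (measurableT_comp m1).
  have := measurable_shear 1 0 s 1; apply: eq_measurable_fun => z _ /=.
  by rewrite !mul1r mul0r addr0 addrC.
rewrite -(integral_shear1 t mF F0) -/F1 -(integral_shear2 s m1 (fun z => F0 _)) -/F2.
rewrite -(integral_shear1 t m2 (fun z => F0 _)).
apply: eq_integral => -[x y] _.
rewrite /F2 /F1 /=; congr (F (_, _)); rewrite /t; last first.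
  have -> : (y + s * (x + - s / (1 + c) * y) = s * x + (1 - s ^+ 2 / (1 + c)) * y)%R by field.
  by rewrite s2 mulfK//; congr (_ + _ * _)%R; ring.
have -> : (x + - s / (1 + c) * y + - s / (1 + c) * (y + s * (x + - s / (1 + c) * y)) =
  (1 - s ^+ 2 / (1 + c)) * x - s * ((2 - s ^+ 2 / (1 + c)) / (1 + c)) * y)%R by field.
rewrite s2 mulfK//.
have -> : (1 - (1 - c) = c)%R by ring.
have -> : (2 - (1 - c) = 1 + c)%R by ring.
by rewrite divff// mulr1.
Qed.

Lemma integral_rotation (c s : R) F : (c ^+ 2 + s ^+ 2 = 1)%R ->
  measurable_fun setT F -> (forall z, 0 <= F z) ->
  \int[@plane_measure R]_z F (c * z.1 - s * z.2, s * z.1 + c * z.2)%R =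
  \int[@plane_measure R]_z F z.
Proof.
move=> cs mF F0; have [c1|] := eqVneq (1 + c)%R 0%R; last first.
  by move=> c1; exact: integral_rotation_shears.
have cE : c = (-1)%R by apply/eqP; rewrite -addr_eq0 addrC c1.
have sE : s = 0%R by move: cs; rewrite cE sqrrN expr1n; move/eqP; rewrite -subr_eq0 addrAC subrr add0r sqrf_eq0 => /eqP.
(* The remaining rotation is the half-turn, excluded from the shear decomposition because tan(pi/2)
   is infinite. It is the square of the quarter-turn, to which the decomposition applies. *)
pose G : P -> \bar R := fun z => F (- z.2, z.1)%R.
have mG : measurable_fun setT G.
  apply: (measurableT_comp mF).
  have := measurable_shear 0 (-1) 1 0; apply: eq_measurable_fun => z _ /=.
  by rewrite !mul0r add0r addr0 mulN1r mul1r.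
have h : (0 ^+ 2 + 1 ^+ 2 = 1 :> R)%R by rewrite expr0n expr1n add0r.
have n0 : (1 + 0 != 0 :> R)%R by rewrite addr0 oner_neq0.
rewrite -(integral_rotation_shears h n0 mF F0).
rewrite -(integral_rotation_shears h n0 (F := fun z : P => F (0 * z.1 - 1 * z.2, 1 * z.1 + 0 * z.2)%R))//; last first.
  by apply: eq_measurable_fun mG => z _; rewrite /G !mul0r !mul1r addr0 add0r.
apply: eq_integral => -[x y] _ /=; congr (F (_, _)); rewrite cE sE; ring.
Qed.

End plane_rotation.

Section roots_of_unity.
Variable R : realType.
Local Notation C := R[i].

Lemma prim_root_ex N : (0 < N)%N -> exists z : C, N.-primitive_root z.
Proof.
move=> N0; pose p : {poly C} := 'X^N - 1; have [r Dp] := closed_field_poly_normal p.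
rewrite (monicP _) ?monicXnsubC // scale1r in Dp.
have rn1: all N.-unity_root r by apply/allP=> z; rewrite -root_prod_XsubC -Dp.
have sz_r: (N < (size r).+1)%N.
  by rewrite -(size_prod_XsubC r id) -Dp size_XnsubC.
have [|z _ Hz] := hasP (has_prim_root N0 rn1 _ sz_r); last by exists z.
by rewrite -separable_prod_XsubC -Dp separable_Xn_sub_1 // pnatr_eq0 -lt0n.
Qed.

Lemma prim_root_cabs N (z : C) : (0 < N)%N -> N.-primitive_root z -> cabs z = 1.
Proof.
move=> N0 Hz; have := congr1 (@cabs R) (prim_expr_order Hz).
rewrite cabsX cabs1 => /eqP; rewrite pexpr_eq1 ?cabs_ge0//.
by move/eqP.
Qed.

Lemma unit_conj (z : C) : cabs z = 1 -> (z^*)%C = z^-1.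
Proof.
move=> h; have z0 : z != 0 by rewrite -cabs_gt0 h.
by apply: (mulfI z0); rewrite -cabs_sqrC h expr1n mulfV.
Qed.

(** Orthogonality of the characters of the cyclic group of order N: for r different from s, the
    geometric sum of (w^r / w^s)^k over a full period vanishes. *)
Lemma dft_parseval N (w : C) (c : 'I_N -> C) : N.-primitive_root w ->
  \sum_(k < N) cabs (\sum_(r < N) c r * w ^+ (k * r)) ^+ 2 =
  N%:R * \sum_(r < N) cabs (c r) ^+ 2.
Proof.
move=> Hw; have N0 := prim_order_gt0 Hw; apply: (@complexI R).
rewrite rmorphM rmorph_nat !rmorph_sum /=.
have w1 := prim_root_cabs N0 Hw; have wJ := unit_conj w1.
have w0 : w != 0 by rewrite -cabs_gt0 w1.
transitivity (\sum_(r < N) \sum_(s < N) c r * (c s)^*%C *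
    \sum_(k < N) (w ^+ r / w ^+ s) ^+ k).
  have E k : (cabs (\sum_(r < N) c r * w ^+ (k * r)) ^+ 2)%:C%C =
      \sum_(r < N) \sum_(s < N) (c r * w ^+ (k * r)) * (c s * w ^+ (k * s))^*%C.
    rewrite cabs_sqrC (rmorph_sum (@conjc R)) /= mulr_suml.
    by apply: eq_bigr => r _; rewrite mulr_sumr.
  rewrite (eq_bigr _ (fun (k : 'I_N) _ => E k)).
  rewrite exchange_big /=; apply: eq_bigr => r _.
  rewrite exchange_big /=; apply: eq_bigr => s _.
  rewrite mulr_sumr; apply: eq_bigr => k _.
  rewrite rmorphM rmorphXn /= wJ mulrACA; congr (_ * _).
  by rewrite exprMn -exprM !exprVn -exprM ![(k * _)%N]mulnC.
rewrite mulr_sumr; apply: eq_bigr => r _.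
rewrite (bigD1 r)//= [X in _ + X]big1 ?addr0 => [|s sr].
  rewrite mulfV ?expf_neq0// (eq_bigr (fun=> 1)) => [|k _]; last by rewrite expr1n.
  by rewrite sumr_const card_ord mulrC cabs_sqrC.
set u := _ / _.
have u1 : u != 1.
  apply: contra sr => /eqP hu; have : w ^+ r = w ^+ s.
    by rewrite -[RHS]mul1r -hu divfK// expf_neq0.
  by move/eqP; rewrite (eq_prim_root_expr Hw) !modn_small// eq_sym.
have uN : u ^+ N = 1.
  rewrite exprMn exprVn -!exprM ![(_ * N)%N]mulnC !exprM (prim_expr_order Hw).
  by rewrite !expr1n invr1 mulr1.
have : (u - 1) * (\sum_(k < N) u ^+ k) = 0 by rewrite -subrX1 uN subrr.
by move/eqP; rewrite mulf_eq0 subr_eq0 (negbTE u1) /= => /eqP ->; rewrite mulr0.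
Qed.

End roots_of_unity.

(** * Measurability and integration over the plane *)

Section plane_integration.
Variable R : realType.
Local Notation C := R[i].
Local Notation P := (measurableTypeR R * measurableTypeR R)%type.
Implicit Types (f : C -> C) (g l : C -> R) (z w : C) (a : nat -> C).

Definition pmeas g := measurable_fun setT (fun p : P => g (p.1 +i* p.2)%C : measurableTypeR R).

Definition cmeas f := pmeas (fun z => complex.Re (f z)) /\
  pmeas (fun z => complex.Im (f z)).

Lemma pmeasD g l : pmeas g -> pmeas l -> pmeas (fun z => g z + l z).
Proof. by move=> h1 h2; exact: measurable_funD. Qed.

Lemma pmeasB g l : pmeas g -> pmeas l -> pmeas (fun z => g z - l z).
Proof. by move=> h1 h2; exact: measurable_funB. Qed.

Lemma pmeasM g l : pmeas g -> pmeas l -> pmeas (fun z => g z * l z).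
Proof. by move=> h1 h2; exact: measurable_funM. Qed.

Lemma pmeas_cst (k : R) : pmeas (fun=> k).
Proof. exact: measurable_cst. Qed.

Lemma cmeas_id : cmeas id.
Proof. by split; [exact: measurable_fst|exact: measurable_snd]. Qed.

Lemma cmeas_cst k : cmeas (fun=> k).
Proof. by split; exact: pmeas_cst. Qed.

Lemma cmeasD f f' : cmeas f -> cmeas f' -> cmeas (fun z => f z + f' z).
Proof.
move=> [h1 h2] [h3 h4]; split.
  by under [X in pmeas X]eq_fun do rewrite ReD; exact: (pmeasD h1 h3).
by under [X in pmeas X]eq_fun do rewrite ImD; exact: (pmeasD h2 h4).
Qed.

Lemma cmeasM f f' : cmeas f -> cmeas f' -> cmeas (fun z => f z * f' z).
Proof.
move=> [h1 h2] [h3 h4]; split.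
  under [X in pmeas X]eq_fun do rewrite Re_mul.
  exact: (pmeasB (pmeasM h1 h3) (pmeasM h2 h4)).
under [X in pmeas X]eq_fun do rewrite Im_mul.
exact: (pmeasD (pmeasM h1 h4) (pmeasM h2 h3)).
Qed.

Definition ppol a K z : C := \sum_(n < K) a n * z ^+ n.

Lemma cmeas_ppol a K : cmeas (ppol a K).
Proof.
elim: K => [|K IH].
  by rewrite /ppol (_ : (fun _ => _) = fun=> 0);
    [exact: cmeas_cst|apply/funext => z; rewrite big_ord0].
rewrite (_ : ppol a K.+1 = fun z => ppol a K z + a K * z ^+ K); last first.
  by apply/funext => z; rewrite /ppol big_ord_recr.
apply: cmeasD => //; apply: cmeasM; first exact: cmeas_cst.
elim: K {IH} => [|K IH]; first exact: cmeas_cst.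
rewrite (_ : (fun _ => _) = fun z => z * z ^+ K).
  by apply: cmeasM => //; exact: cmeas_id.
by apply/funext => z; rewrite exprS.
Qed.

Lemma pmeas_cvg (g : nat -> C -> R) l : (forall n, pmeas (g n)) ->
  (forall z, g ^~ z @ \oo --> l z) -> pmeas l.
Proof. by move=> hg hl; apply: measurable_fun_cvg hg _ => p _; exact: hl. Qed.

Lemma cser_Re (b : nat -> C) (l : C) : cser b l ->
  (fun N => complex.Re (\sum_(n < N) b n)) @ \oo --> complex.Re l.
Proof.
move=> h; apply/cvgrPdist_le => e e0; move/cvgrPdist_le: h => /(_ e e0).
apply: filterS => n; rewrite sub0r normrN ger0_norm ?cabs_ge0//.
by rewrite -ReN -ReD; apply: le_trans; exact: Re_le_cabs.
Qed.

Lemma cser_Im (b : nat -> C) (l : C) : cser b l ->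
  (fun N => complex.Im (\sum_(n < N) b n)) @ \oo --> complex.Im l.
Proof.
move=> h; apply/cvgrPdist_le => e e0; move/cvgrPdist_le: h => /(_ e e0).
apply: filterS => n; rewrite sub0r normrN ger0_norm ?cabs_ge0//.
by rewrite -ImN -ImD; apply: le_trans; exact: Im_le_cabs.
Qed.

Lemma cmeas_pseries a f : (forall z, cser (fun n => a n * z ^+ n) (f z)) -> cmeas f.
Proof.
move=> H; split.
  by apply: pmeas_cvg (fun n => (cmeas_ppol a n).1) _ => z; exact: (cser_Re (H z)).
by apply: pmeas_cvg (fun n => (cmeas_ppol a n).2) _ => z; exact: (cser_Im (H z)).
Qed.

Lemma pmeasX g n : pmeas g -> pmeas (fun z => g z ^+ n).
Proof. by move=> h; exact: measurable_funX. Qed.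

Lemma pmeas_cabs2 f : cmeas f -> pmeas (fun z => cabs (f z) ^+ 2).
Proof.
move=> [h1 h2]; under [X in pmeas X]eq_fun do rewrite cabs_sqr.
exact: (pmeasD (pmeasX 2 h1) (pmeasX 2 h2)).
Qed.

Lemma pmeas_scale k g : pmeas g -> pmeas (fun z => g (k * z)).
Proof.
move=> hg; have m := measurable_shear (complex.Re k) (- complex.Im k) (complex.Im k) (complex.Re k).
have := measurableT_comp hg m; apply: eq_measurable_fun => -[x y] _ /=.
by congr g; apply: eqC_ReIm; rewrite ?Re_mul ?Im_mul /=; ring.
Qed.

Lemma pmeas_sum (I : Type) (s : seq I) (g : I -> C -> R) :
  (forall i, pmeas (g i)) -> pmeas (fun z => \sum_(i <- s) g i z).
Proof.
move=> h; elim: s => [|i s IH].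
  by under [X in pmeas X]eq_fun do rewrite big_nil; exact: pmeas_cst.
by under [X in pmeas X]eq_fun do rewrite big_cons; exact: (pmeasD (h i) IH).
Qed.

Local Open Scope ereal_scope.

Lemma plane_integral_ge0 g : (forall z, 0 <= g z)%R -> 0 <= plane_integral g.
Proof. by move=> h; apply: integral_ge0 => p _; rewrite lee_fin. Qed.

Lemma plane_integral_le g l : pmeas g -> pmeas l -> (forall z, 0 <= g z <= l z)%R ->
  plane_integral g <= plane_integral l.
Proof.
move=> mg ml gl; apply: ge0_le_integral => //.
- by move=> p _; rewrite lee_fin; case/andP: (gl (p.1 +i* p.2)%C).
- apply/measurable_EFinP; exact: mg.
- apply/measurable_EFinP; exact: ml.
by move=> p _; rewrite lee_fin; case/andP: (gl (p.1 +i* p.2)%C).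
Qed.

Lemma plane_integral_sum (I : Type) (s : seq I) (g : I -> C -> R) :
  (forall i, pmeas (g i)) -> (forall i z, 0 <= g i z)%R ->
  plane_integral (fun z => \sum_(i <- s) g i z)%R = \sum_(i <- s) plane_integral (g i).
Proof.
move=> mg g0; rewrite /plane_integral.
under eq_integral do rewrite -sumEFin.
rewrite ge0_integral_sum//.
  by move=> i; apply/measurable_EFinP; exact: mg.
by move=> i p _; rewrite lee_fin.
Qed.

Lemma plane_integralZ (k : R) g : (0 <= k)%R -> pmeas g -> (forall z, 0 <= g z)%R ->
  plane_integral (fun z => k * g z)%R = k%:E * plane_integral g.
Proof.
move=> k0 mg g0; rewrite /plane_integral.
under eq_integral do rewrite EFinM.
rewrite ge0_integralZl_EFin//.
  by move=> p _; rewrite lee_fin.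
apply/measurable_EFinP; exact: mg.
Qed.

Lemma plane_integral_rot w g : cabs w = 1%R -> pmeas g -> (forall z, 0 <= g z)%R ->
  plane_integral (fun z => g (w * z)%R) = plane_integral g.
Proof.
move=> w1 mg g0; have cs : (complex.Re w ^+ 2 + complex.Im w ^+ 2 = 1)%R.
  by rewrite -cabs_sqr w1 expr1n.
have mF : measurable_fun setT (fun p : P => (g (p.1 +i* p.2)%C)%:E).
  apply/measurable_EFinP; exact: mg.
rewrite /plane_integral -(integral_rotation cs mF)/=; last first.
  by move=> p; rewrite lee_fin.
apply: eq_integral => -[x y] _ /=; congr (g _)%:E.
by apply: eqC_ReIm; rewrite ?Re_mul ?Im_mul /=; ring.
Qed.

(** Fatou's lemma in the only form used: a uniform bound on the integrals passes to the pointwise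
    limit, without any convergence of the integrals. *)
Lemma plane_fatou (g : nat -> C -> R) l B : (forall n, pmeas (g n)) ->
  (forall n z, 0 <= g n z)%R -> (forall z, g ^~ z @ \oo --> l z) ->
  (forall n, plane_integral (g n) <= B) -> plane_integral l <= B.
Proof.
move=> mg g0 gl HB.
have -> : plane_integral l =
    \int[@plane_measure R]_(p in setT) limn_einf (fun n => (g n (p.1 +i* p.2)%C)%:E).
  apply: eq_integral => p _.
  have h : (fun n => (g n (p.1 +i* p.2)%C)%:E) @ \oo --> (l (p.1 +i* p.2)%C)%:E.
    by apply: cvg_EFin; [exact: nearW|exact: gl].
  by have [-> _] := cvg_limn_einf_sup h.
apply: (@le_trans _ _ (limn_einf (fun n => plane_integral (g n)))).
  apply: (@fatou _ _ _ (@plane_measure R) setT measurableT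
    (fun n p => (g n (p.1 +i* p.2)%C)%:E)) => //.
    by move=> n; apply/measurable_EFinP; exact: mg.
  by move=> n p _; rewrite lee_fin.
rewrite -[limn_einf _]/(limf_einf _ \oo) limf_einfE; apply: ge_ereal_sup => _ [V FV <-].
have [N HN] : exists N, V N by have [N _ HN] := FV; exists N; apply: HN => /=.
by apply: le_trans (HB N); apply: ereal_inf_lbound; exists N.
Qed.

End plane_integration.

Section parseval.
Variable R : realType.
Local Notation C := R[i].
Variables (W : C -> R) (h : nat -> R).
Hypotheses (W0 : forall z, 0 <= W z) (mW : pmeas W).
Hypothesis WR : forall w z, cabs w = 1 -> W (w * z) = W z.
Hypothesis hE : forall n, plane_integral (fun z => cabs z ^+ (2 * n) * W z) = (h n)%:E.
Implicit Types (f : C -> C) (a : nat -> C) (z w : C).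

Definition wnorm f := plane_integral (fun z => cabs (f z) ^+ 2 * W z).

(** The angular mean of |p|^2 over the circle through z, for the Taylor polynomial p of length K. *)
Definition qpol a K z : R := \sum_(n < K) cabs (a n) ^+ 2 * cabs z ^+ (2 * n).

Let pmeas_mono n : pmeas (fun z => cabs z ^+ (2 * n)).
Proof.
rewrite (_ : (fun _ => _) = fun z => (cabs z ^+ 2) ^+ n).
  by apply: pmeasX; exact: (pmeas_cabs2 (cmeas_id R)).
by apply/funext => z; rewrite exprM.
Qed.

Lemma qpol_ge0 a K z : 0 <= qpol a K z.
Proof. by apply: sumr_ge0 => n _; rewrite mulr_ge0 ?exprn_ge0 ?cabs_ge0. Qed.

Lemma pmeas_qpol a K : pmeas (qpol a K).
Proof.
by apply: pmeas_sum => n; apply: (pmeasM (pmeas_cst _)); exact: pmeas_mono.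
Qed.

Lemma integral_qpol a K : plane_integral (fun z => qpol a K z * W z) =
  (\sum_(n < K) cabs (a n) ^+ 2 * h n)%:E.
Proof.
transitivity (plane_integral (fun z => \sum_(n < K)
    cabs (a n) ^+ 2 * (cabs z ^+ (2 * n) * W z))).
  congr plane_integral; apply/funext => z; rewrite /qpol mulr_suml.
  by apply: eq_bigr => n _; rewrite mulrA.
have mm n : pmeas (fun z => cabs z ^+ (2 * n) * W z).
  exact: (pmeasM (pmeas_mono n) mW).
have m0 n z : 0 <= cabs z ^+ (2 * n) * W z.
  by rewrite mulr_ge0// exprn_ge0// cabs_ge0.
rewrite plane_integral_sum.
- rewrite -sumEFin; apply: eq_bigr => n _.
  by rewrite (plane_integralZ _ (mm n) (m0 n)) ?hE// exprn_ge0// cabs_ge0.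
- by move=> n; exact: (pmeasM (pmeas_cst _) (mm n)).
- by move=> n z; rewrite mulr_ge0// exprn_ge0// cabs_ge0.
Qed.

Definition cavg (w : C) K (g : C -> R) z := K%:R^-1 * \sum_(k < K) g (w ^+ k * z).

Lemma pmeas_cavg w K g : pmeas g -> pmeas (cavg w K g).
Proof.
move=> mg; apply: (pmeasM (pmeas_cst _)); apply: pmeas_sum => k.
exact: pmeas_scale.
Qed.

Lemma integral_cavg (w : C) K g : (0 < K)%N -> K.-primitive_root w ->
  pmeas g -> (forall z, 0 <= g z) ->
  plane_integral (fun z => cavg w K g z * W z) = plane_integral (fun z => g z * W z).
Proof.
move=> K0 Hw mg g0; have w1 := prim_root_cabs K0 Hw.
have wk k : cabs (w ^+ k) = 1 by rewrite cabsX w1 expr1n.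
have Ki : 0 <= (K%:R : R)^-1 by rewrite invr_ge0.
pose G z := g z * W z.
have mG : pmeas G by exact: (pmeasM mg mW).
have G0 z : 0 <= G z by rewrite mulr_ge0.
transitivity (plane_integral (fun z => \sum_(k < K) K%:R^-1 * G (w ^+ k * z))).
  congr plane_integral; apply/funext => z.
  rewrite /cavg -mulrA mulr_suml -mulr_sumr; congr (_ * _).
  by apply: eq_bigr => k _; rewrite /G WR.
rewrite plane_integral_sum; last 2 first.
- by move=> k; apply: (pmeasM (pmeas_cst _)); exact: pmeas_scale.
- by move=> k z; rewrite mulr_ge0.
under eq_bigr => k _.
  rewrite (plane_integralZ Ki (pmeas_scale (w ^+ k) mG))//.
  rewrite (plane_integral_rot (wk k) mG)//.
  over.
rewrite -ge0_sume_distrl//.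
rewrite sumEFin sumr_const card_ord -[_ *+ _]mulr_natr mulVf ?pnatr_eq0 -?lt0n//.
by rewrite mul1e.
Qed.

(** Averaging over K rotations is exact for polynomials of degree less than K, since their exponents
    are distinct modulo K. *)
Lemma cavg_ppol a K w z : (0 < K)%N -> K.-primitive_root w ->
  cavg w K (fun z => cabs (ppol a K z) ^+ 2) z = qpol a K z.
Proof.
move=> K0 Hw; rewrite /cavg /ppol.
have -> : \sum_(k < K) cabs (\sum_(n < K) a n * (w ^+ k * z) ^+ n) ^+ 2 =
    \sum_(k < K) cabs (\sum_(n < K) (a n * z ^+ n) * w ^+ (k * n)) ^+ 2.
  apply: eq_bigr => k _; congr (cabs _ ^+ 2); apply: eq_bigr => n _.
  by rewrite exprMn -exprM mulrA mulrAC.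
rewrite (dft_parseval _ Hw) mulKf ?pnatr_eq0 -?lt0n//.
by apply: eq_bigr => n _; rewrite cabsM cabsX exprMn -exprM [(n * 2)%N]mulnC.
Qed.

Let p2_ge0 f z : 0 <= cabs (f z) ^+ 2. Proof. exact: sqr_ge0. Qed.

Lemma wnorm_ppol a K : wnorm (ppol a K) = (\sum_(n < K) cabs (a n) ^+ 2 * h n)%:E.
Proof.
case: K => [|K].
  rewrite big_ord0 /wnorm /plane_integral -[RHS](@integral0 _ _ _ (@plane_measure R) setT).
  apply: eq_integral => p _; rewrite /ppol big_ord0 cabs0 expr0n mul0r//.
have [w Hw] := prim_root_ex R (ltn0Sn K).
have mp := pmeas_cabs2 (cmeas_ppol a K.+1).
rewrite /wnorm -(integral_cavg (ltn0Sn K) Hw mp (p2_ge0 _)) -integral_qpol.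
by congr plane_integral; apply/funext => z; rewrite cavg_ppol.
Qed.

Lemma geo_tail (c : nat -> C) l (M : R) : 0 <= M ->
  (forall n, cabs (c n) <= M * (1 / 2) ^+ n) -> cser c l ->
  forall K, cabs (l - \sum_(n < K) c n) <= 2 * M * (1 / 2) ^+ K.
Proof.
move=> M0 Hc Hl K.
have tail N : cabs (\sum_(n < N + K) c n - \sum_(n < K) c n) <=
    2 * M * (1 / 2) ^+ K - 2 * M * (1 / 2) ^+ (N + K).
  elim: N => [|N IH]; first by rewrite add0n !subrr cabs0.
  rewrite addSn big_ord_recr /= addrAC (le_trans (ler_cabsD _ _))//.
  apply: (le_trans (lerD IH (Hc _))).
  by rewrite exprS le_eqVlt; apply/orP; left; apply/eqP; field.
rewrite -subr_le0; move: Hl; rewrite /cser -(cvg_shiftn K) => Hl.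
apply: (cvg0_unique _ Hl) => N; rewrite lerBlDr.
have := ler_cabsD (l - \sum_(n < N + K) c n) (\sum_(n < N + K) c n - \sum_(n < K) c n).
rewrite addrA subrK => /le_trans; apply; rewrite lerD2l (le_trans (tail N))//.
by rewrite lerBlDr lerDl mulr_ge0 ?exprn_ge0// mulr_ge0.
Qed.

Section entire_function.
Variables (f : C -> C) (a : nat -> C).
Hypothesis ra : rapid a.
Hypothesis fa : forall z, cser (fun n => a n * z ^+ n) (f z).

Let mf : cmeas f := cmeas_pseries fa.

Lemma ppol_approx (r : R) : 0 < r -> exists2 M : R, 0 <= M & forall z K, cabs z <= r ->
  cabs (f z - ppol a K z) <= 2 * M * (1 / 2) ^+ K /\ cabs (ppol a K z) <= 2 * M.
Proof.
move=> r0; have [M M0 HM] := rapid_bound ra r0; exists M => // z K zr.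
have Hc n : cabs (a n * z ^+ n) <= M * (1 / 2) ^+ n.
  apply: le_trans (HM n); rewrite cabsM cabsX ler_wpM2l ?cabs_ge0//.
  by rewrite lerXn2r ?nnegrE ?cabs_ge0// ltW.
split; first exact: geo_tail (fa z) _.
apply: (le_trans (ler_cabs_sum _ _ _)); apply: (@le_trans _ _ (\sum_(n < K) M * (1 / 2) ^+ n)); first by apply: ler_sum => n _; exact: Hc.
by rewrite -mulr_sumr mulrC ler_wpM2r// geo_sum_le.
Qed.

Lemma ppol_cvg z : (fun K => cabs (ppol a K z) ^+ 2) @ \oo --> cabs (f z) ^+ 2.
Proof.
rewrite expr2; under eq_fun do rewrite expr2.
suff H : (fun K => cabs (ppol a K z)) @ \oo --> cabs (f z) by exact: cvgM.
apply/cvgrPdist_le => e e0; move/cvgrPdist_le: (fa z) => /(_ e e0).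
apply: filterS => n; rewrite sub0r normrN ger0_norm ?cabs_ge0//.
by apply: le_trans; exact: cabs_lip.
Qed.

Lemma parseval_ge (B : \bar R) : (forall K, ((\sum_(n < K) cabs (a n) ^+ 2 * h n)%:E <= B)%E) ->
  (wnorm f <= B)%E.
Proof.
move=> HB; apply: (@plane_fatou R (fun K z => cabs (ppol a K z) ^+ 2 * W z)).
- by move=> K; apply: (pmeasM (pmeas_cabs2 (cmeas_ppol a K)) mW).
- by move=> K z; rewrite mulr_ge0// sqr_ge0.
- by move=> z; apply: cvgM; [exact: ppol_cvg|exact: cvg_cst].
- by move=> K; rewrite -[plane_integral _]/(wnorm _) wnorm_ppol.
Qed.

(** The K-fold rotation averages of |f|^2 have the same weighted integral as |f|^2 and are
    asymptotically at least the angular mean [qpol a D]. Cutting them off at [qpol a D] by a minimum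
    makes them converge to it, and Fatou applies. *)
Lemma parseval_le D : ((\sum_(n < D) cabs (a n) ^+ 2 * h n)%:E <= wnorm f)%E.
Proof.
rewrite -integral_qpol.
have /choice[w Hw] : forall K, exists z : C, K.+1.-primitive_root z.
  by move=> K; exact: prim_root_ex.
have mf2 := pmeas_cabs2 mf.
pose A K z := cavg (w K) K.+1 (fun z => cabs (f z) ^+ 2) z.
have A0 K z : 0 <= A K z by rewrite mulr_ge0 ?invr_ge0// sumr_ge0.
have mA K : pmeas (A K) by exact: pmeas_cavg.
apply: (@plane_fatou R (fun K z => Num.min (A K z) (qpol a D z) * W z)).
- move=> K; apply: (pmeasM _ mW); exact: (measurable_minr (mA K) (pmeas_qpol a D)).
- by move=> K z; rewrite mulr_ge0// le_min A0 qpol_ge0.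
- move=> z; apply: cvgM; last exact: cvg_cst.
  have [|M M0 HM] := @ppol_approx (cabs z + 1); first by rewrite ltr_wpDl// cabs_ge0.
  (* With p the Taylor polynomial and d the size of the remainder, |f|^2 >= p^2 - 2 p d, where p <=
     2M and d <= 2M/2^K at length K. The loss is at most 8 M^2/2^K, and averaging preserves it. *)
  have Hlow K : (D <= K.+1)%N -> qpol a D z - 8 * M ^+ 2 * (1 / 2) ^+ K.+1 <= A K z.
    move=> DK; have K0 : (0 : R) < K.+1%:R by rewrite ltr0n.
    apply: (@le_trans _ _ (qpol a K.+1 z - 8 * M ^+ 2 * (1 / 2) ^+ K.+1)).
      rewrite lerD2r /qpol -(subnKC DK) big_split_ord /= lerDl.
      by apply: sumr_ge0 => n _; rewrite mulr_ge0 ?exprn_ge0 ?cabs_ge0.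
    rewrite -(cavg_ppol _ _ (ltn0Sn K) (Hw K)) /A /cavg -(ler_pM2l K0).
    rewrite mulrBr !mulVKf ?gt_eqF//.
    have -> : K.+1%:R * (8 * M ^+ 2 * (1 / 2) ^+ K.+1) =
      \sum_(k < K.+1) 8 * M ^+ 2 * (1 / 2) ^+ K.+1.
      by rewrite sumr_const card_ord mulr_natl.
    rewrite -sumrB.
    apply: ler_sum => k _; set u := w K ^+ k * z.
    have [] := HM u K.+1.
      rewrite /u cabsM cabsX (prim_root_cabs (ltn0Sn K) (Hw K)) expr1n mul1r.
      by rewrite lerDl.
    set t := (1 / 2) ^+ K.+1 => h1 h2.
    have t0 : 0 <= t by rewrite exprn_ge0.
    have := lerB_cabsD (ppol a K.+1 u) (f u - ppol a K.+1 u).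
    rewrite (addrC (ppol a K.+1 u)) subrK => h3.
    have h4 := cabs_ge0 (f u); have h5 := cabs_ge0 (ppol a K.+1 u).
    have h6 := cabs_ge0 (f u - ppol a K.+1 u).
    move: (cabs (f u)) (cabs (ppol a K.+1 u)) (cabs (f u - ppol a K.+1 u)) h1 h2 h3 h4 h5 h6.
    move=> F p d h1 h2 h3 h4 h5 h6.
    have : p * d <= (2 * M) * (2 * M * t) by apply: ler_pM.
    have [h7|h7] := leP d p; last first.
      have : p ^+ 2 <= p * d by rewrite expr2 ler_wpM2l// ltW.
      have : 0 <= F ^+ 2 by exact: sqr_ge0.
      by nra.
    have : (p - d) ^+ 2 <= F ^+ 2 by rewrite lerXn2r ?nnegrE// subr_ge0.
    by have := sqr_ge0 d; nra.
  apply: (@squeeze_cvgr _ _ _ _ (fun K => qpol a D z - 8 * M ^+ 2 * (1 / 2) ^+ K.+1)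
     (fun=> qpol a D z)).
  + exists D => // K /= DK; rewrite ge_min lexx orbT andbT le_min Hlow ?lerBlDr ?lerDl//=.
      by rewrite mulr_ge0 ?exprn_ge0// mulr_ge0// sqr_ge0.
    exact: leq_trans DK _.
  + rewrite -[X in _ --> X]subr0; apply: cvgB; first exact: cvg_cst.
    rewrite -(mulr0 (8 * M ^+ 2)); apply: cvgMr.
    rewrite (cvg_shiftS (fun K => (1 / 2 : R) ^+ K)); apply: cvg_expr.
    by rewrite ger0_norm//; lra.
  + exact: cvg_cst.
- move=> K; rewrite /wnorm -(integral_cavg (ltn0Sn K) (Hw K) mf2 (p2_ge0 _)).
  apply: plane_integral_le.
  + apply: (pmeasM _ mW); exact: (measurable_minr (mA K) (pmeas_qpol a D)).
  + exact: (pmeasM (mA K) mW).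
  + move=> z; rewrite mulr_ge0 ?le_min ?A0 ?qpol_ge0//=.
    by rewrite ler_wpM2r// ge_min lexx.
Qed.

End entire_function.
End parseval.

(** * Sums of exponentials and domination of Gaussians *)

Section exponential_sums.
Variable R : realType.
Implicit Types (x : R).

Lemma expR1_ge2 : 2 <= expR 1 :> R.
Proof. by have := expR_ge1Dx (1 : R). Qed.

Lemma expRN1_le : expR (-1) <= 1 / 2 :> R.
Proof.
by rewrite expRN div1r lef_pV2 ?posrE ?expR_gt0// expR1_ge2.
Qed.

Let expsum_le0 K x : x <= 0 -> \sum_(k < K) expR (- `|x - k%:R|) <= 2 * expR x.
Proof.
elim: K x => [|K IH] x x0; first by rewrite big_ord0 mulr_ge0// expR_ge0.
rewrite big_ord_recl /= subr0 ler0_norm// opprK.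
have := IH (x - 1) ltac:(by rewrite subr_le0 (le_trans x0)).
have -> : \sum_(k < K) expR (- `|x - 1 - k%:R|) =
    \sum_(k < K) expR (- `|x - (lift ord0 k)%:R|).
  by apply: eq_bigr => k _; rewrite lift0 -natr1; congr (expR (- `|_|)); ring.
rewrite expRD => h; have := ler_wpM2l (expR_ge0 x) expRN1_le; lra.
Qed.

(** Induction on K shifts x by 1. Subtracting exp(- x) strengthens the claim enough to pay for the
    split-off term, because exp(1 - x) >= 2 exp(- x). *)
Let expsum_gt K x : \sum_(k < K) expR (- `|x - k%:R|) <= 4 - (if 0 < x then expR (- x) else 0).
Proof.
elim: K x => [|K IH] x.
  rewrite big_ord0; case: ifP => x0; last by rewrite subr0.
  by rewrite subr_ge0 (@le_trans _ _ 1)// ?ler1n// -expR0 ler_expR lerNl oppr0 ltW.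
case: ifPn => [x0|]; last first.
  rewrite -leNgt => x0; rewrite subr0 (le_trans (expsum_le0 K.+1 x0))//.
  by have : expR x <= 1 by [rewrite -expR0 ler_expR]; lra.
rewrite big_ord_recl /= subr0 gtr0_norm//.
have -> : \sum_(k < K) expR (- `|x - (lift ord0 k)%:R|) =
    \sum_(k < K) expR (- `|x - 1 - k%:R|).
  by apply: eq_bigr => k _; rewrite lift0 -natr1; congr (expR (- `|_|)); ring.
have e1 : expR (- x) <= 1 by rewrite -expR0 ler_expR lerNl oppr0 ltW.
have [x1|x1] := leP x 1.
  have := @expsum_le0 K (x - 1) ltac:(by rewrite subr_le0).
  have : expR (x - 1) <= 1 by rewrite -[leRHS]expR0 ler_expR subr_le0.
  by lra.
have := IH (x - 1); rewrite subr_gt0 x1 opprB.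
have : 2 * expR (- x) <= expR (1 - x).
  by rewrite expRD ler_wpM2r ?expR_ge0// expR1_ge2.
by lra.
Qed.

Lemma expsum K x : \sum_(k < K) expR (- `|x - k%:R|) <= 4.
Proof.
by rewrite (le_trans (expsum_gt K x))// gerBl; case: ifP => // _; exact: expR_ge0.
Qed.

(** The difference of the exponents is the square a (|x| - b/(2a))^2. *)
Lemma gauss_le (a b x : R) : 0 < a ->
  expR (- (a * x ^+ 2)) <= expR (b ^+ 2 / (4 * a)) * expR (- (b * `|x|)).
Proof.
move=> a0; rewrite -expRD ler_expR -subr_ge0.
rewrite (_ : _ - _ = a * (`|x| - b / (2 * a)) ^+ 2).
  by rewrite mulr_ge0 ?sqr_ge0// ltW.
have -> : x ^+ 2 = `|x| ^+ 2 by rewrite real_normK// num_real.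
by field; rewrite gt_eqF.
Qed.

End exponential_sums.

(** * The Fock space and its kernel *)

Section monomial_norms.
Variable R : realType.
Local Notation C := R[i].
Local Notation P := (measurableTypeR R * measurableTypeR R)%type.
Implicit Types (z w : C).

Lemma logp_ge0 (t : R) : 0 <= logp t.
Proof. by rewrite /logp le_max lexx orbT. Qed.

Lemma expR_logp (t : R) : 0 <= t -> expR (logp t) = Num.max 1 t.
Proof.
rewrite le_eqVlt => /predU1P[<-|t0].
  by rewrite /logp ln0// maxxx expR0 max_l.
rewrite /logp; have [t1|t1] := leP 1 t.
  by rewrite max_l ?lnK// ln_ge0.
by rewrite max_r ?expR0// ln_le0// ltW.
Qed.

Definition rectI (a b c d : R) z : R :=
  \1_(`[a, b] `*` `[c, d] : set P) (complex.Re z, complex.Im z).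

Lemma pmeas_rectI a b c d : pmeas (rectI a b c d).
Proof.
have : measurable_fun setT (\1_(`[a, b] `*` `[c, d] : set P) : P -> R).
  by apply: measurable_indic; exact: measurableX.
by apply: eq_measurable_fun => -[x y].
Qed.

Lemma rectI_ge0 a b c d z : 0 <= rectI a b c d z.
Proof. by rewrite /rectI indicE. Qed.

Lemma integral_rectI a b c d : a <= b -> c <= d ->
  plane_integral (rectI a b c d) = ((b - a) * (d - c))%:E.
Proof.
move=> ab cd.
have mR : measurable (`[a, b] `*` `[c, d] : set P) by exact: measurableX.
transitivity (\int[@plane_measure R]_p (\1_(`[a, b] `*` `[c, d] : set P) p)%:E)%E.
  by apply: eq_integral => -[x y].
rewrite integral_indic// setIT.
transitivity ((@lebesgue_measure R) `[a, b]%classic * (@lebesgue_measure R) `[c, d]%classic)%E.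
  by apply: product_measure1E.
have L (u v : R) : u <= v -> (@lebesgue_measure R) `[u, v]%classic = (v - u)%:E.
  move=> uv; rewrite lebesgue_measure_itv/= lte_fin; case: ltP => // vu.
  by rewrite (_ : v = u) ?subrr//; apply/eqP; rewrite eq_le vu.
by rewrite !L.
Qed.

Variable alpha : R.
Hypothesis alpha0 : 0 < alpha.

Definition lmod z : R := logp (cabs z).
Definition wt z : R := expR (- (2 * log2_weight alpha z)).
(** The critical value of log |z| for the n-th monomial. It uses n + 1 rather than n because the
    area element in logarithmic coordinates contributes a factor |z|^2. *)
Definition ctr n : R := n.+1%:R / (2 * alpha).
Definition Hn n : R := expR (n.+1%:R ^+ 2 / (2 * alpha)).

Lemma lmod_ge0 z : 0 <= lmod z. Proof. exact: logp_ge0. Qed.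
Lemma expR_lmod z : expR (lmod z) = Num.max 1 (cabs z).
Proof. by rewrite expR_logp// cabs_ge0. Qed.
Lemma cabs_le_lmod z : cabs z <= expR (lmod z).
Proof. by rewrite expR_lmod le_max lexx orbT. Qed.

Lemma wtE z : wt z = expR (- (2 * alpha * lmod z ^+ 2)).
Proof. by rewrite /wt /log2_weight mulrA. Qed.

Lemma wt_ge0 z : 0 <= wt z. Proof. exact: expR_ge0. Qed.

Lemma wt_radial w z : cabs w = 1 -> wt (w * z) = wt z.
Proof. by move=> h; rewrite !wtE /lmod cabsM h mul1r. Qed.

Lemma pmeas_cabs : pmeas (@cabs R).
Proof.
have h := pmeas_cabs2 (cmeas_id R).
rewrite /pmeas (_ : (fun _ => _) = (@Num.sqrt R) \o (fun p : P => cabs (p.1 +i* p.2)%C ^+ 2)).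
  apply: measurableT_comp h; apply: continuous_measurable_fun.
  exact: sqrt_continuous.
by apply/funext => p /=; rewrite sqrtr_sqr ger0_norm// cabs_ge0.
Qed.

Lemma pmeas_lmod : pmeas lmod.
Proof.
have h : pmeas (fun z => ln (cabs z)).
  by apply: measurableT_comp pmeas_cabs; exact: measurable_ln.
exact: (measurable_maxr h (pmeas_cst 0)).
Qed.

Lemma pmeas_wt : pmeas wt.
Proof.
rewrite /pmeas; under eq_fun do rewrite wtE.
have h : pmeas (fun z => -1 * (2 * alpha * lmod z ^+ 2)).
  exact: (pmeasM (pmeas_cst _) (pmeasM (pmeas_cst _) (pmeasX 2 pmeas_lmod))).
have := measurableT_comp (@measurable_expR R) h.
by apply: eq_measurable_fun => p _ /=; rewrite mulN1r.
Qed.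

(** Completion of the square in u. The factor exp(- 2u) is kept apart because it is cancelled by the
    area at logarithmic radius u. *)
Let square n u : expR (u *+ (2 * n)) * expR (- (2 * alpha * u ^+ 2)) =
  Hn n * (expR (- (2 * u)) * expR (- (2 * alpha * (u - ctr n) ^+ 2))).
Proof.
rewrite /Hn -!expRD -[u *+ _]mulr_natl natrM; congr expR; rewrite /ctr -natr1.
by field; rewrite gt_eqF.
Qed.

Lemma mono_wt_le n z : cabs z ^+ (2 * n) * wt z <=
  Hn n * (expR (- (2 * lmod z)) * expR (- (2 * alpha * (lmod z - ctr n) ^+ 2))).
Proof.
rewrite -square wtE ler_wpM2r ?expR_ge0// -[lmod z *+ _]mulr_natl expRM_natl.
by rewrite lerXn2r ?nnegrE ?cabs_ge0 ?expR_ge0// cabs_le_lmod.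
Qed.

Lemma mono_wt_eq n z : 1 <= cabs z -> cabs z ^+ (2 * n) * wt z =
  Hn n * (expR (- (2 * lmod z)) * expR (- (2 * alpha * (lmod z - ctr n) ^+ 2))).
Proof.
move=> z1; rewrite -square wtE -[lmod z *+ _]mulr_natl expRM_natl.
by rewrite expR_lmod max_r.
Qed.

Lemma pmeas_mono_wt n : pmeas (fun z => cabs z ^+ (2 * n) * wt z).
Proof. exact: (pmeasM (pmeasX _ pmeas_cabs) pmeas_wt). Qed.

Lemma mono_wt_ge0 n z : 0 <= cabs z ^+ (2 * n) * wt z.
Proof. by rewrite mulr_ge0 ?wt_ge0// exprn_ge0// cabs_ge0. Qed.

Lemma Hn_gt0 n : 0 < Hn n. Proof. exact: expR_gt0. Qed.

Definition Cup : R := expR (1 / (8 * alpha)) * expR 3 * 16.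

(** The plane is covered by shells on which [lmod] has integer part k, each enclosed in a square of
    area 4 exp(2k + 2). This area cancels exp(- 2k), the Gaussian becomes exp(- |ctr n - k|) up to a
    constant, and [expsum] adds the shells. *)
Lemma mono_norm_le n :
  (plane_integral (fun z => cabs z ^+ (2 * n) * wt z)%R <= (Cup * Hn n)%:E)%E.
Proof.
pose D := expR (1 / (8 * alpha)) * expR 1.
pose sq_ k := rectI (- expR k.+1%:R) (expR k.+1%:R) (- expR k.+1%:R) (expR k.+1%:R).
pose t k z : R := Hn n * (D * expR (- (2 * k%:R)) * expR (- `|ctr n - k%:R|)) * sq_ k z.
have t0 k z : 0 <= t k z by rewrite /t !mulr_ge0 ?expR_ge0 ?rectI_ge0// ltW.
have mt k : pmeas (t k) by exact: (pmeasM (pmeas_cst _) (pmeas_rectI _ _ _ _)).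
pose g z := cabs z ^+ (2 * n) * wt z.
pose T K z := \sum_(k < K) t k z.
have mT K : pmeas (T K) by apply: pmeas_sum.
have T0 K z : 0 <= T K z by apply: sumr_ge0.
have tle z : g z <= t (Num.truncn (lmod z)) z.
  set k := Num.truncn (lmod z).
  have [k1 k2] : k%:R <= lmod z /\ lmod z < k.+1%:R.
    by apply/andP; exact: truncn_itv (lmod_ge0 z).
  have zk : cabs z <= expR k.+1%:R.
    by rewrite (le_trans (cabs_le_lmod z))// ler_expR ltW.
  have -> : t k z = Hn n * (D * expR (- (2 * k%:R)) * expR (- `|ctr n - k%:R|)).
    rewrite /t /sq_ /rectI indicE mem_set ?mulr1//; split => /=;
      rewrite in_itv /= -ler_norml (le_trans _ zk)//;
      [exact: Re_le_cabs|exact: Im_le_cabs].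
  rewrite (le_trans (mono_wt_le n z))// ler_wpM2l ?(ltW (Hn_gt0 n))//.
  have -> : D * expR (- (2 * k%:R)) * expR (- `|ctr n - k%:R|) =
    expR (- (2 * k%:R)) * (expR (1 / (8 * alpha)) * expR (1 - `|ctr n - k%:R|)).
    by rewrite /D expRD; ring.
  apply: ler_pM; rewrite ?expR_ge0//.
    by rewrite ler_expR lerN2 ler_pM2l.
  have a20 : 0 < 2 * alpha by rewrite mulr_gt0.
  apply: (le_trans (gauss_le 1 (lmod z - ctr n) a20)).
  have -> : 1 ^+ 2 / (4 * (2 * alpha)) = 1 / (8 * alpha).
    by field; rewrite gt_eqF.
  rewrite ler_wpM2l ?expR_ge0// ler_expR mul1r lerNl opprB lerBlDr.
  have -> : ctr n - k%:R = - (lmod z - ctr n) + (lmod z - k%:R) by ring.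
  rewrite (le_trans (ler_normD _ _))// normrN lerD2l ger0_norm ?subr_ge0//.
  by move: k2; rewrite -natr1; lra.
apply: (@plane_fatou R (fun K z => Num.min (g z) (T K z))).
- move=> K; exact: (measurable_minr (pmeas_mono_wt n) (mT K)).
- by move=> K z; rewrite le_min mono_wt_ge0 T0.
- move=> z; apply/cvgrPdist_le => e e0; exists (Num.truncn (lmod z)).+1 => // K /= HK.
  rewrite -/(g z) (min_l _) ?subrr ?normr0 ?(ltW e0)// (le_trans (tle z))//.
  rewrite /T (bigD1 (Ordinal HK))//= lerDl.
  by apply: sumr_ge0.
move=> K; apply: (@le_trans _ _ (plane_integral (T K))).
  apply: plane_integral_le => //.
    exact: (measurable_minr (pmeas_mono_wt n) (mT K)).
  by move=> z; rewrite le_min mono_wt_ge0 T0/= ge_min lexx orbT.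
rewrite plane_integral_sum//.
have E k : plane_integral (t k) =
    (Hn n * (4 * expR 2 * D) * expR (- `|ctr n - k%:R|))%:E.
  rewrite plane_integralZ ?integral_rectI.
  - rewrite -EFinM; congr (_%:E).
    have -> : expR (- (2 * k%:R)) = (expR k%:R)^-1 ^+ 2 :> R.
      by rewrite expRN expRM_natl exprVn.
    rewrite -natr1 expRD (_ : expR 2 = expR 1 ^+ 2); last by rewrite -expRM_natl mulr1.
    by field; rewrite gt_eqF// expR_gt0.
  - by rewrite lerNl (le_trans _ (expR_ge0 _))// oppr_le0 expR_ge0.
  - by rewrite lerNl (le_trans _ (expR_ge0 _))// oppr_le0 expR_ge0.
  - by rewrite !mulr_ge0 ?expR_ge0// ltW.
  - exact: pmeas_rectI.
  - by move=> z; exact: rectI_ge0.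
under eq_bigr do rewrite E.
rewrite sumEFin lee_fin -mulr_sumr.
apply: (le_trans (ler_wpM2l _ (expsum K (ctr n)))).
  by rewrite !mulr_ge0 ?expR_ge0// ltW.
rewrite le_eqVlt; apply/orP; left; apply/eqP; rewrite /Cup /D.
have -> : expR 3 = expR 2 * expR 1 :> R by rewrite -expRD; congr expR; ring.
ring.
Qed.

(** Lower bound from the single rectangle [r, 2r] x [0, r] with log r = [ctr n]. On it [lmod]
    exceeds [ctr n] by at most 2, which costs exp(- 4) in the factor exp(- 2u) and exp(- 8 alpha) in
    the Gaussian. *)
Definition Clow : R := expR (- (4 + 8 * alpha)).

Lemma mono_norm_ge n :
  ((Clow * Hn n)%:E <= plane_integral (fun z => cabs z ^+ (2 * n) * wt z)%R)%E.
Proof.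
pose r := expR (ctr n).
have r0 : 0 < r by exact: expR_gt0.
have c0 : 0 <= ctr n by rewrite divr_ge0// mulr_ge0// ltW.
have r1 : 1 <= r by rewrite -expR0 ler_expR.
pose k := Hn n * Clow * r ^- 2.
have k0 : 0 <= k by rewrite !mulr_ge0 ?expR_ge0 ?invr_ge0 ?exprn_ge0 ?(ltW r0)// ltW.
have mr := pmeas_rectI r (2 * r) 0 r.
have -> : (Clow * Hn n)%:E = plane_integral (fun z => k * rectI r (2 * r) 0 r z).
  rewrite (plane_integralZ k0 mr (rectI_ge0 _ _ _ _)) integral_rectI ?(ltW r0)//; last by lra.
  by rewrite -EFinM; congr (_%:E); rewrite /k; field; rewrite gt_eqF.
apply: plane_integral_le; first exact: (pmeasM (pmeas_cst _) mr).
  exact: pmeas_mono_wt.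
move=> z; rewrite mulr_ge0 ?rectI_ge0//= /rectI indicE.
case: (boolP (_ \in _)) => [|_]; last by rewrite mulr0 mono_wt_ge0.
rewrite inE => -[] /=; rewrite !in_itv/= => /andP[x1 x2] /andP[y1 y2].
rewrite mulr1.
have zr : r <= cabs z by rewrite (le_trans x1)// (le_trans (ler_norm _))// Re_le_cabs.
have zr2 : cabs z <= expR 2 * r.
  have x0 : 0 <= complex.Re z by rewrite (le_trans (ltW r0)).
  rewrite (le_trans (cabs_le_ReIm z))// !ger0_norm//.
  have : 3 <= expR 2 :> R by have := expR_ge1Dx (2 : R); lra.
  by move: r0 x2 y2; clear; nra.
have z1 : 1 <= cabs z by rewrite (le_trans r1).
have [u1 u2] : ctr n <= lmod z /\ lmod z <= ctr n + 2.
  rewrite -ler_expR -[lmod z <= _]ler_expR expR_lmod max_r//; split=> //.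
  by rewrite expRD [leRHS]mulrC; exact: zr2.
rewrite mono_wt_eq// /k -mulrA ler_wpM2l ?(ltW (Hn_gt0 n))//.
rewrite /Clow /r -expRM_natl -expRN -!expRD ler_expR.
have : (lmod z - ctr n) ^+ 2 <= 4.
  by have -> : 4 = 2 ^+ 2 :> R; [ring|rewrite lerXn2r ?nnegrE//; lra].
move/(ler_wpM2l (ltW alpha0)); move: u1 u2; clear; nra.
Qed.

Definition hn n : R := fine (plane_integral (fun z => cabs z ^+ (2 * n) * wt z)).

Lemma hnE n : plane_integral (fun z => cabs z ^+ (2 * n) * wt z)%R = (hn n)%:E.
Proof.
rewrite /hn fineK// ge0_fin_numE; last by apply: plane_integral_ge0; exact: mono_wt_ge0.
by rewrite (le_lt_trans (mono_norm_le n))// ltry.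
Qed.

Lemma hn_bounds n : Clow * Hn n <= hn n <= Cup * Hn n.
Proof. by rewrite -!lee_fin -hnE mono_norm_ge mono_norm_le. Qed.

End monomial_norms.

Section fock_space.
Variable R : realType.
Local Notation C := R[i].
Variable alpha : R.
Hypothesis alpha0 : 0 < alpha.
Implicit Types (f g : C -> C) (a b : nat -> C) (z w : C).

Local Notation phi := (log2_weight alpha).
Local Notation wt := (wt alpha).
Local Notation hn := (hn alpha).
Local Notation N := (fock_norm2 phi).

Definition coefs f a := rapid a /\ forall z, cser (fun n => a n * z ^+ n) (f z).

Lemma fock_coefs f : fock phi f -> exists a, coefs f a.
Proof. by case=> /entire_pseries[a [h1 h2]] _; exists a. Qed.

Lemma coefs_entire f a : coefs f a -> entire f.
Proof. by case; exact: pseries_entire. Qed.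

Let wt0 := wt_ge0 alpha.
Let mwt := pmeas_wt alpha.
Let wtR := @wt_radial R alpha.
Let hE := hnE alpha0.

Lemma hn_gt0 n : 0 < hn n.
Proof.
have /andP[h _] := hn_bounds alpha0 n; apply: lt_le_trans h.
by rewrite mulr_gt0 ?expR_gt0// Hn_gt0.
Qed.

Lemma fock_partial f a K : coefs f a ->
  ((\sum_(n < K) cabs (a n) ^+ 2 * hn n)%:E <= N f)%E.
Proof. by case=> h1 h2; exact: (parseval_le wt0 mwt wtR hE h1 h2). Qed.

Lemma fock_norm_le f a (B : \bar R) : coefs f a ->
  (forall K, ((\sum_(n < K) cabs (a n) ^+ 2 * hn n)%:E <= B)%E) -> (N f <= B)%E.
Proof. by case=> h1 h2; exact: (parseval_ge wt0 mwt wtR hE h2). Qed.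

Lemma fock_norm_fin f : fock phi f -> N f = (fine (N f))%:E.
Proof.
case=> _ h; rewrite fineK// ge0_fin_numE// plane_integral_ge0// => z.
by rewrite mulr_ge0 ?sqr_ge0// expR_ge0.
Qed.

Lemma fock_norm_cvg f a : fock phi f -> coefs f a ->
  (fun K => \sum_(n < K) cabs (a n) ^+ 2 * hn n) @ \oo --> fine (N f).
Proof.
move=> Ff ha; set s := (fun K => _).
have s_le K : s K <= fine (N f).
  by rewrite -lee_fin -fock_norm_fin//; exact: fock_partial.
have nd : nondecreasing_seq s.
  apply/nondecreasing_seqP => K; rewrite /s big_ord_recr /= lerDl.
  by rewrite mulr_ge0 ?sqr_ge0// ltW// hn_gt0.
have hub : has_ubound (range s) by exists (fine (N f)) => _ [K _ <-].
have := nondecreasing_cvgn nd hub; congr (_ --> _).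
apply/eqP; rewrite eq_le; apply/andP; split.
  by apply: ge_sup; [exists (s 0%N), 0%N|move=> _ [K _ <-]].
rewrite -lee_fin -fock_norm_fin//; apply: (fock_norm_le ha) => K.
by rewrite lee_fin; apply: ub_le_sup => //; exists K.
Qed.

Lemma rapidD a b : rapid a -> rapid b -> rapid (fun n => a n + b n).
Proof.
move=> ha hb r r0; have [M HM] := ha r r0; have [M' HM'] := hb r r0.
exists (M + M') => n; apply: (le_trans _ (lerD (HM n) (HM' n))).
by rewrite -mulrDl ler_wpM2r ?exprn_ge0 ?(ltW r0)// ler_cabsD.
Qed.

Lemma rapidZ k a : rapid a -> rapid (fun n => k * a n).
Proof.
move=> ha r r0; have [M HM] := ha r r0; exists (cabs k * M) => n.
by rewrite cabsM -mulrA ler_wpM2l ?cabs_ge0.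
Qed.

Lemma coefsD f g a b : coefs f a -> coefs g b ->
  coefs (fun z => f z + g z) (fun n => a n + b n).
Proof.
move=> [h1 h2] [h3 h4]; split; first exact: rapidD.
by move=> z; apply: eq_cser (cserD (h2 z) (h4 z)) => n; rewrite mulrDl.
Qed.

Lemma coefsZ k f a : coefs f a -> coefs (fun z => k * f z) (fun n => k * a n).
Proof.
move=> [h1 h2]; split; first exact: rapidZ.
by move=> z; apply: eq_cser (cserZ k (h2 z)) => n; rewrite mulrA.
Qed.

Lemma coefs_cmeas f a : coefs f a -> cmeas f.
Proof. by case=> _; exact: cmeas_pseries. Qed.

Let pmeas_norm f a : coefs f a -> pmeas (fun z => cabs (f z) ^+ 2 * wt z).
Proof. by move=> /coefs_cmeas h; exact: (pmeasM (pmeas_cabs2 h) mwt). Qed.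

Let norm_ge0 f z : 0 <= cabs (f z) ^+ 2 * wt z.
Proof. by rewrite mulr_ge0 ?sqr_ge0. Qed.

Lemma fockD f g : fock phi f -> fock phi g -> fock phi (fun z => f z + g z).
Proof.
move=> Ff Fg; have [a ha] := fock_coefs Ff; have [b hb] := fock_coefs Fg.
split; first exact: coefs_entire (coefsD ha hb).
have mf := pmeas_norm ha; have mg := pmeas_norm hb.
apply: (@le_lt_trans _ _ (plane_integral (fun z => \sum_(i <- [:: f; g])
    2 * (cabs (i z) ^+ 2 * wt z)))).
  apply: plane_integral_le; first exact: pmeas_norm (coefsD ha hb).
    have := pmeasD (pmeasM (pmeas_cst 2) mf) (pmeasM (pmeas_cst 2) mg).
    by apply: eq_measurable_fun => p _; rewrite big_cons big_seq1.
  move=> z; rewrite (norm_ge0 (fun z => f z + g z))/= big_cons big_seq1 -mulrDr -mulrDl mulrA.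
  rewrite ler_wpM2r//.
  have : cabs (f z + g z) ^+ 2 <= (cabs (f z) + cabs (g z)) ^+ 2.
    by rewrite lerXn2r ?nnegrE ?addr_ge0 ?cabs_ge0// ler_cabsD.
  by have := sqr_ge0 (cabs (f z) - cabs (g z)); nra.
have -> : plane_integral (fun z => \sum_(i <- [:: f; g]) 2 * (cabs (i z) ^+ 2 * wt z)) =
    (2%:E * N f + 2%:E * N g)%E.
  rewrite -[N f]/(plane_integral _) -[N g]/(plane_integral _).
  rewrite -(plane_integralZ _ mf)// -(plane_integralZ _ mg)//.
  (* [plane_integral_sum] asks for measurability at every value of the index type; Booleans replace
     arbitrary functions as indices so that this holds. *)
  transitivity (plane_integral (fun z => \sum_(i <- [:: true; false])
    2 * (cabs ((if i then f else g) z) ^+ 2 * wt z))).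
    by congr plane_integral; apply/funext => z; rewrite !big_cons !big_nil.
  rewrite plane_integral_sum ?big_cons ?big_nil ?adde0//.
    by case; [exact: (pmeasM (pmeas_cst 2) mf)|exact: (pmeasM (pmeas_cst 2) mg)].
  by move=> i z; rewrite mulr_ge0.
by rewrite (fock_norm_fin Ff) (fock_norm_fin Fg) -!EFinM -EFinD ltry.
Qed.

Lemma fockZ k f : fock phi f -> fock phi (fun z => k * f z).
Proof.
move=> Ff; have [a ha] := fock_coefs Ff.
split; first exact: coefs_entire (coefsZ k ha).
have mf := pmeas_norm ha.
have -> : N (fun z => k * f z) = ((cabs k ^+ 2)%:E * N f)%E.
  rewrite -[N f]/(plane_integral _) -plane_integralZ ?sqr_ge0//.
  by congr plane_integral; apply/funext => z; rewrite cabsM exprMn mulrA.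
by rewrite (fock_norm_fin Ff) -EFinM ltry.
Qed.

Let Repart f g z := complex.Re (f z * (g z)^*%C * (wt z)%:C%C).

(** Polarization: 4 Re(f conj g) = |f + g|^2 - |f - g|^2. Signed integrals thereby reduce to norms,
    to which Parseval's identity applies. *)
Let Repart_fine f g a b : fock phi f -> fock phi g -> coefs f a -> coefs g b ->
  4 * fine (plane_integral (Repart f g)) =
  fine (N (fun z => f z + g z)) - fine (N (fun z => f z + (-1) * g z)).
Proof.
move=> Ff Fg ha hb.
have F1 := fockD Ff Fg; have F2 := fockD Ff (fockZ (-1) Fg).
have h1 := coefsD ha hb; have h2 := coefsD ha (coefsZ (-1) hb).
have int f' a' : fock phi f' -> coefs f' a' -> (@plane_measure R).-integrable setT
    (fun p => (1 / 4 * (cabs (f' (p.1 +i* p.2)%C) ^+ 2 * wt (p.1 +i* p.2)%C))%:E).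
  move=> Ff' hf'; apply/integrableP; split.
    by apply/measurable_EFinP; exact: (pmeasM (pmeas_cst _) (pmeas_norm hf')).
  rewrite (_ : (\int[_]_(_ in _) _)%E = ((1 / 4)%:E * N f')%E).
    by rewrite (fock_norm_fin Ff') -EFinM ltry.
  rewrite -[N f']/(plane_integral _) -plane_integralZ//; last exact: pmeas_norm hf'.
  apply: eq_integral => p _; rewrite gee0_abs// lee_fin.
  by rewrite mulr_ge0.
have i1 := int _ _ F1 h1; have i2 := int _ _ F2 h2.
have E : plane_integral (Repart f g) =
    ((1 / 4)%:E * N (fun z => f z + g z)%R - (1 / 4)%:E * N (fun z => f z + (-1) * g z)%R)%E.
  rewrite -[N (fun z => f z + g z)]/(plane_integral _).
  rewrite -[N (fun z => f z + -1 * g z)]/(plane_integral _).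
  have q0 : 0 <= 1 / 4 :> R by rewrite divr_ge0.
  rewrite -(plane_integralZ q0 (pmeas_norm h1) (norm_ge0 _)).
  rewrite -(plane_integralZ q0 (pmeas_norm h2) (norm_ge0 _)).
  rewrite -integralB_EFin//; apply: eq_integral => p _; rewrite -EFinB; congr (_%:E).
  set z := (p.1 +i* p.2)%C; rewrite -mulrBr -mulrBl /Repart mulrC ReZ.
  rewrite -/(wt z) mulrC [RHS]mulrA; congr (_ * _).
  rewrite !cabs_sqr !Re_mul !ReD !ImD !ReJ !ImJ Re_mul Im_mul.
  by rewrite ReN ImN /=; field.
by rewrite E (fock_norm_fin F1) (fock_norm_fin F2) -!EFinM -EFinB /=; field.
Qed.

(** The real part follows from polarization on both the function side and the coefficient side. The
    imaginary part is the real part for i g in place of g, since Re(f conj(i g)) = Im(f conj g). *)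
Lemma fock_dot_series f g a b : fock phi f -> fock phi g -> coefs f a -> coefs g b ->
  cser (fun n => a n * (b n)^*%C * (hn n)%:C%C) (fock_dot phi f g).
Proof.
move=> Ff Fg ha hb.
have key g' b' : fock phi g' -> coefs g' b' ->
    (fun K => \sum_(n < K) complex.Re (a n * (b' n)^*%C * (hn n)%:C%C)) @ \oo -->
    fine (plane_integral (Repart f g')).
  move=> Fg' hb'.
  have c1 := fock_norm_cvg (fockD Ff Fg') (coefsD ha hb').
  have c2 := fock_norm_cvg (fockD Ff (fockZ (-1) Fg')) (coefsD ha (coefsZ (-1) hb')).
  have -> : (fun K => \sum_(n < K) complex.Re (a n * (b' n)^*%C * (hn n)%:C%C)) =
     (fun K => 1 / 4 * (\sum_(n < K) cabs (a n + b' n) ^+ 2 * hn n -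
       \sum_(n < K) cabs (a n + -1 * b' n) ^+ 2 * hn n)).
    apply/funext => K; rewrite -sumrB mulr_sumr; apply: eq_bigr => n _.
    rewrite mulrC ReZ -mulrBl [RHS]mulrA [RHS]mulrC; congr (_ * _).
    rewrite !cabs_sqr !Re_mul !ReD !ImD !ReJ !ImJ Re_mul Im_mul.
    by rewrite ReN ImN /=; field.
  have -> : fine (plane_integral (Repart f g')) = 1 / 4 *
      (fine (N (fun z => f z + g' z)) - fine (N (fun z => f z + -1 * g' z))).
    by rewrite -(Repart_fine Ff Fg' ha hb'); field.
  by apply: cvgM; [exact: cvg_cst|exact: cvgB].
apply: cser_ReIm.
  by under eq_fun do rewrite Re_sum; exact: key.
have := key _ _ (fockZ 'i%C Fg) (coefsZ 'i%C hb).
have -> : fine (plane_integral (Repart f (fun z => 'i%C * g z))) =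
    complex.Im (fock_dot phi f g).
  congr (fine (plane_integral _)); apply/funext => z.
  rewrite /Repart -/(wt z) [in LHS]mulrC [in RHS]mulrC ReZ ImZ.
  by rewrite !Re_mul !Im_mul !ReJ !ImJ !Re_mul !Im_mul /=; ring.
have -> // : (fun K => \sum_(n < K) complex.Re (a n * ('i%C * b n)^*%C * (hn n)%:C%C)) =
  (fun K => complex.Im (\sum_(n < K) a n * (b n)^*%C * (hn n)%:C%C)).
apply/funext => K; rewrite Im_sum; apply: eq_bigr => n _.
rewrite [in LHS]mulrC [in RHS]mulrC ReZ ImZ.
by rewrite !Re_mul !Im_mul !ReJ !ImJ !Re_mul !Im_mul /=; ring.
Qed.

End fock_space.

(** * The reproducing kernel and its size on the diagonal *)

Section kernel.
Variable R : realType.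
Local Notation C := R[i].
Variable alpha : R.
Hypothesis alpha0 : 0 < alpha.
Implicit Types (f g : C -> C) (a b : nat -> C) (z w : C).

Local Notation phi := (log2_weight alpha).
Local Notation hn := (hn alpha).
Local Notation Hn := (Hn alpha).

Let h0 := hn_gt0 alpha0.

Lemma pow_le_Hn (t : R) : 0 < t -> exists2 M : R, 0 <= M & forall n, t ^+ n <= M * Hn n.
Proof.
move=> t0; exists (expR (alpha * ln t ^+ 2 / 2 - ln t)); first exact: expR_ge0.
move=> n; rewrite -{1}(lnK t0) -expRM_natl /Hn -expRD ler_expR -subr_ge0.
rewrite (_ : _ - _ = (n.+1%:R - alpha * ln t) ^+ 2 / (2 * alpha)).
  by rewrite divr_ge0 ?sqr_ge0// mulr_ge0// ltW.
by rewrite -natr1; field; rewrite gt_eqF.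
Qed.

Definition kcoef z n : C := (z^*%C) ^+ n / (hn n)%:C%C.

Lemma cabs_kcoef z n : cabs (kcoef z n) = cabs z ^+ n / hn n.
Proof. by rewrite cabsM cabsV cabsX cabs_conj cabs_real gtr0_norm. Qed.

Lemma conj_kcoef z n : (kcoef z n)^*%C = z ^+ n / (hn n)%:C%C.
Proof.
have hJ (u v : C) : (u / v)^*%C = u^*%C / v^*%C.
  by rewrite (rmorphM (@conjc R)) (fmorphV (@conjc R)).
have hX (u : C) k : (u ^+ k)^*%C = (u^*%C) ^+ k by exact: (rmorphXn (@conjc R)).
by rewrite /kcoef hJ hX conjcK conjc_real.
Qed.

Lemma rapid_kcoef z : rapid (kcoef z).
Proof.
move=> r r0; have t0 : 0 < (cabs z + 1) * r.
  by rewrite mulr_gt0// ltr_wpDl// cabs_ge0.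
have [M M0 HM] := pow_le_Hn t0; exists (M / Clow alpha) => n.
rewrite cabs_kcoef mulrAC -exprMn ler_pdivrMr//.
have /andP[h _] := hn_bounds alpha0 n.
apply: (@le_trans _ _ (M / Clow alpha * (Clow alpha * Hn n))); last first.
  by rewrite ler_wpM2l// divr_ge0// expR_ge0.
rewrite mulrA divfK ?gt_eqF ?expR_gt0// (le_trans _ (HM n))//.
rewrite lerXn2r ?nnegrE ?mulr_ge0 ?addr_ge0 ?cabs_ge0 ?(ltW r0)//.
by rewrite ler_wpM2r ?(ltW r0)// lerDl.
Qed.

Definition kern z : C -> C := pval (kcoef z).

Lemma coefs_kern z : coefs (kern z) (kcoef z).
Proof. by split; [exact: rapid_kcoef|move=> w; apply: pvalP; exact: rapid_kcoef]. Qed.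

Lemma fock_kern z : fock phi (kern z).
Proof.
split; first exact: coefs_entire (coefs_kern z).
have r0 : 0 < cabs z + 1 by rewrite ltr_wpDl// cabs_ge0.
have [M M0 HM] := rapid_bound (@rapid_kcoef z) r0.
apply: (@le_lt_trans _ _ (M * 2)%:E); last exact: ltry.
apply: (fock_norm_le alpha0 (coefs_kern z)) => K; rewrite lee_fin.
apply: (@le_trans _ _ (\sum_(n < K) M * (1 / 2) ^+ n)); last first.
  by rewrite -mulr_sumr ler_wpM2l// geo_sum_le.
apply: ler_sum => n _; apply: le_trans (HM n).
rewrite expr2 -mulrA ler_wpM2l ?cabs_ge0// cabs_kcoef divfK ?gt_eqF//.
by rewrite lerXn2r ?nnegrE ?cabs_ge0 ?(ltW r0)// lerDl.
Qed.

Lemma kern_repro z : is_repro_kernel phi z (kern z).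
Proof.
split; first exact: fock_kern.
move=> f Ff; have [a ha] := fock_coefs Ff.
apply: (@cser_unique R (fun n => a n * z ^+ n)); first exact: ha.2.
apply: eq_cser (fock_dot_series alpha0 Ff (fock_kern z) ha (coefs_kern z)) => n.
rewrite conj_kcoef -mulrA mulfVK//.
by rewrite -cabs_eq0 cabs_real normr_eq0 gt_eqF.
Qed.

Lemma repro_kernelP z : is_repro_kernel phi z (repro_kernel phi z).
Proof. by rewrite /repro_kernel; apply: xgetPex; exists (kern z); exact: kern_repro. Qed.

Lemma cser_conj (b : nat -> C) (l : C) : cser b l ->
  cser (fun n => (b n)^*%C) (l^*)%C.
Proof.
rewrite /cser => h; rewrite (_ : (fun _ => _) = (fun M => cabs (l - \sum_(n < M) b n)))//.
by apply/funext => M; rewrite -cabs_conj rmorphB /= conjcK rmorph_sum /=;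
  under eq_bigr do rewrite conjcK.
Qed.

Definition kappa z : R := complex.Re (repro_kernel phi z z).

(** [repro_kernel] is an arbitrary choice among representing elements. Applying the reproducing
    property of it and of the explicit [kern z] to each other shows that their values at z are
    conjugate, and the second one is the series. *)
Lemma kappa_cvg z : (fun K => \sum_(n < K) cabs z ^+ (2 * n) / hn n) @ \oo --> kappa z.
Proof.
have [Fk hk] := repro_kernelP z; have [c hc] := fock_coefs Fk.
have [Fl hl] := kern_repro z.
have h1 := fock_dot_series alpha0 Fk Fl hc (coefs_kern z).
have h2 := fock_dot_series alpha0 Fl Fk (coefs_kern z) hc.
have E : repro_kernel phi z z = (kern z z)^*%C.
  rewrite (hl _ Fk) (hk _ Fl); apply: (cser_unique h1).
  apply: eq_cser (cser_conj h2) => n.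
  have hM (u v : C) : (u * v)^*%C = u^*%C * v^*%C by exact: (rmorphM (@conjc R)).
  by rewrite !hM conjcK conjc_real; congr (_ * _); exact: mulrC.
rewrite /kappa E ReJ.
have := cser_Re ((coefs_kern z).2 z).
have -> // : (fun K => complex.Re (\sum_(n < K) kcoef z n * z ^+ n)) =
  (fun K => \sum_(n < K) cabs z ^+ (2 * n) / hn n).
apply/funext => K; rewrite Re_sum; apply: eq_bigr => n _.
rewrite /kcoef mulrAC -exprMn (mulrC _ z) -cabs_sqrC exprM.
by rewrite -rmorphXn -fmorphV -rmorphM /=.
Qed.

(** Scaled so that the monomial of degree n is normalized to peak at [tau] = n + 1. *)
Definition tau z : R := 2 * alpha * lmod z.
(** The size of k_z(z) up to constants depending on alpha only. *)
Definition Ek z : R := expR (2 * alpha * lmod z ^+ 2 - 2 * lmod z).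

Lemma tau_ge0 z : 0 <= tau z.
Proof. by rewrite mulr_ge0 ?lmod_ge0// mulr_ge0// ltW. Qed.

Let gauss n z : expR (lmod z *+ (2 * n)) =
  Hn n * (Ek z * expR (- (1 / (2 * alpha) * (n.+1%:R - tau z) ^+ 2))).
Proof.
rewrite /Hn /Ek -!expRD -[_ *+ _]mulr_natl natrM -natr1 /tau; congr expR.
by field; rewrite gt_eqF.
Qed.

Lemma kterm_le n z : cabs z ^+ (2 * n) / hn n <=
  (Clow alpha)^-1 * (Ek z * expR (- (1 / (2 * alpha) * (n.+1%:R - tau z) ^+ 2))).
Proof.
have /andP[h _] := hn_bounds alpha0 n; have C0 : 0 < Clow alpha by exact: expR_gt0.
rewrite ler_pdivrMr// -[leRHS]mulrA [leRHS]mulrC ler_pdivlMr//.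
apply: (@le_trans _ _ (expR (lmod z *+ (2 * n)) * Clow alpha)).
  rewrite ler_wpM2r ?(ltW C0)// -mulr_natl expRM_natl.
  by rewrite lerXn2r ?nnegrE ?cabs_ge0 ?expR_ge0// cabs_le_lmod.
rewrite gauss mulrAC [Hn n * _]mulrC [leRHS]mulrC ler_wpM2r//.
by rewrite mulr_ge0 ?expR_ge0.
Qed.

(** Lower counterpart of [kterm_le]. The hypothesis holds for |z| >= 1 or n = 0, the cases in which
    replacing |z| by max(1, |z|) loses nothing. *)
Lemma kterm_eq n z : cabs z ^+ n = expR (lmod z) ^+ n -> cabs z ^+ (2 * n) / hn n >=
  (Cup alpha)^-1 * (Ek z * expR (- (1 / (2 * alpha) * (n.+1%:R - tau z) ^+ 2))).
Proof.
move=> E; have /andP[_ h] := hn_bounds alpha0 n.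
have C0 : 0 < Cup alpha by rewrite !mulr_gt0// expR_gt0.
set X := Ek z * _; have X0 : 0 <= X by rewrite mulr_ge0 ?expR_ge0.
rewrite ler_pdivlMr// -mulrA mulrC ler_pdivrMr//.
rewrite mulnC exprM E -exprM mulnC -expRM_natl mulr_natl gauss -/X.
have -> : Hn n * X * Cup alpha = (Cup alpha * Hn n) * X by ring.
by rewrite [leLHS]mulrC ler_wpM2r.
Qed.

(** Selects the dominant monomial at z. Inside the unit disc [tau z] = 0, so the exponent is 0 and
    both powers equal 1. *)
Lemma truncn_tau z : cabs z ^+ Num.truncn (tau z) = expR (lmod z) ^+ Num.truncn (tau z) /\
  `|(Num.truncn (tau z)).+1%:R - tau z| <= 1.
Proof.
have /andP[t1 t2] := truncn_itv (tau_ge0 z); split; last first.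
  by rewrite ger0_norm ?subr_ge0 ?(ltW t2)// lerBlDr -natr1 addrC lerD2l.
move: t1; case: (Num.truncn (tau z)) => [|n] t1; first by rewrite !expr0.
rewrite expR_lmod max_r// leNgt; apply/negP => z1.
suff l0 : lmod z = 0.
  by move: t1; rewrite /tau l0 mulr0 lern0.
by apply: expR_inj; rewrite expR_lmod expR0 max_l// (ltW z1).
Qed.

End kernel.

Section kernel_bounds.
Variable R : realType.
Local Notation C := R[i].
Variable alpha : R.
Hypothesis alpha0 : 0 < alpha.
Implicit Types (z w : C).

Local Notation hn := (hn alpha).
Local Notation Hn := (Hn alpha).
Local Notation kappa := (kappa alpha).
Local Notation tau := (tau alpha).
Local Notation Ek := (Ek alpha).

Let h0 := hn_gt0 alpha0.
Let Clow0 : 0 < Clow alpha. Proof. exact: expR_gt0. Qed.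
Let Cup0 : 0 < Cup alpha. Proof. by rewrite !mulr_gt0// expR_gt0. Qed.
Let i2a : 0 < 1 / (2 * alpha). Proof. by rewrite divr_gt0// mulr_gt0. Qed.

Lemma Ek_gt0 z : 0 < Ek z. Proof. exact: expR_gt0. Qed.

Lemma kappa_le : exists2 c : R, 0 < c & forall z, kappa z <= c * Ek z.
Proof.
pose D := expR (1 ^+ 2 / (4 * (1 / (2 * alpha)))).
exists ((Clow alpha)^-1 * (D * 4)); first by rewrite mulr_gt0 ?invr_gt0// mulr_gt0// expR_gt0.
move=> z; rewrite -(cvg_lim _ (kappa_cvg alpha0 (z := z)))//.
apply: limr_le; first exact: cvgP (kappa_cvg alpha0 (z := z)).
apply: nearW => K; apply: (@le_trans _ _ (\sum_(n < K) (Clow alpha)^-1 * Ek z *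
    (D * expR (- `|tau z - 1 - n%:R|)))).
  apply: ler_sum => n _; apply: (le_trans (kterm_le alpha0 n z)).
  rewrite mulrA ler_wpM2l//; first by rewrite mulr_ge0 ?expR_ge0// invr_ge0 ltW.
  apply: (le_trans (gauss_le 1 _ i2a)); rewrite ler_wpM2l ?expR_ge0//.
  rewrite mul1r ler_expR lerN2.
  have -> : n.+1%:R - tau z = - (tau z - 1 - n%:R) by rewrite -natr1; ring.
  by rewrite normrN.
rewrite -mulr_sumr -mulr_sumr.
have -> : (Clow alpha)^-1 * (D * 4) * Ek z = (Clow alpha)^-1 * Ek z * (D * 4) by ring.
rewrite ler_wpM2l//; first by rewrite mulr_ge0 ?expR_ge0// invr_ge0 ltW.
by rewrite ler_wpM2l ?expR_ge0// expsum.
Qed.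

Lemma kappa_ge_term n z : cabs z ^+ (2 * n) / hn n <= kappa z.
Proof.
rewrite -[leRHS](cvg_lim _ (kappa_cvg alpha0 (z := z)))//.
apply: limr_ge; first exact: cvgP (kappa_cvg alpha0 (z := z)).
exists n.+1 => // K /= nK; rewrite (bigD1 (Ordinal nK))//= lerDl.
by apply: sumr_ge0 => k _; rewrite divr_ge0 ?exprn_ge0 ?cabs_ge0// ltW.
Qed.

Lemma kappa_ge : exists2 c : R, 0 < c & forall z, c * Ek z <= kappa z.
Proof.
exists ((Cup alpha)^-1 * expR (- (1 / (2 * alpha)))).
  by rewrite mulr_gt0 ?invr_gt0// expR_gt0.
move=> z; have [E t1] := truncn_tau alpha0 z.
apply: le_trans (kappa_ge_term (Num.truncn (tau z)) z).
apply: le_trans (kterm_eq alpha0 E); rewrite -[leLHS]mulrA ler_wpM2l ?invr_ge0 ?(ltW Cup0)//.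
rewrite [leLHS]mulrC ler_wpM2l ?expR_ge0// ler_expR lerN2 ler_piMr ?(ltW i2a)//.
by rewrite -real_normK ?num_real// expr_le1.
Qed.

Lemma kappa_gt0 z : 0 < kappa z.
Proof. by have [c c0 /(_ z)] := kappa_ge; apply: lt_le_trans; rewrite mulr_gt0// Ek_gt0. Qed.

Definition skap z := Num.sqrt (kappa z).
Definition shn n := Num.sqrt (hn n).

Lemma skap_gt0 z : 0 < skap z. Proof. by rewrite sqrtr_gt0 kappa_gt0. Qed.
Lemma shn_gt0 n : 0 < shn n. Proof. by rewrite sqrtr_gt0. Qed.
Lemma skapE z : skap z ^+ 2 = kappa z. Proof. by rewrite sqr_sqrtr// ltW// kappa_gt0. Qed.
Lemma shnE n : shn n ^+ 2 = hn n. Proof. by rewrite sqr_sqrtr// ltW. Qed.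

(** The normalized matrix entries decay at any prescribed exponential rate, because their squares
    are bounded by a Gaussian; only the constant depends on b. The rates 1, 2 and 3 are used
    below. *)
Lemma entry_le (b : R) : exists2 c : R, 0 < c & forall z n,
  cabs z ^+ n <= c * (skap z * shn n * expR (- (b * `|n.+1%:R - tau z|))).
Proof.
have [c c0 Hc] := kappa_ge.
pose D := expR ((2 * b) ^+ 2 / (4 * (1 / (2 * alpha)))).
have D0 : 0 < D by exact: expR_gt0.
have E0 : 0 <= (Clow alpha)^-1 * D / c by rewrite divr_ge0 ?(ltW c0)// mulr_ge0 ?(ltW D0)// invr_ge0 ltW.
exists (Num.sqrt ((Clow alpha)^-1 * D / c)) => [|z n].
  by rewrite sqrtr_gt0 divr_gt0// mulr_gt0// invr_gt0.
have s0 := ltW (skap_gt0 z); have n0 := ltW (shn_gt0 n).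
rewrite -ler_sqr ?nnegrE ?exprn_ge0 ?cabs_ge0 ?mulr_ge0 ?sqrtr_ge0 ?expR_ge0//.
rewrite -exprM mulnC !exprMn skapE shnE sqr_sqrtr// -expRM_natl.
have := kterm_le alpha0 n z; rewrite ler_pdivrMr// => /le_trans; apply.
have -> : (Clow alpha)^-1 * D / c * (kappa z * hn n * expR (2 * (- (b * `|n.+1%:R - tau z|)))) =
  (Clow alpha)^-1 * (kappa z / c * (D * expR (- (2 * b * `|n.+1%:R - tau z|)))) * hn n.
  have -> : 2 * (- (b * `|n.+1%:R - tau z|)) = - (2 * b * `|n.+1%:R - tau z|) by ring.
  by ring.
rewrite ler_wpM2r ?(ltW (h0 n))// ler_wpM2l ?invr_ge0 ?(ltW Clow0)//.
apply: ler_pM; rewrite ?expR_ge0//; first by rewrite ler_pdivlMr// mulrC.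
exact: gauss_le.
Qed.

Lemma skap_le : exists2 c : R, 0 < c & forall z,
  skap z <= c * expR (alpha * lmod z ^+ 2 - lmod z).
Proof.
have [c c0 Hc] := kappa_le; exists (Num.sqrt c); first by rewrite sqrtr_gt0.
move=> z; have s0 := ltW (skap_gt0 z).
rewrite -ler_sqr ?nnegrE ?mulr_ge0 ?sqrtr_ge0 ?expR_ge0// exprMn skapE sqr_sqrtr ?(ltW c0)//.
rewrite -expRM_natl (le_trans (Hc z))// ler_wpM2l ?(ltW c0)// /Ek ler_expR.
by rewrite le_eqVlt; apply/orP; left; apply/eqP; ring.
Qed.

Lemma shn_le : exists2 c : R, 0 < c & forall n,
  shn n <= c * expR (n.+1%:R ^+ 2 / (4 * alpha)).
Proof.
exists (Num.sqrt (Cup alpha)); first by rewrite sqrtr_gt0.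
move=> n; have s0 := ltW (shn_gt0 n).
rewrite -ler_sqr ?nnegrE ?mulr_ge0 ?sqrtr_ge0 ?expR_ge0// exprMn shnE sqr_sqrtr ?(ltW Cup0)//.
have /andP[_ h] := hn_bounds alpha0 n; rewrite -expRM_natl (le_trans h)//.
rewrite ler_wpM2l ?(ltW Cup0)// /Hn ler_expR le_eqVlt; apply/orP; left; apply/eqP.
by field; rewrite gt_eqF.
Qed.

End kernel_bounds.

(** * Separation and the upper sampling inequality *)

Section schur_test.
Variable R : realType.

(** Variance identity: with total weight S and first moment T, the sum of w (S b - T)^2 is S (S Q -
    T^2). If S = 0, all weights vanish and so does T. *)
Lemma weighted_cauchy_schwarz (J : Type) (r : seq J) (w b : J -> R) :
  (forall j, 0 <= w j) ->
  (\sum_(j <- r) w j * b j) ^+ 2 <= (\sum_(j <- r) w j) * \sum_(j <- r) w j * b j ^+ 2.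
Proof.
move=> w0; set S := \sum_(j <- r) w j; set T := \sum_(j <- r) w j * b j.
set Q := \sum_(j <- r) w j * b j ^+ 2.
have S0 : 0 <= S by exact: sumr_ge0.
have E : \sum_(j <- r) w j * (S * b j - T) ^+ 2 = S * (S * Q - T ^+ 2).
  transitivity (\sum_(j <- r) (S ^+ 2 * (w j * b j ^+ 2) -
      2 * S * T * (w j * b j) + T ^+ 2 * w j)).
    by apply: eq_bigr => j _; ring.
  by rewrite big_split sumrB -!mulr_sumr -/S -/T -/Q /=; ring.
have h : 0 <= S * (S * Q - T ^+ 2).
  by rewrite -E; apply: sumr_ge0 => j _; rewrite mulr_ge0// sqr_ge0.
move: S0; rewrite le_eqVlt => /predU1P[S0|S0]; last first.
  by rewrite -subr_ge0 -(pmulr_rge0 _ S0).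
suff -> : T = 0 by rewrite expr0n mulr_ge0 -?S0//; apply: sumr_ge0 => j _;
  rewrite mulr_ge0// sqr_ge0.
have Qz : forall t : seq J, \sum_(j <- t) w j = 0 -> \sum_(j <- t) w j * b j = 0.
  elim=> [|j t IH]; first by rewrite !big_nil.
  rewrite !big_cons => /eqP; rewrite paddr_eq0//; last exact: sumr_ge0.
  by case/andP => /eqP -> /eqP /IH ->; rewrite mul0r addr0.
exact: Qz.
Qed.

Lemma schur (I J : Type) (s : seq I) (r : seq J) (w : I -> J -> R) (y : I -> R)
    (b : J -> R) (A D : R) : (forall i j, 0 <= w i j) -> 0 <= A ->
  (forall i, \sum_(j <- r) w i j <= A) -> (forall j, \sum_(i <- s) w i j <= D) ->
  (forall i, 0 <= y i) -> (forall i, y i <= \sum_(j <- r) w i j * b j) ->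
  \sum_(i <- s) y i ^+ 2 <= A * D * \sum_(j <- r) b j ^+ 2.
Proof.
move=> w0 A0 hA hD y0 hy.
apply: (@le_trans _ _ (\sum_(i <- s) A * \sum_(j <- r) w i j * b j ^+ 2)).
  apply: ler_sum => i _.
  apply: (@le_trans _ _ ((\sum_(j <- r) w i j * b j) ^+ 2)).
    by rewrite lerXn2r ?nnegrE// (le_trans (y0 i)).
  apply: (le_trans (weighted_cauchy_schwarz _ _ (w0 i))).
  by rewrite ler_wpM2r ?hA//; apply: sumr_ge0 => j _; rewrite mulr_ge0 ?sqr_ge0.
rewrite -mulr_sumr -mulrA ler_wpM2l// exchange_big /= mulr_sumr.
apply: ler_sum => j _; rewrite -mulr_suml ler_wpM2r ?sqr_ge0//.
Qed.

Lemma count_exp_sum (T : eqType) (s : seq T) (k : T -> nat) (B : nat) (x : R) :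
  (forall j, count (fun l => k l == j) s <= B)%N ->
  \sum_(l <- s) expR (- `|x - (k l)%:R|) <= B%:R * 4.
Proof.
move=> HB; pose K := (\max_(l <- s) k l).+1.
have kK l : l \in s -> (k l < K)%N by move=> ls; rewrite ltnS; exact: leq_bigmax_seq.
have -> : \sum_(l <- s) expR (- `|x - (k l)%:R|) =
    \sum_(j < K) (count (fun l => k l == j) s)%:R * expR (- `|x - j%:R|).
  transitivity (\sum_(l <- s) \sum_(j < K | k l == j) expR (- `|x - j%:R|)).
    rewrite big_seq [RHS]big_seq; apply: eq_bigr => l ls.
    by rewrite (big_pred1 (Ordinal (kK l ls)))// => j; rewrite -val_eqE /= eq_sym.
  rewrite (exchange_big_dep xpredT)//=; apply: eq_bigr => j _.
  by rewrite big_const_seq iter_addr_0 mulr_natl.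
apply: (@le_trans _ _ (\sum_(j < K) B%:R * expR (- `|x - j%:R|))).
  by apply: ler_sum => j _; rewrite ler_wpM2r ?expR_ge0// ler_nat.
by rewrite -mulr_sumr ler_wpM2l// expsum.
Qed.

Lemma esum_le_seq (T : choiceType) (L : set T) (F : T -> R) (B : \bar R) :
  (forall s : seq T, uniq s -> (forall l, l \in s -> L l) ->
    ((\sum_(l <- s) F l)%:E <= B)%E) ->
  (\esum_(l in L) (F l)%:E <= B)%E.
Proof.
move=> H; apply: ge_ereal_sup => _ [A [fA AL] <-].
rewrite fsbig_finite//= sumEFin; apply: H; first exact: finmap.fset_uniq.
by move=> l; rewrite in_fset_set// inE => /AL.
Qed.

Lemma esum_ge_seq (T : choiceType) (L : set T) (F : T -> R) (s : seq T) :
  uniq s -> (forall l, l \in s -> L l) ->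
  ((\sum_(l <- s) F l)%:E <= \esum_(l in L) (F l)%:E)%E.
Proof.
move=> us sL; apply: ereal_sup_ubound; exists [set` s].
  by split; [exact: finite_seq|move=> l /= /sL].
by rewrite -fsbig_seq//= sumEFin.
Qed.

End schur_test.

Section separation.
Variable R : realType.
Local Notation C := R[i].
Variable alpha : R.
Hypothesis alpha0 : 0 < alpha.
Implicit Types (z w : C) (L : set C) (s : seq C).

Local Notation tau := (tau alpha).
Local Notation ring k := (fun l : C => Num.truncn (tau l) == k).

(** Separation in logarithmic form: the exponential equals max(1, min(|z|, |w|)), which is
    comparable to the denominator of [drho]. *)
Definition sep (d : R) L := forall z w, L z -> L w -> z <> w ->
  d * expR (Num.min (lmod z) (lmod w)) <= cabs (z - w).

Lemma expR_min_lmod z w : expR (Num.min (lmod z) (lmod w)) =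
  Num.max 1 (Num.min (cabs z) (cabs w)).
Proof.
have mono (x y : R) : expR (Num.min x y) = Num.min (expR x) (expR y).
  case: (leP x y) => h; first by rewrite min_l// ler_expR.
  by rewrite min_r// ler_expR ltW.
rewrite mono !expR_lmod.
by rewrite max_minr.
Qed.

Lemma drho_sep L : drho_separated alpha L -> exists2 d : R, 0 < d & sep d L.
Proof.
rewrite /drho_separated; set I := ereal_inf _ => I0.
have [d d0 dI] : exists2 d : R, 0 < d & (d%:E <= I)%E.
  case: I I0 => [x|_|]//; first by rewrite lte_fin => x0; exists x.
  by exists 1; rewrite ?leey.
pose q : R := Num.sqrt (2 * alpha).
have q0 : 0 < q by rewrite sqrtr_gt0 mulr_gt0.
exists (d * Num.min 1 q / q); first by rewrite divr_gt0// mulr_gt0// lt_min ltr01.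
move=> z w Lz Lw zw.
have : (d%:E <= (drho alpha z w)%:E)%E.
  by apply: le_trans dI _; apply: ereal_inf_lbound; exists (z, w).
rewrite lee_fin /drho -/q expR_min_lmod; set m := Num.min (cabs z) (cabs w).
have m0 : 0 <= m by rewrite le_min !cabs_ge0.
have qm : 0 < q + m by rewrite ltr_pwDl.
rewrite mulrA ler_pdivlMr// => h.
rewrite mulrAC ler_pdivrMr// [leRHS]mulrC (le_trans _ h)// -mulrA ler_pM2l//.
have [h1|h1] := leP 1 m; have [h2|h2] := leP 1 q; nra.
Qed.

Lemma sep_drho (d : R) L : 0 < d -> sep d L -> drho_separated alpha L.
Proof.
move=> d0 H; pose q : R := Num.sqrt (2 * alpha).
have q0 : 0 < q by rewrite sqrtr_gt0 mulr_gt0.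
apply: (@lt_le_trans _ _ (q * d / (q + 1))%:E).
  by rewrite lte_fin divr_gt0 ?mulr_gt0// addr_gt0.
apply: le_ereal_inf_tmp => _ [[z w] [/= Lz Lw zw] <-]; rewrite lee_fin /drho -/q.
have := H _ _ Lz Lw zw; rewrite expR_min_lmod; set m := Num.min (cabs z) (cabs w) => h.
have m0 : 0 <= m by rewrite le_min !cabs_ge0.
have qm : 0 < q + m by rewrite ltr_pwDl.
rewrite -mulrA ler_pM2l// ler_pdivrMr ?addr_gt0// mulrAC ler_pdivlMr//.
have [h1|h1] := leP 1 m.
  rewrite max_r// in h; apply: (@le_trans _ _ (d * m * (q + 1))).
    by rewrite -mulrA ler_pM2l//; nra.
  by rewrite ler_pM2r// addr_gt0.
rewrite max_l ?(ltW h1)// mulr1 in h; apply: (@le_trans _ _ (d * (q + 1))).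
  by rewrite ler_pM2l// lerD2l ltW.
by rewrite ler_pM2r// addr_gt0.
Qed.

Definition count_bd L (B : nat) := forall s, uniq s -> (forall l, l \in s -> L l) ->
  forall k, (count (ring k) s <= B)%N.

Lemma lmod_ring k z : Num.truncn (tau z) == k ->
  k%:R / (2 * alpha) <= lmod z /\ lmod z < k.+1%:R / (2 * alpha).
Proof.
move=> /eqP <-; have a2 : 0 < 2 * alpha by rewrite mulr_gt0.
have /andP[h1 h2] := truncn_itv (tau_ge0 alpha0 z).
have E : tau z = lmod z * (2 * alpha) by rewrite /tau mulrC.
by rewrite ler_pdivrMr// ltr_pdivlMr// -E.
Qed.

(** Pigeonhole in a grid of squares of side [rho] covering the disc of radius [Rk], which contains
    layer k. Two points in one cell are closer than 2 rho = d exp(k/(2 alpha)), the smallest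
    distance allowed in the layer; [q] accounts for the width of the layer. The number of cells does
    not depend on k. *)
Lemma sep_count (d : R) L : 0 < d -> sep d L -> exists B, count_bd L B.
Proof.
move=> d0 H; pose q := expR (- (1 / (2 * alpha))).
have q0 : 0 < q by exact: expR_gt0.
pose M := (Num.truncn (4 / (d * q))).+1; exists (M * M)%N => s us sL k.
pose Rk := expR (k.+1%:R / (2 * alpha)); have Rk0 : 0 < Rk by exact: expR_gt0.
pose rho := d * q * Rk / 2.
have rho0 : 0 < rho by rewrite divr_gt0// mulr_gt0// mulr_gt0.
pose cell (x : R) := Num.truncn ((x + Rk) / rho).
rewrite -size_filter; set s' := seq.filter _ s.
have us' : uniq s' by exact: filter_uniq.
have s'P l : l \in s' -> [/\ L l, k%:R / (2 * alpha) <= lmod l & cabs l <= Rk].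
  rewrite mem_filter => /andP[/lmod_ring[h1 h2] /sL Ll]; split=> //.
  by rewrite (le_trans (cabs_le_lmod l))// ler_expR ltW.
have bnd (x : R) : `|x| <= Rk -> 0 <= (x + Rk) / rho /\ (cell x < M)%N.
  rewrite ler_norml => /andP[x1 x2].
  have x0 : 0 <= (x + Rk) / rho by rewrite divr_ge0 ?(ltW rho0)//; lra.
  split=> //; rewrite ltnS; apply: le_truncn.
  rewrite ler_pdivrMr// (_ : 4 / _ * rho = 2 * Rk); first lra.
  by rewrite /rho; field; rewrite !gt_eqF.
have near (x y : R) : `|x| <= Rk -> `|y| <= Rk -> cell x = cell y -> `|x - y| < rho.
  move=> /bnd[x1 _] /bnd[y1 _] E.
  have /andP[a1 a2] := truncn_itv x1; have /andP[b1 b2] := truncn_itv y1.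
  rewrite -/(cell x) E in a1 a2; rewrite -/(cell y) in b1 b2.
  rewrite -natr1 in a2; rewrite -natr1 in b2.
  have -> : x - y = ((x + Rk) / rho - (y + Rk) / rho) * rho.
    by field; rewrite gt_eqF.
  rewrite normrM (gtr0_norm rho0) -[ltRHS]mul1r ltr_pM2r// ltr_norml.
  by apply/andP; split; lra.
pose h (l : C) := (cell (complex.Re l), cell (complex.Im l)).
have hinj : {in s' &, injective h}.
  move=> z w zs ws [E1 E2]; apply: contrapT => zw.
  have [Lz z1 z2] := s'P _ zs; have [Lw w1 w2] := s'P _ ws.
  have h1 := near _ _ (le_trans (Re_le_cabs z) z2) (le_trans (Re_le_cabs w) w2) E1.
  have h2 := near _ _ (le_trans (Im_le_cabs z) z2) (le_trans (Im_le_cabs w) w2) E2.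
  have := H _ _ Lz Lw zw; apply/negP; rewrite -ltNge.
  apply: (le_lt_trans (cabs_le_ReIm _)); rewrite ReD ReN ImD ImN.
  apply: (@lt_le_trans _ _ (rho + rho)); first exact: ltrD.
  rewrite (_ : rho + rho = d * (q * Rk)); last by rewrite /rho; field.
  have E : - (1 / (2 * alpha)) + k.+1%:R / (2 * alpha) = k%:R / (2 * alpha).
    by rewrite -natr1; field; rewrite gt_eqF.
  by rewrite ler_pM2l// /q /Rk -expRD ler_expR E le_min z1.
rewrite -(size_map h).
have -> : (M * M = size [seq (i, j) | i <- iota 0 M, j <- iota 0 M])%N.
  by rewrite size_allpairs size_iota.
apply: uniq_leq_size; first by rewrite map_inj_in_uniq.
move=> _ /mapP[l /s'P[_ _ lR] ->]; apply/allpairsP; exists (h l).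
have [_ i1] := bnd _ (le_trans (Re_le_cabs l) lR).
have [_ i2] := bnd _ (le_trans (Im_le_cabs l) lR).
by rewrite !mem_iota /= !add0n; split.
Qed.

End separation.

Section upper_bound.
Variable R : realType.
Local Notation C := R[i].
Variable alpha : R.
Hypothesis alpha0 : 0 < alpha.
Implicit Types (z w : C) (L : set C) (s : seq C) (a : nat -> C).

Local Notation phi := (log2_weight alpha).
Local Notation N := (fock_norm2 phi).
Local Notation hn := (hn alpha).
Local Notation tau := (tau alpha).
Local Notation kappa := (kappa alpha).
Local Notation skap := (skap alpha).
Local Notation shn := (shn alpha).

Lemma tau_exp_sum z K : \sum_(n < K) expR (- `|n.+1%:R - tau z|) <= 4.
Proof.
rewrite (eq_bigr (fun n : 'I_K => expR (- `|tau z - 1 - n%:R|))) ?expsum// => n _.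
have -> : n.+1%:R - tau z = - (tau z - 1 - n%:R) by rewrite -natr1; ring.
by rewrite normrN.
Qed.

Lemma schur_points L B s (y : C -> R) (b : nat -> R) K (e : R) :
  count_bd alpha L B -> uniq s -> (forall l, l \in s -> L l) -> 0 <= e ->
  (forall l, l \in s -> 0 <= y l) ->
  (forall l, l \in s -> y l <= e * \sum_(n < K) expR (- `|n.+1%:R - tau l|) * b n) ->
  \sum_(l <- s) y l ^+ 2 <= e ^+ 2 * (16 * expR 1 * B%:R) * \sum_(n < K) b n ^+ 2.
Proof.
move=> HB us sL e0 y0 hy.
(* [schur] quantifies over all indices, so weights and values are set to 0 off the list [s]. *)
pose w (l : C) (n : 'I_K) := if l \in s then e * expR (- `|n.+1%:R - tau l|) else 0.
pose y' l := if l \in s then y l else 0.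
have -> : \sum_(l <- s) y l ^+ 2 = \sum_(l <- s) y' l ^+ 2.
  by rewrite big_seq [RHS]big_seq; apply: eq_bigr => l ls; rewrite /y' ls.
have -> : e ^+ 2 * (16 * expR 1 * B%:R) = (e * 4) * (e * (expR 1 * (B%:R * 4))) by ring.
apply: (@schur R _ _ _ _ w).
- by move=> l n; rewrite /w; case: ifP => // _; rewrite mulr_ge0 ?expR_ge0.
- by rewrite mulr_ge0.
- move=> l; rewrite /w; case: (l \in s); last by rewrite big1 ?mulr_ge0.
  by rewrite -mulr_sumr ler_wpM2l// tau_exp_sum.
- move=> n; apply: (@le_trans _ _ (\sum_(l <- s)
    e * (expR 1 * expR (- `|n.+1%:R - (Num.truncn (tau l))%:R|)))); last first.
    rewrite -!mulr_sumr; apply: (ler_wpM2l e0); apply: (ler_wpM2l (expR_ge0 1)).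
    by apply: (@count_exp_sum R _ s (fun l => Num.truncn (tau l))) => k; exact: HB.
  rewrite big_seq [leRHS]big_seq; apply: ler_sum => l ls.
  rewrite /w ls ler_wpM2l// -expRD ler_expR lerNl opprD opprK addrC lerBlDr.
  have /andP[t1 t2] := truncn_itv (tau_ge0 alpha0 l).
  have -> : n.+1%:R - (Num.truncn (tau l))%:R =
    (n.+1%:R - tau l) + (tau l - (Num.truncn (tau l))%:R) :> R by ring.
  rewrite (le_trans (ler_normD _ _))// lerD2l ger0_norm ?subr_ge0// lerBlDr addrC.
  by rewrite natr1 ltW.
- by move=> l; rewrite /y'; case: ifP => // ls; exact: y0.
- move=> l; rewrite /y' /w; have [ls|_] := boolP (l \in s); last first.
    by rewrite big1// => n _; rewrite mul0r.
  rewrite (le_trans (hy _ ls))// mulr_sumr; apply: ler_sum => n _.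
  by rewrite mulrA.
Qed.

Lemma ppol_entry : exists2 c : R, 0 < c & forall a K z,
  cabs (ppol a K z) / skap z <=
  c * \sum_(n < K) expR (- `|n.+1%:R - tau z|) * (cabs (a n) * shn n).
Proof.
have [c c0 Hc] := entry_le alpha0 1; exists c => // a K z.
have s0 := skap_gt0 alpha0 z.
rewrite ler_pdivrMr// (le_trans (ler_cabs_sum _ _ _))// mulr_sumr mulr_suml.
apply: ler_sum => n _; rewrite cabsM cabsX.
have := ler_wpM2l (cabs_ge0 (a n)) (Hc z n); rewrite mul1r => /le_trans; apply.
by rewrite le_eqVlt; apply/orP; left; apply/eqP; ring.
Qed.

Lemma bessel_pol L B : count_bd alpha L B -> exists2 c : R, 0 < c &
  forall a K s, uniq s -> (forall l, l \in s -> L l) ->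
  \sum_(l <- s) (cabs (ppol a K l) / skap l) ^+ 2 <=
  c * \sum_(n < K) cabs (a n) ^+ 2 * hn n.
Proof.
move=> HB; have [c c0 Hc] := ppol_entry.
(* The added 1 keeps the constant positive when [B] is 0. *)
exists (c ^+ 2 * (16 * expR 1 * B%:R) + 1).
  apply: ltr_wpDl => //; apply: mulr_ge0; first exact: sqr_ge0.
  by apply: mulr_ge0 => //; apply: mulr_ge0 => //; exact: expR_ge0.
move=> a K s us sL.
apply: (le_trans (schur_points (b := fun n => cabs (a n) * shn n) (K := K) HB us sL (ltW c0) _ _)).
- by move=> l _; rewrite divr_ge0 ?cabs_ge0 ?(ltW (skap_gt0 alpha0 l)).
- by move=> l _; exact: Hc.
have -> : \sum_(n < K) (cabs (a n) * shn n) ^+ 2 = \sum_(n < K) cabs (a n) ^+ 2 * hn n.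
  by apply: eq_bigr => n _; rewrite exprMn shnE.
rewrite ler_wpM2r ?lerDl//; apply: sumr_ge0 => n _.
by rewrite mulr_ge0 ?sqr_ge0// ltW// hn_gt0.
Qed.

Lemma sum_cvg (T : Type) (t : seq T) (u : T -> nat -> R) (v : T -> R) :
  (forall i, u i @ \oo --> v i) -> (fun n => \sum_(i <- t) u i n) @ \oo --> \sum_(i <- t) v i.
Proof.
move=> H; elim: t => [|i t IH].
  by under eq_fun do rewrite big_nil; rewrite big_nil; exact: cvg_cst.
by under eq_fun do rewrite big_cons; rewrite big_cons; apply: cvgD.
Qed.

Lemma bessel_fock L B : count_bd alpha L B -> exists2 c : R, 0 < c &
  forall f s, fock phi f -> uniq s -> (forall l, l \in s -> L l) ->
  \sum_(l <- s) cabs (f l) ^+ 2 / kappa l <= c * fine (N f).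
Proof.
move=> HB; have [c c0 Hc] := bessel_pol HB; exists c => // f s Ff us sL.
have [a ha] := fock_coefs Ff.
have H : (fun K => \sum_(l <- s) cabs (ppol a K l) ^+ 2 / kappa l) @ \oo -->
    \sum_(l <- s) cabs (f l) ^+ 2 / kappa l.
  apply: sum_cvg => l; apply: cvgM; last exact: cvg_cst.
  exact: (ppol_cvg ha.2).
rewrite -(cvg_lim _ H)//; apply: limr_le; first exact: cvgP H.
apply: nearW => K; apply: (@le_trans _ _ (c * \sum_(n < K) cabs (a n) ^+ 2 * hn n)).
  rewrite (le_trans _ (Hc a K s us sL))// le_eqVlt; apply/orP; left; apply/eqP.
  by apply: eq_bigr => l _; rewrite expr_div_n skapE.
rewrite ler_wpM2l ?(ltW c0)// -lee_fin -fock_norm_fin//.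
exact: (fock_partial alpha0 K ha).
Qed.

Lemma sampling_upper L B : count_bd alpha L B -> exists2 c : R, 0 < c &
  forall f, fock phi f ->
  (\esum_(l in L) (cabs (f l) ^+ 2 / kappa l)%:E <= c%:E * N f)%E.
Proof.
move=> HB; have [c c0 Hc] := bessel_fock HB; exists c => // f Ff.
rewrite (fock_norm_fin Ff) -EFinM; apply: esum_le_seq => s us sL.
by rewrite lee_fin Hc.
Qed.

Lemma coefs_ppol a K : coefs (ppol a K) (fun n => if (n < K)%N then a n else 0).
Proof.
split.
  move=> r r0; exists (\sum_(n < K) cabs (a n) * r ^+ n) => n.
  case: ifP => nK; last first.
    rewrite cabs0 mul0r; apply: sumr_ge0 => m _.
    by rewrite mulr_ge0 ?cabs_ge0// exprn_ge0// ltW.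
  rewrite (bigD1 (Ordinal nK))//= lerDl; apply: sumr_ge0 => m _.
  by rewrite mulr_ge0 ?cabs_ge0// exprn_ge0// ltW.
move=> z; apply/cvgrPdist_le => e e0; exists K => // M /= KM.
suff -> : ppol a K z = \sum_(n < M) (if (n < K)%N then a n else 0) * z ^+ n.
  by rewrite subrr cabs0 subrr normr0 ltW.
rewrite -(subnKC KM) big_split_ord /= [X in _ + X]big1 ?addr0 => [|n _].
  by apply: eq_bigr => n _; rewrite ltn_ord.
by rewrite ltnNge leq_addr mul0r.
Qed.

Lemma norm_ppol a K : N (ppol a K) = (\sum_(n < K) cabs (a n) ^+ 2 * hn n)%:E.
Proof. exact: (wnorm_ppol (wt_ge0 alpha) (pmeas_wt alpha) (@wt_radial R alpha) (hnE alpha0)). Qed.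

Lemma fock_ppol a K : fock phi (ppol a K).
Proof. by split; [exact: coefs_entire (coefs_ppol a K)|rewrite norm_ppol ltry]. Qed.

End upper_bound.

(** * Necessity *)

Section finite_unions.
Variable R : realType.
Local Notation C := R[i].
Variable alpha : R.
Hypothesis alpha0 : 0 < alpha.
Implicit Types (z w : C) (L : set C) (s : seq C).

Local Notation phi := (log2_weight alpha).
Local Notation N := (fock_norm2 phi).
Local Notation hn := (hn alpha).
Local Notation tau := (tau alpha).
Local Notation kappa := (kappa alpha).
Local Notation lay z := (Num.truncn (tau z)).

Let Cup0 : 0 < Cup alpha. Proof. by rewrite !mulr_gt0// expR_gt0. Qed.

Lemma layer_term : exists2 c : R, 0 < c & forall z,
  c * hn (lay z) <= cabs z ^+ (2 * lay z) / kappa z.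
Proof.
have [c c0 Hc] := kappa_le alpha0.
have i2a : 0 < 1 / (2 * alpha) by rewrite divr_gt0// mulr_gt0.
pose D := expR (- (1 / (2 * alpha))).
exists ((Cup alpha)^-1 * D / c); first by rewrite divr_gt0// mulr_gt0 ?invr_gt0// expR_gt0.
move=> z; have [E t1] := truncn_tau alpha0 z.
have h0 := hn_gt0 alpha0 (lay z).
have k0 := kappa_gt0 alpha0 z.
rewrite ler_pdivlMr// mulrAC -ler_pdivlMr//; apply: le_trans (kterm_eq alpha0 E).
apply: (@le_trans _ _ ((Cup alpha)^-1 * D / c * (c * Ek alpha z))).
  rewrite ler_wpM2l// divr_ge0 ?(ltW c0)// mulr_ge0 ?expR_ge0// invr_ge0 ltW//.
rewrite mulrA divfK ?gt_eqF// -mulrA ler_wpM2l ?invr_ge0 ?(ltW Cup0)//.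
rewrite mulrC ler_wpM2l ?expR_ge0// ler_expR lerN2 ler_piMr ?(ltW i2a)//.
by rewrite -real_normK ?num_real// expr_le1.
Qed.

(** Test function z^k: by [layer_term] every point of layer k contributes a fixed proportion of its
    norm, so the upper sampling inequality limits the number of such points. *)
Lemma sampling_count L : sampling phi L -> exists B, count_bd alpha L B.
Proof.
case=> c c0 Hc; have [d d0 Hd] := layer_term.
exists (Num.truncn (c / d)).+1 => s us sL k.
pose a n : C := if n == k then 1 else 0.
have pE z : ppol a k.+1 z = z ^+ k.
  rewrite /ppol (bigD1 ord_max)//= /a eqxx mul1r big1 ?addr0// => n nk.
  by rewrite -val_eqE /= in nk; rewrite (negbTE nk) mul0r.
have NE : N (ppol a k.+1) = (hn k)%:E.
  rewrite norm_ppol// (bigD1 ord_max)//= /a eqxx cabs1 expr1n mul1r big1 ?addr0// => n nk.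
  by rewrite -val_eqE /= in nk; rewrite (negbTE nk) cabs0 expr0n mul0r.
have [_] := Hc _ (fock_ppol alpha0 a k.+1); rewrite NE -EFinM => h.
pose t := [seq l <- s | lay l == k].
have ut : uniq t by exact: filter_uniq.
have tL l : l \in t -> L l by rewrite mem_filter => /andP[_ /sL].
have := le_trans (esum_ge_seq (fun l => cabs (ppol a k.+1 l) ^+ 2 / kappa l) ut tL) h.
rewrite lee_fin => {}h.
rewrite -size_filter -/t.
have h0 := hn_gt0 alpha0 k.
have : (size t)%:R * (d * hn k) <= c * hn k.
  apply: le_trans h; rewrite mulr_natl -[size t]count_predT -iter_addr_0 -big_const_seq.
  rewrite big_seq [leRHS]big_seq; apply: ler_sum => l.
  rewrite mem_filter => /andP[/eqP lk _]; rewrite pE cabsX -exprM mulnC -lk.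
  exact: Hd.
rewrite mulrA ler_pM2r// -ler_pdivlMr// => h2.
by rewrite -(ler_nat R) (le_trans h2)// ltW// truncnS_gt.
Qed.

Lemma count_layer L B k : count_bd alpha L B -> exists2 s, uniq s /\ (size s <= B)%N &
  forall l, (l \in s) = `[< L l /\ lay l = k >].
Proof.
move=> HB.
pose good (s : seq C) := uniq s /\ forall l, l \in s -> L l /\ lay l = k.
pose P n := `[< exists2 s, good s & size s = n >].
have P0 : exists n, P n by exists 0%N; apply/asboolP; exists [::].
have Pb n : P n -> (n <= B)%N.
  move=> /asboolP[s [us sL] <-].
  have := HB s us (fun l h => (sL l h).1) k; rewrite (_ : count _ s = size s)//.
  by apply/eqP; rewrite -all_count; apply/allP => l /sL[_ ->].
case: (ex_maxnP P0 Pb) => n Pn max_n; have /asboolP[s [us sL] sz] := Pn.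
exists s; first by split=> //; rewrite sz; exact: Pb.
move=> l; apply/idP/asboolP => [/sL//|[Ll lk]].
apply/negPn/negP => ls; have : P n.+1.
  apply/asboolP; exists (l :: s); last by rewrite /= sz.
  split; first by rewrite /= ls.
  by move=> m; rewrite inE => /predU1P[->|/sL].
by move/max_n; rewrite ltnn.
Qed.

Lemma far_apart z w : tau z + 1 <= tau w ->
  (expR (1 / (2 * alpha)) - 1) * expR (Num.min (lmod z) (lmod w)) <= cabs (z - w).
Proof.
move=> h; have a2 : 0 < 2 * alpha by rewrite mulr_gt0.
have h1 : lmod z + 1 / (2 * alpha) <= lmod w.
  rewrite -(ler_pM2l a2) (le_trans _ h)// mulrDr /tau lerD2l.
  by rewrite mul1r mulfV ?gt_eqF.
have p : 0 < 1 / (2 * alpha) by rewrite divr_gt0.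
have zw : lmod z <= lmod w by lra.
rewrite min_l//; have w1 : expR (lmod w) = cabs w.
  have : 0 < lmod w by have := lmod_ge0 z; lra.
  rewrite -ltr_expR expR0 expR_lmod; have [//|_] := leP 1 (cabs w).
  by rewrite ltxx.
rewrite cabsB; apply: le_trans (lerB_cabs w z).
rewrite mulrBl (mul1r (expR _)) lerB ?cabs_le_lmod// -expRD -w1 ler_expR.
by rewrite addrC.
Qed.

Lemma count_finite_union L B : count_bd alpha L B ->
  exists (n : nat) (F : 'I_n -> set C),
    (forall i, drho_separated alpha (F i)) /\ L = \bigcup_(i in [set: 'I_n]) F i.
Proof.
move=> HB; have /choice[e He] : forall k, exists s, (uniq s /\ (size s <= B)%N) /\
    forall l, (l \in s) = `[< L l /\ lay l = k >].
  by move=> k; have [s h1 h2] := count_layer k HB; exists s.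
pose rk l := index l (e (lay l)).
(* The class records the rank of a point within its layer together with the parity of the layer.
   Distinct points of one class lie in different layers of equal parity, hence at least two layers
   apart, so that their values of [tau] differ by at least 1. *)
pose idx l := ((rk l).*2 + odd (lay l))%N.
have in_e l : L l -> l \in e (lay l) by move=> Ll; rewrite (He _).2; exact/asboolP.
have rkB l : L l -> (rk l < B)%N.
  by move=> Ll; apply: leq_trans (He (lay l)).1.2; rewrite index_mem in_e.
have idxB l : L l -> (idx l < B.*2)%N.
  move=> /rkB h; rewrite /idx; case: (odd _); rewrite ?addn0 ?addn1 -?doubleS.
    by rewrite -[X in (X <= _)%N]/((rk l).+1.*2) leq_double.
  by rewrite ltn_double.
exists B.*2, (fun i => [set l | L l /\ idx l = i]); split; last first.
  apply/seteqP; split=> [l Ll|l [i _ []]//].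
  by exists (Ordinal (idxB _ Ll)).
move=> i; have d0 : 0 < expR (1 / (2 * alpha)) - 1.
  by rewrite subr_gt0 -expR0 ltr_expR divr_gt0// mulr_gt0.
apply: (sep_drho alpha0 d0) => z w [Lz iz] [Lw iw] zw.
have far k k' : odd k = odd k' -> (k < k')%N -> (k.+2 <= k')%N.
  move=> ok; rewrite leq_eqVlt => /predU1P[kk|//].
  by move: ok; rewrite -kk /=; case: (odd k).
have E : idx z = idx w by rewrite iz iw.
have Eo : odd (lay z) = odd (lay w).
  by move/(congr1 odd): E; rewrite /idx !oddD !odd_double !oddb.
have Er : rk z = rk w.
  by move: E; rewrite /idx Eo => /addIn/double_inj.
have tl v : (lay v)%:R <= tau v < (lay v).+1%:R by exact: truncn_itv (tau_ge0 alpha0 v).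
have gap u v : ((lay u).+2 <= lay v)%N -> tau u + 1 <= tau v.
  rewrite -(ler_nat R) -[X in X <= _]natr1 => h.
  have /andP[_ h1] := tl u; have /andP[h2 _] := tl v.
  by move: h h1 h2; clear; lra.
have [h|h|h] := ltngtP (lay z) (lay w).
- by apply/far_apart/gap/far.
- by rewrite minC cabsB; apply/far_apart/gap/far.
exfalso; apply: zw.
by rewrite -(nth_index 0 (in_e _ Lz)) -(nth_index 0 (in_e _ Lw)) -/(rk z) Er /rk h.
Qed.

(** Zorn's lemma on separated subsets: separation involves two points only and therefore passes to
    unions of chains. A point outside a maximal subset must violate separation against one of its
    members. *)
Lemma maximal_sep (d : R) L : 0 < d -> exists L', [/\ L' `<=` L, sep d L' &
  forall l, L l -> ~ L' l -> exists l', [/\ L' l', l <> l' &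
    cabs (l - l') < d * expR (Num.min (lmod l) (lmod l'))]].
Proof.
move=> d0; pose P := [set A : set C | A `<=` L /\ sep d A].
have [|A [[AL As] Amax]] := @Zorn_bigcup C P.
  move=> F FP Ft; split; first by move=> z [X /FP[XL _] /XL].
  move=> z w [X FX Xz] [Y FY Yw].
  have [XY|YX] := Ft _ _ FX FY.
    by apply: (FP _ FY).2 => //; exact: XY.
  by apply: (FP _ FX).2 => //; exact: YX.
exists A; split=> // l Ll Al; apply: contrapT => Hn.
apply: (Amax (l |` A)); first by split; [move=> z; right|move=> /(_ l (or_introl erefl))].
split; first by move=> z [->|/AL].
have key w : A w -> l <> w -> d * expR (Num.min (lmod l) (lmod w)) <= cabs (l - w).
  by move=> Aw lw; rewrite leNgt; apply/negP => h; apply: Hn; exists w.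
move=> z w [->|Az] [->|Aw] zw //.
- exact: key.
- by rewrite minC cabsB; apply: key => // h; exact: zw.
- exact: As.
Qed.

End finite_unions.

(** * Polynomials vanishing on the points of a window *)

Section window_count.
Variable R : realType.
Local Notation C := R[i].
Variable alpha : R.
Hypothesis alpha0 : 0 < alpha.
Implicit Types (z w : C) (L : set C) (s : seq C) (a : nat -> C).

Local Notation phi := (log2_weight alpha).
Local Notation N := (fock_norm2 phi).
Local Notation tau := (tau alpha).
Local Notation skap := (skap alpha).
Local Notation shn := (shn alpha).
Local Notation lay z := (Num.truncn (tau z)).

Lemma one_sub_exp (z : C) (e : R) d : cabs (1 - z) <= e -> e <= 1 ->
  cabs (1 - z ^+ d) <= e * expR (2 * d%:R).
Proof.
move=> h e1; have e0 : 0 <= e := le_trans (cabs_ge0 _) h.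
elim: d => [|d IH]; first by rewrite expr0 subrr cabs0 mulr_ge0// expR_ge0.
have z2 : cabs z <= 2.
  have := ler_cabsB 1 (1 - z); rewrite opprB addrCA subrr addr0 cabs1; lra.
have -> : 1 - z ^+ d.+1 = (1 - z ^+ d) * z + (1 - z) by rewrite exprSr; ring.
rewrite (le_trans (ler_cabsD _ _))// cabsM.
have E2 : 3 <= expR 2 :> R by have := expR_ge1Dx (2 : R); lra.
have Ed : 1 <= expR (2 * d%:R) :> R by rewrite -[leLHS]expR0 ler_expR mulr_ge0.
have -> : expR (2 * d.+1%:R) = expR (2 * d%:R) * expR 2 :> R.
  by rewrite -expRD -natr1; congr expR; ring.
have p := ler_pM (cabs_ge0 _) (cabs_ge0 _) IH z2.
set E := expR (2 * d%:R) in Ed p *.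
have : e * E * 3 <= e * E * expR 2 by rewrite ler_wpM2l// mulr_ge0//; lra.
have : e * 1 <= e * E by rewrite ler_wpM2l.
by move: p h; clear; lra.
Qed.

(* The factor (l/l')^k, with k close to tau l, makes the estimate of p(l) in terms
   of p(l') = 0 independent of the size of the degrees involved. *)
Lemma perturbation : exists2 c : R, 0 < c & forall a K (l l' : C) (e : R),
  l != 0 -> l' != 0 -> e <= 1 -> cabs (l - l') <= e * cabs l -> cabs (l - l') <= e * cabs l' ->
  ppol a K l' = 0 ->
  cabs (ppol a K l) / skap l <=
  c * e * \sum_(n < K) expR (- `|n.+1%:R - tau l|) * (cabs (a n) * shn n).
Proof.
(* Rate 3, because comparing n-th powers of nearby points costs exp(2 |n - k|) and rate 1 must
   remain. *)
have [c c0 Hc] := entry_le alpha0 3; exists (c * expR 2).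
  by rewrite mulr_gt0// expR_gt0.
move=> a K l l' e l0 l'0 e1 h1 h2 pl'.
have cl : 0 < cabs l by rewrite cabs_gt0.
have cl' : 0 < cabs l' by rewrite cabs_gt0.
have e0 : 0 <= e by have := le_trans (cabs_ge0 _) h1; rewrite pmulr_lge0.
set k := lay l; pose q := l' / l.
have q0 : q != 0 by rewrite mulf_neq0// invr_eq0.
have q1 : cabs (1 - q) <= e.
  rewrite (_ : 1 - q = (l - l') / l); last by rewrite /q; field.
  by rewrite cabsM cabsV ler_pdivrMr.
have q2 : cabs (1 - q^-1) <= e.
  rewrite (_ : 1 - q^-1 = - ((l - l') / l')); last by rewrite /q; field; rewrite l0 l'0.
  by rewrite cabsN cabsM cabsV ler_pdivrMr.
(* The vanishing value p(l') is subtracted with the weight q^-k, so that the error in degree n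
   depends on |n - k| rather than on n. *)
have pE : ppol a K l = \sum_(n < K) a n * l ^+ n * (1 - q ^+ n / q ^+ k).
  have -> : ppol a K l = ppol a K l - q ^- k * ppol a K l' by rewrite pl' mulr0 subr0.
  rewrite /ppol mulr_sumr -sumrB; apply: eq_bigr => n _.
  rewrite (_ : l' ^+ n = l ^+ n * q ^+ n); last by rewrite -exprMn /q mulrCA mulfV// mulr1.
  by ring.
have dist (n : nat) : cabs (1 - q ^+ n / q ^+ k) <= e * expR (2 * `|n%:R - k%:R|).
  have [kn|/ltnW nk] := leqP k n.
    rewrite -expfB_cond ?(negbTE q0)// -natrB// ger0_norm//.
    exact: one_sub_exp.
  have -> : q ^+ n / q ^+ k = q^-1 ^+ (k - n).
    rewrite exprVn -{1}(subnK nk) exprD invfM mulrCA mulfV ?mulr1//.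
    by rewrite expf_neq0.
  by rewrite distrC -natrB// ger0_norm//; exact: one_sub_exp.
have s0 := skap_gt0 alpha0 l.
rewrite ler_pdivrMr// pE (le_trans (ler_cabs_sum _ _ _))// mulr_sumr mulr_suml.
apply: ler_sum => n _; rewrite !cabsM cabsX.
have := Hc l n; set t := `|n.+1%:R - tau l| => h.
have [_ tk] := truncn_tau alpha0 l.
have nk : `|n%:R - k%:R| <= t + 1 :> R.
  have -> : n%:R - k%:R = (n.+1%:R - tau l) - (k.+1%:R - tau l) :> R.
    by rewrite -!natr1; ring.
  by rewrite (le_trans (ler_normB _ _))// lerD2l.
have dn : cabs (1 - q ^+ n / q ^+ k) <= e * (expR 2 * expR (2 * t)).
  rewrite (le_trans (dist n))// ler_wpM2l// -expRD ler_expR.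
  by rewrite (le_trans (ler_wpM2l _ nk))// mulrDr mulr1 addrC.
have sn := shn_gt0 alpha0 n.
have Q := ler_pM (exprn_ge0 n (cabs_ge0 l)) (cabs_ge0 _) h dn.
rewrite -mulrA; apply: (le_trans (ler_wpM2l (cabs_ge0 (a n)) Q)).
have -> : expR (- (3 * t)) = expR (- t) * (expR (2 * t))^-1 :> R.
  by rewrite -expRN -expRD; congr expR; ring.
rewrite le_eqVlt; apply/orP; left; apply/eqP.
by field; rewrite gt_eqF// expR_gt0.
Qed.

(** Dimension count: D coefficients against fewer than D linear conditions, read off as a nonzero
    row in the left kernel of a D by [size W] matrix. *)
Lemma vanishing_pol n0 D (W : seq C) : (size W < D)%N -> exists a : nat -> C,
  [/\ forall n, a n != 0 -> (n0 <= n < n0 + D)%N,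
      exists2 n, (n < n0 + D)%N & a n != 0 &
      forall w, w \in W -> ppol a (n0 + D) w = 0].
Proof.
move=> WD; pose A : 'M[C]_(D, size W) := \matrix_(j, i) (nth 0 W i) ^+ (n0 + j).
have ker0 : kermx A != 0.
  rewrite kermx_eq0 /row_free; apply/negP => /eqP rA.
  by have := rank_leq_col A; rewrite rA leqNgt WD.
pose v := nz_row (kermx A).
have v0 : v != 0 by rewrite nz_row_eq0.
have vA : v *m A = 0 by apply/sub_kermxP; exact: nz_row_sub.
pose a n := if insub (n - n0)%N is Some j then (if (n0 <= n)%N then v 0 j else 0) else 0.
have aE (j : 'I_D) : a (n0 + j)%N = v 0 j.
  rewrite /a addKn; case: insubP => [j' _ jj|]; last by rewrite ltn_ord.
  by rewrite leq_addr; congr (v _ _); exact: val_inj.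
have aS n : (n < n0)%N -> a n = 0.
  by move=> nn; rewrite /a leqNgt nn /=; case: insub.
have [j vj] : exists j, v 0 j != 0.
  apply/existsP; apply: contraNT v0; rewrite negb_exists => /forallP h.
  apply/eqP/rowP => j; rewrite mxE; apply/eqP; have := h j; rewrite negbK.
  by [].
exists a; split.
- move=> n an; rewrite leqNgt; apply/andP; split.
    by apply/negP => /aS h; rewrite h eqxx in an.
  move: an; rewrite /a; case: insubP => [j' jD _|]; last by rewrite eqxx.
  case: (leqP n0 n) => [nn _|]; last by rewrite eqxx.
  by rewrite -ltn_subLR.
- by exists (n0 + j)%N; [rewrite ltn_add2l|rewrite aE].
- move=> w wW; rewrite /ppol big_split_ord /= big1 ?add0r => [|n _]; last first.
    by rewrite aS// mul0r.
  have iW : (index w W < size W)%N by rewrite index_mem.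
  have := congr1 (fun M : 'rV_(size W) => M 0 (Ordinal iW)) vA; rewrite !mxE => E.
  rewrite -[RHS]E; apply: eq_bigr => k _.
  by rewrite aE mxE /= nth_index.
Qed.

End window_count.

Section sampling_density.
Variable R : realType.
Local Notation C := R[i].
Variable alpha : R.
Hypothesis alpha0 : 0 < alpha.
Implicit Types (z w : C) (L : set C) (s : seq C) (a : nat -> C).

Local Notation phi := (log2_weight alpha).
Local Notation N := (fock_norm2 phi).
Local Notation hn := (hn alpha).
Local Notation tau := (tau alpha).
Local Notation kappa := (kappa alpha).
Local Notation skap := (skap alpha).
Local Notation shn := (shn alpha).

Lemma lmod_near (e : R) z w : 0 <= e -> cabs (z - w) <= e * expR (lmod w) ->
  lmod z <= lmod w + e.
Proof.
move=> e0 h; rewrite -ler_expR expRD expR_lmod.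
have w1 : 1 <= expR (lmod w) by rewrite -[leLHS]expR0 ler_expR lmod_ge0.
have ee : 1 + e <= expR e by exact: expR_ge1Dx.
apply: (@le_trans _ _ (expR (lmod w) * (1 + e))); last by rewrite ler_wpM2l ?expR_ge0.
rewrite ge_max; apply/andP; split; first by rewrite mulrDr mulr1 ler_wpDr// mulr_ge0// expR_ge0.
have := ler_cabsD (z - w) w; rewrite subrK => /le_trans; apply.
by rewrite addrC mulrDr mulr1 lerD ?cabs_le_lmod// mulrC.
Qed.

Lemma cabs_lmod z : 0 < lmod z -> cabs z = expR (lmod z) /\ z != 0.
Proof.
move=> z0; have E : cabs z = expR (lmod z).
  move: z0; rewrite -ltr_expR expR0 expR_lmod; have [//|_] := leP 1 (cabs z).
  by rewrite ltxx.
by split=> //; rewrite -cabs_gt0 E expR_gt0.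
Qed.

Lemma sampling_window L : sampling phi L -> exists L', [/\ L' `<=` L,
  drho_separated alpha L' & exists r : R, forall x y (W : seq C) n0 D, 1 <= x ->
    (forall l, L' l -> x <= tau l -> tau l < y -> l \in W) ->
    x + r <= n0.+1%:R -> (n0 + D)%:R <= y - r -> (D <= size W)%N].
Proof.
move=> HL; have [B HB] := sampling_count alpha0 HL.
have [c c0 Hc] := HL.
have [c1 c10 Hp] := perturbation alpha0.
have [c2 c20 He] := entry_le alpha0 2.
pose M : R := 16 * expR 1 * B%:R.
have M0 : 0 <= M by rewrite !mulr_ge0 ?expR_ge0.
have Mc0 : 0 <= M * c by rewrite mulr_ge0// ltW.
(* With pointwise bound [e] on all of L, Schur's test makes the sampling sum at most e^2 M times the
   squared norm; this choice gives e^2 M c < 1, contradicting the lower inequality. *)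
pose e : R := (M * c + 1)^-1.
have e0 : 0 < e by rewrite invr_gt0 ltr_wpDl.
have eM : e * (M * c) < 1.
  by rewrite mulrC ltr_pdivrMr ?ltr_wpDl// mul1r ltrDl.
have e1 : e <= 1 by rewrite invf_le1 ?ltr_wpDl// lerDr.
(* The three entries ensure, in order, that a nearby node differs by at most 1 in [tau], that
   [perturbation] applies, and that its constant becomes at most [e]. *)
pose d := Num.min (1 / (2 * alpha)) (Num.min 1 (e / c1)).
have d0 : 0 < d by rewrite !lt_min ltr01 !divr_gt0// mulr_gt0.
have [d1 d2 d3] : [/\ d <= 1 / (2 * alpha), d <= 1 & d * c1 <= e].
  by split; rewrite -?ler_pdivlMr// /d !ge_min lexx ?orbT.
have [L' [L'L sL' ML']] := maximal_sep L d0.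
exists L'; split=> //; first exact: sep_drho sL'.
(* The margin of the window: half of the decay rate 2 turns distance r - 1 into the factor [e], by
   exp t >= 1 + t; the other half stays for Schur's test. *)
pose r := 1 + c2 / e; have r1 : c2 * expR (- (r - 1)) <= e.
  rewrite /r addrC addKr expRN ler_pdivrMr ?expR_gt0// mulrC -ler_pdivrMr//.
  by apply: le_trans (expR_ge1Dx _); rewrite lerDr.
exists r => x y W n0 D x1 HW h1 h2.
rewrite leqNgt; apply/negP => WD.
have [a [aS [n nD an] aW]] := vanishing_pol n0 WD.
set K := (n0 + D)%N in aS nD aW *; set p := ppol a K.
have supp n' : a n' != 0 -> x + r <= n'.+1%:R /\ n'.+1%:R <= y - r.
  move=> /aS/andP[g1 g2]; split; first by rewrite (le_trans h1)// ler_nat ltnS.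
  by rewrite (le_trans _ h2)// ler_nat.
have key l : L l -> cabs (p l) / skap l <=
    e * \sum_(n < K) expR (- `|n.+1%:R - tau l|) * (cabs (a n) * shn n).
  move=> Ll; have s0 := skap_gt0 alpha0 l.
  have rhs0 : 0 <= \sum_(n < K) expR (- `|n.+1%:R - tau l|) * (cabs (a n) * shn n).
    apply: sumr_ge0 => m _; rewrite mulr_ge0 ?expR_ge0// mulr_ge0 ?cabs_ge0//.
    by rewrite ltW// shn_gt0.
  (* Shrinking the window by 1 leaves room for the neighbour l', which then lies in the window and
     is a zero of p. Since x >= 1, both points are outside the unit disc. Points outside the
     shrunken window are far from every exponent of p. *)
  have [/andP[l1 l2]|out] := boolP ((x + 1 <= tau l) && (tau l < y - 1)).
    have inW l' : L' l' -> x <= tau l' -> tau l' < y -> p l' = 0.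
      by move=> h3 h4 h5; apply: aW; exact: HW.
    have [L'l|nL'l] := pselect (L' l).
      have -> : p l = 0 by apply: inW => //; lra.
      by rewrite cabs0 mul0r mulr_ge0// ltW.
    have [l' [L'l' ll' near]] := ML' _ Ll nL'l.
    have a20 : 0 < 2 * alpha by rewrite mulr_gt0.
    have ml : Num.min (lmod l) (lmod l') <= lmod l by rewrite ge_min lexx.
    have ml' : Num.min (lmod l) (lmod l') <= lmod l' by rewrite ge_min lexx orbT.
    have n1 : cabs (l - l') <= d * expR (lmod l).
      by rewrite (le_trans (ltW near))// ler_pM2l// ler_expR.
    have n2 : cabs (l - l') <= d * expR (lmod l').
      by rewrite (le_trans (ltW near))// ler_pM2l// ler_expR.
    have t1 : tau l <= tau l' + 1.
      have := ler_wpM2l (ltW a20) (lmod_near (ltW d0) n2).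
      move/le_trans; apply; rewrite mulrDr lerD2l mulrC -ler_pdivlMr//.
    have t2 : tau l' <= tau l + 1.
      rewrite cabsB in n1; have := ler_wpM2l (ltW a20) (lmod_near (ltW d0) n1).
      move/le_trans; apply; rewrite mulrDr lerD2l mulrC -ler_pdivlMr//.
    have pos v : 1 <= tau v -> 0 < lmod v.
      move=> hv; rewrite -(pmulr_rgt0 _ a20); apply: lt_le_trans ltr01 hv.
    have [E1 l0] := cabs_lmod (pos l ltac:(move: x1 l1; clear; lra)).
    have [E2 l'0] := cabs_lmod (pos l' ltac:(move: x1 l1 t1; clear; lra)).
    have pl' : p l' = 0 by apply: inW => //; move: l1 l2 t1 t2; clear; lra.
    rewrite -E1 in n1; rewrite -E2 in n2.
    apply: (le_trans (Hp a K l l' d l0 l'0 d2 n1 n2 pl')).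
    by rewrite ler_wpM2r// mulrC.
  rewrite ler_pdivrMr// (le_trans (ler_cabs_sum _ _ _))// mulr_sumr mulr_suml.
  apply: ler_sum => m _; rewrite cabsM cabsX.
  have [->|am] := eqVneq (a m) 0; first by rewrite cabs0 !(mul0r, mulr0).
  have [g1 g2] := supp _ am.
  have tr : r - 1 <= `|m.+1%:R - tau l|.
    move: out; rewrite negb_and -ltNge -leNgt => /orP[q|q].
      by rewrite (le_trans _ (ler_norm _))//; move: q g1; clear; lra.
    by rewrite distrC (le_trans _ (ler_norm _))//; move: q g2; clear; lra.
  apply: (le_trans (ler_wpM2l (cabs_ge0 (a m)) (He l m))).
  set t := `|m.+1%:R - tau l| in tr *.
  have E3 : expR (- (2 * t)) = expR (- t) * expR (- t) :> R.
    by rewrite -expRD; congr expR; ring.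
  have h3 : c2 * expR (- t) <= e.
    by rewrite (le_trans _ r1)// ler_pM2l// ler_expR lerN2.
  pose Y := expR (- t) * (cabs (a m) * shn m) * skap l.
  have Y0 : 0 <= Y.
    by rewrite !mulr_ge0 ?expR_ge0 ?cabs_ge0 ?(ltW s0)// ltW// shn_gt0.
  rewrite E3; have -> : cabs (a m) * (c2 * (skap l * shn m * (expR (- t) * expR (- t)))) =
    c2 * expR (- t) * Y by rewrite /Y; ring.
  have -> : e * (expR (- t) * (cabs (a m) * shn m)) * skap l = e * Y by rewrite /Y; ring.
  exact: ler_wpM2r.
have Np : N p = (\sum_(n < K) cabs (a n) ^+ 2 * hn n)%:E by exact: norm_ppol.
set Q := \sum_(n < K) cabs (a n) ^+ 2 * hn n in Np.
have Q0 : 0 < Q.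
  rewrite /Q (bigD1 (Ordinal nD))//= ltr_wpDr//.
    by apply: sumr_ge0 => m _; rewrite mulr_ge0 ?sqr_ge0// ltW// hn_gt0.
  by rewrite mulr_gt0 ?hn_gt0// exprn_gt0// cabs_gt0.
have [low _] := Hc _ (fock_ppol alpha0 a K).
have up : ((\esum_(l in L) (cabs (p l) ^+ 2 / kappa l)%:E) <= (e ^+ 2 * M * Q)%:E)%E.
  apply: esum_le_seq => s us sL; rewrite lee_fin.
  have -> : \sum_(l <- s) cabs (p l) ^+ 2 / kappa l = \sum_(l <- s) (cabs (p l) / skap l) ^+ 2.
    by apply: eq_bigr => l _; rewrite expr_div_n skapE.
  have -> : Q = \sum_(n < K) (cabs (a n) * shn n) ^+ 2.
    by apply: eq_bigr => m _; rewrite exprMn shnE.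
  apply: (schur_points alpha0 (b := fun n => cabs (a n) * shn n) HB us sL (ltW e0)).
    by move=> l _; rewrite divr_ge0 ?cabs_ge0// ltW// skap_gt0.
  by move=> l ls; apply: key; exact: sL.
have := le_trans low up; rewrite -/p Np -EFinM lee_fin mulrC ler_pdivrMr//.
apply/negP; rewrite -ltNge.
have -> : e ^+ 2 * M * Q * c = e * (e * (M * c)) * Q by ring.
rewrite -[ltRHS]mul1r ltr_pM2r//.
by rewrite (le_lt_trans _ eM)// ler_piMl// mulr_ge0// ltW.
Qed.

Lemma limf_einf_ge (F : set_system R) (f : R -> \bar R) (b : \bar R) :
  (\forall x \near F, (b <= f x)%E) -> (b <= limf_einf f F)%E.
Proof.
move=> H; rewrite limf_einfE.
apply: (@le_trans _ _ (ereal_inf (f @` [set x | (b <= f x)%E]))).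
  by apply: le_ereal_inf_tmp => _ [x /= h <-].
by apply: ereal_sup_ubound; exists [set x | (b <= f x)%E].
Qed.

(** The annulus from t to s t is the window of length 2 alpha log s starting at 2 alpha log t. The
    loss 2 r + 1 at its ends does not depend on t and disappears after division by log s. *)
Lemma window_density L : (exists r : R, forall x y (W : seq C) n0 D, 1 <= x ->
    (forall l, L l -> x <= tau l -> tau l < y -> l \in W) ->
    x + r <= n0.+1%:R -> (n0 + D)%:R <= y - r -> (D <= size W)%N) ->
  ((2 * alpha)%:E <= lower_density L)%E.
Proof.
case=> r0 Hw0.
pose r := `|r0|; have r_ge0 : 0 <= r by exact: normr_ge0.
have Hw : forall x y (W : seq C) n0 D, 1 <= x ->
    (forall l, L l -> x <= tau l -> tau l < y -> l \in W) ->
    x + r <= n0.+1%:R -> (n0 + D)%:R <= y - r -> (D <= size W)%N.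
  have := ler_norm r0; rewrite -/r => rr x y W n0 D h1 h2 h3 h4.
  by apply: (Hw0 x y W n0 D) => //; move: rr h3 h4; clear; lra.
have a20 : 0 < 2 * alpha by rewrite mulr_gt0.
have count_ge (s t : R) : 1 < s -> expR (1 / (2 * alpha)) <= t ->
    ((2 * alpha * ln s - (2 * r + 1))%:E <= counting (L `&` annulus t (s * t)))%E.
  move=> s1 ht; rewrite /counting; case: asboolP => [fA|_]; last exact: leey.
  have t0 : 0 < t by apply: lt_le_trans ht; exact: expR_gt0.
  have s0 : 0 < s by exact: lt_trans s1.
  have lt : 1 / (2 * alpha) <= ln t by rewrite -ler_expR lnK.
  have p : 0 < 1 / (2 * alpha) by rewrite divr_gt0.
  pose x := 2 * alpha * ln t; pose y := x + 2 * alpha * ln s.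
  have x1 : 1 <= x by rewrite /x mulrC -ler_pdivrMr.
  pose W : seq C := finmap.enum_fset (fset_set (L `&` annulus t (s * t))).
  have HW l : L l -> x <= tau l -> tau l < y -> l \in W.
    move=> Ll; rewrite /x /y /tau -mulrDr ler_pM2l// ltr_pM2l// => h1 h2.
    rewrite in_fset_set// inE; split=> //.
    have l0 : 0 < lmod l by rewrite (lt_le_trans p)// (le_trans lt).
    have [E _] := cabs_lmod l0; rewrite /annulus /= E.
    apply/andP; split; first by rewrite -(lnK t0) ler_expR.
    by rewrite -(@lnK _ (s * t)) ?posrE ?mulr_gt0// ltr_expR lnM ?posrE// addrC.
  (* The exponents n0, ..., n1 - 1 have their peaks n + 1 between x + r and y - r; the two roundings
     lose at most 1 in total. *)
  pose n0 := Num.truncn (x + r); pose n1 := Num.truncn (y - r).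
  have xr0 : 0 <= x + r by move: x1 r_ge0; clear; lra.
  have /andP[a1 a2] := truncn_itv xr0; rewrite -/n0 in a1 a2.
  rewrite lee_fin -[X in _ <= X%:R]/(size W).
  have [yr|yr] := leP (y - r) (x + r).
    rewrite (@le_trans _ _ 0)//; move: yr; rewrite /y; move: r_ge0; clear; lra.
  have yr0 : 0 <= y - r by rewrite (le_trans xr0)// ltW.
  have /andP[b1 b2] := truncn_itv yr0; rewrite -/n1 in b1 b2.
  have n01 : (n0 <= n1)%N by apply: le_truncn; exact: ltW.
  have := Hw x y W n0 (n1 - n0)%N x1 HW (ltW a2).
  rewrite subnKC// => /(_ b1); rewrite -(ler_nat R) natrB// => h.
  rewrite (le_trans _ h)//; move: a1 b2; rewrite /y -natr1; clear; lra.
rewrite /lower_density.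
apply/lee_addgt0Pr => e e0; rewrite -leeBlDr//.
apply: limf_einf_ge; near=> s.
have s1 : 1 < s by near: s; apply: nbhs_pinfty_gt; rewrite num_real.
have s2 : expR ((2 * r + 1) / e) <= s.
  by near: s; apply: nbhs_pinfty_ge; rewrite num_real.
have ls : 0 < ln s by exact: ln_gt0.
have big : (2 * r + 1) / e <= ln s.
  by rewrite -ler_expR lnK ?posrE// (lt_trans _ s1).
apply: limf_einf_ge; near=> t.
have ht : expR (1 / (2 * alpha)) <= t by near: t; apply: nbhs_pinfty_ge; rewrite num_real.
rewrite inver gt_eqF// lee_pdivlMr//; apply: le_trans (count_ge s t s1 ht).
rewrite -EFinB -EFinM lee_fin mulrBl lerD2l lerN2.
by move: big; rewrite ler_pdivrMr// [ln s * e]mulrC.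
Unshelve. all: by end_near.
Qed.

End sampling_density.

(** * Sufficiency *)

Section lagrange_interpolation.
Variable R : realType.
Local Notation C := R[i].

(** Integers are grouped into blocks of length q >= 1/b, which reduces to rate 1 with at most q
    terms per block. *)
Lemma expsum_rate (b : R) : 0 < b -> exists2 c : R, 0 < c &
  forall K x, \sum_(k < K) expR (- (b * `|x - k%:R|)) <= c.
Proof.
move=> b0; pose q := (Num.truncn b^-1).+1; have q0 : 0 < (q%:R : R) by rewrite ltr0n.
have bq : q%:R^-1 <= b.
  by rewrite -[leRHS]invrK lef_pV2 ?posrE ?invr_gt0// ltW// truncnS_gt.
exists (expR 1 * (q%:R * 4)); first by rewrite !mulr_gt0// expR_gt0.
move=> K x; have count_le j : (count (fun l => l %/ q == j)%N (iota 0 K) <= q)%N.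
  rewrite -size_filter -[leqRHS](size_iota (j * q)).
  apply: uniq_leq_size; first by rewrite filter_uniq// iota_uniq.
  move=> l; rewrite mem_filter => /andP[/eqP <- _]; rewrite mem_iota.
  by rewrite leq_divM -mulSnr ltn_ceil.
apply: le_trans (ler_wpM2l (expR_ge0 1) (count_exp_sum (x / q%:R) count_le)).
rewrite -(big_mkord xpredT (fun k => expR (- (b * `|x - k%:R|)))) mulr_sumr /index_iota subn0.
apply: ler_sum => k _; rewrite -expRD ler_expR.
have kq : k%:R = (k %/ q)%:R * q%:R + (k %% q)%:R :> R by rewrite -natrM -natrD -divn_eq.
have mq : (k %% q)%:R / q%:R <= 1 :> R.
  by rewrite ler_pdivrMr// mul1r ler_nat ltnW// ltn_mod.
have m0 : 0 <= (k %% q)%:R / q%:R :> R by rewrite divr_ge0.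
have h : `|x - k%:R| / q%:R <= b * `|x - k%:R|.
  by rewrite mulrC ler_wpM2r.
have E : x / q%:R - (k %/ q)%:R = (x - k%:R) / q%:R + (k %% q)%:R / q%:R.
  by rewrite kq; field; rewrite gt_eqF.
have := ler_normD ((x - k%:R) / q%:R) ((k %% q)%:R / q%:R); rewrite -E.
rewrite (ger0_norm m0) normrM normfV (gtr0_norm q0).
by move: mq h; clear; lra.
Qed.

Lemma coef_prod_XsubC_le (I : Type) (s : seq I) (P : pred I) (c : I -> C) (r : R) m : 0 <= r ->
  cabs ((\prod_(i <- s | P i) ('X - (c i)%:P))`_m) * r ^+ m <=
  \prod_(i <- s | P i) (r + cabs (c i)).
Proof.
move=> r0; elim: s m => [|i s IH] m.
  rewrite !big_nil coef1; case: m => [|m] /=; first by rewrite cabs1 mulr1.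
  by rewrite cabs0 mul0r.
rewrite !big_cons; case: (P i); last exact: IH.
set p := \prod_(j <- s | _) ('X - _) in IH *.
rewrite mulrBl coefB coefXM coefCM.
apply: (le_trans (ler_wpM2r (exprn_ge0 _ r0) (ler_cabsB _ _))).
rewrite mulrDl [leRHS]mulrDl; apply: lerD; last first.
  by rewrite cabsM -mulrA ler_wpM2l ?cabs_ge0.
case: m => [|m] /=.
  by rewrite cabs0 mul0r mulr_ge0//; apply: prodr_ge0 => k _; rewrite addr_ge0 ?cabs_ge0.
by rewrite exprS mulrCA ler_wpM2l.
Qed.

(** The radius r is free and acts as a weight: the m-th coefficient of a product of X - c_i, times
    r^m, is at most the product of r + |c_i|. It is later set to the critical radius of z^m. *)
Lemma lagrange_coef_le (a : nat -> C) (mu : nat -> C) K m (r : R) : injective mu ->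
  (m < K)%N -> 0 < r ->
  cabs (a m) * r ^+ m <= \sum_(j < K) cabs (ppol a K (mu j)) *
    \prod_(i < K | i != j) ((r + cabs (mu i)) / cabs (mu j - mu i)).
Proof.
move=> mu_inj mK r0; have K0 : (0 < K)%N by exact: leq_ltn_trans mK.
pose p := \poly_(n < K) a n.
have pE z : p.[z] = ppol a K z by rewrite horner_poly.
have -> : a m = p`_m by rewrite coef_poly mK.
have sz : (size p <= K)%N by exact: size_poly.
rewrite (lagrange_gen K0 mu_inj sz) coef_sum.
apply: (le_trans (ler_wpM2r (exprn_ge0 _ (ltW r0)) (ler_cabs_sum _ _ _))).
rewrite mulr_suml; apply: ler_sum => j _.
rewrite lagrangeE// pE coefCM coefCM !cabsM -mulrA ler_wpM2l ?cabs_ge0//.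
rewrite horner_prod cabsV cabs_prod -prodfV -mulrA big_split /= [leRHS]mulrC.
have -> : \prod_(i < K | i != j :> nat) (cabs ('X - (mu i)%:P).[mu j])^-1 =
    \prod_(i < K | i != j) (cabs (mu j - mu i))^-1.
  by apply: eq_bigr => i _; rewrite hornerXsubC.
rewrite ler_wpM2l//; first by apply: prodr_ge0 => i _; rewrite invr_ge0 cabs_ge0.
exact: coef_prod_XsubC_le (ltW r0).
Qed.

End lagrange_interpolation.

(** * Exponents of the Lagrange weights for nearly arithmetic nodes *)

Section lagrange_exponents.
Variable R : realType.
Implicit Types (u : nat -> R) (sigma A x : R).

Lemma sum_arith (a b : R) d :
  \sum_(i < d) (a + b * i%:R) = a * d%:R + b * (d%:R * (d%:R - 1) / 2).
Proof.
elim: d => [|d IH]; first by rewrite big_ord0; ring.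
by rewrite big_ord_recr /= IH -natr1; field.
Qed.

(* [u i] stands for [tau] of the [i]-th node; up to bounded errors the left-hand
   side is a sum of [`|j - m|] terms in arithmetic progression. *)
Lemma interp_exponent_le u sigma A j m :
  (forall i k, `|u i - u k - sigma * (i%:R - k%:R)| <= A) ->
  \sum_(i < m) (u j - u i) - \sum_(i < j) (u j - u i) <=
  - (sigma / 2) * `|j%:R - m%:R| ^+ 2 + (A + `|sigma| / 2) * `|j%:R - m%:R|.
Proof.
move=> H; have H1 i k : u i - u k <= sigma * (i%:R - k%:R) + A.
  by have := H i k; rewrite ler_norml => /andP[_]; clear; lra.
have s1 := ler_norm sigma; have s2 : - sigma <= `|sigma| by rewrite -normrN ler_norm.
have [mj|jm] := leqP m j.
  rewrite -(subnKC mj); set d := (j - m)%N.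
  have -> : (m + d)%:R - m%:R = d%:R :> R by rewrite natrD; ring.
  rewrite (ger0_norm (ler0n _ d)) big_split_ord /=.
  have : \sum_(i < d) (u (m + i)%N - u (m + d)%N) <=
      \sum_(i < d) ((A - sigma * d%:R) + sigma * i%:R).
    apply: ler_sum => i _; apply: (le_trans (H1 _ _)); rewrite !natrD.
    by rewrite le_eqVlt; apply/orP; left; apply/eqP; ring.
  rewrite sum_arith.
  have -> : \sum_(i < d) (u (m + i)%N - u (m + d)%N) =
      - \sum_(i < d) (u (m + d)%N - u (m + i)%N).
    by rewrite -sumrN; apply: eq_bigr => i _; rewrite opprB.
  have : 0 <= (d%:R : R) by [].
  by move: (d%:R : R) s1 s2 => D; clear; nra.
rewrite -(subnKC (ltnW jm)); set d := (m - j)%N.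
have -> : j%:R - (j + d)%:R = - d%:R :> R by rewrite natrD; ring.
rewrite normrN (ger0_norm (ler0n _ d)) big_split_ord /=.
have : \sum_(i < d) (u j - u (j + i)%N) <= \sum_(i < d) (A + (- sigma) * i%:R).
  apply: ler_sum => i _; apply: (le_trans (H1 _ _)); rewrite !natrD.
  by rewrite le_eqVlt; apply/orP; left; apply/eqP; ring.
rewrite sum_arith; have : 0 <= (d%:R : R) by [].
by move: (d%:R : R) s1 s2 => D; clear; nra.
Qed.

(** If the u_i were increasing with x between indices m - 1 and m, the maxima would select exactly i
    < m and i < j. For the second sum dropping terms suffices; for the first, indices on the wrong
    side of x occur only near m and are paid for by the exponential sum, using t <= exp t. *)
Lemma sum_max_le u sigma A x j m K : (j < K)%N -> (m <= K)%N ->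
  (forall i, `|u i - x - sigma * (i%:R - m%:R)| <= A) -> 0 <= sigma ->
  \sum_(i < K | i != j :> nat) (Num.max (u i) x - Num.max (u i) (u j)) <=
  \sum_(i < m) (x - u i) - \sum_(i < j) (u j - u i) +
    expR A * \sum_(i < K) expR (- (sigma * `|m%:R - i%:R|)).
Proof.
move=> jK mK H s0.
have H1 i : u i - x <= sigma * (i%:R - m%:R) + A /\ x - u i <= sigma * (m%:R - i%:R) + A.
  by have := H i; rewrite ler_norml => /andP[h1 h2]; split; move: h1 h2; clear; lra.
apply: (@le_trans _ _ (\sum_(i < K) (Num.max (u i) x - Num.max (u i) (u j)))).
  rewrite [leRHS](bigD1 (Ordinal jK))//= lerDr subr_ge0 maxxx.
  by rewrite le_max lexx.
have -> : \sum_(i < K) (Num.max (u i) x - Num.max (u i) (u j)) =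
    \sum_(i < K) (Num.max (u i) x - u i) - \sum_(i < K) (Num.max (u i) (u j) - u i).
  by rewrite -sumrB; apply: eq_bigr => i _; ring.
have h1 : \sum_(i < j) (u j - u i) <= \sum_(i < K) (Num.max (u i) (u j) - u i).
  rewrite -(subnKC (ltnW jK)) big_split_ord /= -[leLHS]addr0; apply: lerD.
    by apply: ler_sum => i _; rewrite lerB// le_max lexx orbT.
  by apply: sumr_ge0 => i _; rewrite subr_ge0 le_max lexx.
have h2 : \sum_(i < K) (Num.max (u i) x - u i) <= \sum_(i < m) (x - u i) +
    expR A * \sum_(i < K) expR (- (sigma * `|m%:R - i%:R|)).
  rewrite (big_ord_widen K (fun i => x - u i) mK) [in leRHS]big_mkcond /=.
  rewrite mulr_sumr -big_split /=; apply: ler_sum => i _; rewrite -expRD.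
  set e := expR _; have e0 : 0 <= e by exact: expR_ge0.
  have [i1 i2] := H1 i.
  case: ltnP => im.
    have : u i - x <= e.
      apply: le_trans (le_trans _ (expR_ge1Dx _)) => //; apply: (le_trans i1).
      rewrite ger0_norm ?subr_ge0 ?ler_nat ?(ltnW im)//.
      by clear; lra.
    by move: e0; have [] := leP (u i) x; clear; lra.
  have : x - u i <= e.
    apply: le_trans (le_trans _ (expR_ge1Dx _)) => //; apply: (le_trans i2).
    rewrite ler0_norm ?subr_le0 ?ler_nat//.
    by clear; lra.
  by move: e0; have [] := leP (u i) x; clear; lra.
by move: h1 h2; clear; lra.
Qed.

End lagrange_exponents.

Section coefficient_bound.
Variable R : realType.
Local Notation C := R[i].
Variable alpha : R.
Hypothesis alpha0 : 0 < alpha.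
Implicit Types (z w : C) (a : nat -> C).

Local Notation tau := (tau alpha).
Local Notation skap := (skap alpha).
Local Notation shn := (shn alpha).

(** The distance is at least the larger modulus up to exp(- c q), where q is the ratio of the
    moduli. For q <= 1/2 the difference of moduli suffices, as 1 - q >= exp(- 2q). For q > 1/2
    separation gives the factor d q, and 4/d is chosen so that 4 q^2 >= 1 closes the estimate. The
    corrections q are summable over nearly arithmetic nodes. *)
Lemma dist_lower (b d s t : R) z w : 0 <= b -> 0 < d ->
  cabs z = expR (b * s) -> cabs w = expR (b * t) ->
  d * expR (b * Num.min s t) <= cabs (z - w) ->
  expR (b * Num.max t s - (2 + 4 / d) * expR (- (b * `|t - s|))) <= cabs (z - w).
Proof.
move=> b0 d0; wlog st : s t z w / s <= t.
  move=> W hz hw h; have /orP[st|ts] := le_total s t; first exact: (W s t z w).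
  by rewrite maxC distrC cabsB; apply: (W t s w z) => //; rewrite // minC cabsB.
move=> hz hw; rewrite (min_l st) (max_l st) => h.
rewrite ger0_norm ?subr_ge0//; set q := expR (- (b * (t - s))).
have q0 : 0 < q by exact: expR_gt0.
have E : expR (b * s) = q * expR (b * t) by rewrite -expRD; congr expR; ring.
have h1 : (1 - q) * expR (b * t) <= cabs (z - w).
  by rewrite mulrBl mul1r -E -hz -hw cabsB lerB_cabs.
rewrite E mulrA in h; rewrite expRD mulrC.
have [q2|q2] := leP q (1 / 2).
  apply: le_trans h1; rewrite ler_wpM2r ?expR_ge0//.
  have := expR_ge1Dx (2 * q) => e1.
  have le : - ((2 + 4 / d) * q) <= - (2 * q).
    rewrite lerN2 [leRHS]mulrDl lerDl mulr_ge0 ?(ltW q0)//.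
    by rewrite divr_ge0// ltW.
  apply: (@le_trans _ _ (expR (- (2 * q)))); first by rewrite ler_expR.
  rewrite expRN -[leLHS]mul1r ler_pdivrMr ?expR_gt0//.
  have q1 : 0 <= 1 - q by move: q2; clear; lra.
  apply: le_trans (ler_wpM2l q1 e1).
  by move: q0 q2; clear; nra.
apply: le_trans h; rewrite ler_wpM2r ?expR_ge0//.
rewrite expRN -[leLHS]mul1r ler_pdivrMr ?expR_gt0//.
have e1 := expR_ge1Dx ((2 + 4 / d) * q).
have dq : 0 <= d * q by rewrite mulr_ge0// ltW.
apply: le_trans (ler_wpM2l dq e1).
have -> : d * q * (1 + (2 + 4 / d) * q) = d * q + 2 * d * (q * q) + 4 * (q * q).
  by field; rewrite gt_eqF.
have := mulr_ge0 (ltW d0) (ltW (mulr_gt0 q0 q0)).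
by move: q2 dq; clear; nra.
Qed.

Lemma ratio_le (b d s t x : R) z w : 0 <= b -> 0 < d ->
  cabs z = expR (b * s) -> cabs w = expR (b * t) ->
  d * expR (b * Num.min s t) <= cabs (z - w) ->
  (expR (b * x) + cabs w) / cabs (z - w) <=
  expR (b * (Num.max t x - Num.max t s) +
    (2 + 4 / d) * (expR (- (b * `|t - x|)) + expR (- (b * `|t - s|)))).
Proof.
move=> b0 d0 hz hw h; have H := dist_lower b0 d0 hz hw h.
have zw : 0 < cabs (z - w) by apply: lt_le_trans H; exact: expR_gt0.
rewrite ler_pdivrMr//; set c := 2 + 4 / d in H *.
have c1 : 1 <= c by rewrite /c; have := divr_ge0 (ler0n R 4) (ltW d0); clear; lra.
set M := Num.max t s in H *; set q := expR (- (b * `|t - s|)) in H *.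
set y := expR (- (b * `|t - x|)).
have y0 : 0 <= y by exact: expR_ge0.
rewrite hw; apply: le_trans (ler_wpM2l (expR_ge0 _) H); rewrite -expRD.
have -> : b * (Num.max t x - M) + c * (y + q) + (b * M - c * q) =
  b * Num.max t x + c * y by ring.
rewrite expRD; apply: (@le_trans _ _ (expR (b * Num.max t x) * (1 + y))).
  rewrite mulrDr mulr1 /y -expRD; have [tx|xt] := leP t x.
    rewrite ler0_norm ?subr_le0// lerD2l ler_expR.
    by rewrite le_eqVlt; apply/orP; left; apply/eqP; ring.
  rewrite addrC lerD2l ger0_norm ?subr_ge0 ?(ltW xt)// ler_expR.
  by rewrite le_eqVlt; apply/orP; left; apply/eqP; ring.
rewrite ler_wpM2l ?expR_ge0//; apply: le_trans (expR_ge1Dx _).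
by rewrite lerD2l ler_peMl.
Qed.

(* The exponents add up to [- (sigma - sigma ^+ 2) * d ^+ 2 / 2 + O(d + 1)] with
   [d = `|j - m|]: this is where [sigma < 1] is needed. *)
Lemma coef_bound (sigma A d : R) : 0 < sigma -> sigma < 1 -> 0 <= A -> 0 < d ->
  exists2 c : R, 0 < c & forall (mu : nat -> C) a K m, injective mu -> (m < K)%N ->
    (forall i, 0 < lmod (mu i)) ->
    (forall i j, i <> j -> d * expR (Num.min (lmod (mu i)) (lmod (mu j))) <= cabs (mu i - mu j)) ->
    (forall i, `|tau (mu i) - m.+1%:R - sigma * (i%:R - m%:R)| <= A) ->
    cabs (a m) * shn m <= c * \sum_(j < K) expR (- `|j%:R - m%:R|) *
      (cabs (ppol a K (mu j)) / skap (mu j)).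
Proof.
move=> s0 s1 A0 d0.
have [c1 c10 Hc1] := skap_le alpha0; have [c2 c20 Hc2] := shn_le alpha0.
pose b := 1 / (2 * alpha); have b0 : 0 < b by rewrite divr_gt0// mulr_gt0.
have [c3 c30 Hc3] := expsum_rate s0.
have [c4 c40 Hc4] := expsum_rate (mulr_gt0 b0 s0).
(* [g] and [B] are the quadratic and linear coefficients left in d = |j - m| after adding the
   Lagrange exponent and (sigma d + A)^2/2. *)
pose g := (sigma - sigma ^+ 2) / 2; pose B := sigma * A + 2 * A + sigma / 2.
have g0 : 0 < g by rewrite divr_gt0// subr_gt0 expr2 gtr_pMr.
(* Total of the corrections of [ratio_le] over all nodes: one sum measured from x, one from u_j. *)
pose F := (2 + 4 / d) * (2 * (expR (b * (2 * A)) * c4)).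
pose G := b * ((B + 1 / b) ^+ 2 / (4 * g) + A ^+ 2 / 2 + expR A * c3) + F.
exists (c1 * c2 * expR G); first by rewrite !mulr_gt0// expR_gt0.
move=> mu a K m mu_inj mK pos Hsep Hmu.
pose u i := tau (mu i); pose x : R := m.+1%:R.
have lE i : lmod (mu i) = b * u i by rewrite /u /tau /b; field; rewrite gt_eqF.
have cE i : cabs (mu i) = expR (b * u i) by rewrite -lE; exact: (cabs_lmod (pos i)).1.
have Hu i k : `|u i - u k - sigma * (i%:R - k%:R)| <= 2 * A.
  have := Hmu i; have := Hmu k; rewrite -/(u i) -/(u k) !ler_norml.
  by move=> /andP[h1 h2] /andP[h3 h4]; apply/andP; split; move: h1 h2 h3 h4; clear; lra.
have dist_exp y D k i : `|y - sigma * (i%:R - k%:R)| <= D -> D <= 2 * A ->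
    expR (- (b * `|y|)) <= expR (b * (2 * A)) * expR (- (b * sigma * `|k%:R - i%:R|)).
  move=> h1 h2; rewrite -expRD ler_expR.
  have -> : b * (2 * A) + - (b * sigma * `|k%:R - i%:R|) = b * (2 * A - sigma * `|k%:R - i%:R|).
    by ring.
  rewrite -mulrN ler_pM2l//.
  have := ler_normB y (y - sigma * (i%:R - k%:R)).
  have -> : y - (y - sigma * (i%:R - k%:R)) = sigma * (i%:R - k%:R) by ring.
  rewrite normrM (gtr0_norm s0) [`|i%:R - _|]distrC.
  by move: h1 h2; clear; lra.
have factor j : (j < K)%N -> \prod_(i < K | i != j :> nat)
    ((expR (b * x) + cabs (mu i)) / cabs (mu j - mu i)) <=
    expR (b * (\sum_(i < m) (x - u i) - \sum_(i < j) (u j - u i) + expR A * c3) + F).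
  move=> jK; pose e i := b * (Num.max (u i) x - Num.max (u i) (u j)) +
    (2 + 4 / d) * (expR (- (b * `|u i - x|)) + expR (- (b * `|u i - u j|))).
  apply: (@le_trans _ _ (\prod_(i < K | i != j :> nat) expR (e i))).
    apply: ler_prod => i ij; rewrite divr_ge0 ?addr_ge0 ?expR_ge0 ?cabs_ge0//=.
    apply: ratio_le => //; first exact: ltW.
    rewrite (_ : b * Num.min (u j) (u i) = Num.min (lmod (mu j)) (lmod (mu i))).
      by apply: Hsep => ji; rewrite ji eqxx in ij.
    by rewrite !lE minr_pMr// ltW.
  rewrite -expR_sum ler_expR big_split /= -!mulr_sumr; apply: lerD.
    rewrite ler_pM2l// (le_trans (sum_max_le jK (ltnW mK) Hmu (ltW s0)))//.
    by rewrite lerD2l ler_wpM2l ?expR_ge0.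
  rewrite /F ler_wpM2l//; first by rewrite addr_ge0// divr_ge0// ltW.
  apply: (@le_trans _ _ (\sum_(i < K)
    (expR (- (b * `|u i - x|)) + expR (- (b * `|u i - u j|))))).
    rewrite [leRHS](bigD1 (Ordinal jK))//= lerDr addr_ge0// expR_ge0//.
  rewrite big_split mulrDl !mul1r; apply: lerD.
    apply: (le_trans _ (ler_wpM2l (expR_ge0 _) (Hc4 K m%:R))).
    rewrite mulr_sumr; apply: ler_sum => i _; apply: dist_exp (Hmu i) _.
    by move: A0; clear; lra.
  apply: (le_trans _ (ler_wpM2l (expR_ge0 _) (Hc4 K j%:R))).
  by rewrite mulr_sumr; apply: ler_sum => i _; exact: dist_exp (Hu i j) _.
have r0 : 0 < expR (b * x) by exact: expR_gt0.
have := lagrange_coef_le a mu_inj mK r0; rewrite -expRM_natl.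
have sm0 := shn_gt0 alpha0 m.
rewrite -ler_pdivlMr ?expR_gt0// => /(ler_wpM2r (ltW sm0)) /le_trans; apply.
rewrite mulr_suml mulr_suml mulr_sumr; apply: ler_sum => j _.
have sj0 := skap_gt0 alpha0 (mu j).
set P := \prod_(i < K | _) _; set v := cabs (ppol a K (mu j)).
have v0 : 0 <= v / skap (mu j) by rewrite divr_ge0 ?cabs_ge0// ltW.
have -> : v * P / expR (m%:R * (b * x)) * shn m =
    (P * skap (mu j) * shn m / expR (m%:R * (b * x))) * (v / skap (mu j)).
  by field; rewrite !gt_eqF// expR_gt0.
rewrite [leRHS]mulrA ler_wpM2r// ler_pdivrMr ?expR_gt0//.
have hP : P <= _ := factor _ (ltn_ord j).
have P0 : 0 <= P.
  by apply: prodr_ge0 => i _; rewrite divr_ge0 ?addr_ge0 ?expR_ge0 ?cabs_ge0.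
apply: (le_trans (ler_pM _ (ltW sm0) (ler_pM P0 (ltW sj0) hP (Hc1 (mu j))) (Hc2 m))).
  by rewrite mulr_ge0// ltW.
set D := `|j%:R - m%:R|; set X := _ + F.
have -> : expR X * (c1 * expR (alpha * lmod (mu j) ^+ 2 - lmod (mu j))) *
    (c2 * expR (m.+1%:R ^+ 2 / (4 * alpha))) =
    c1 * c2 * expR (X + (alpha * lmod (mu j) ^+ 2 - lmod (mu j)) + m.+1%:R ^+ 2 / (4 * alpha)).
  by rewrite !expRD; ring.
have -> : c1 * c2 * expR G * expR (- D) * expR (m%:R * (b * x)) =
    c1 * c2 * expR (G + - D + m%:R * (b * x)) by rewrite !expRD; ring.
rewrite ler_pM2l ?mulr_gt0// ler_expR.
have D0 : 0 <= D by exact: normr_ge0.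
have E1 : \sum_(i < m) (x - u i) = m%:R * (x - u j) + \sum_(i < m) (u j - u i).
  have -> : m%:R * (x - u j) = \sum_(i < m) (x - u j) by rewrite sumr_const card_ord mulr_natl.
  by rewrite -big_split; apply: eq_bigr => i _ /=; ring.
have hD := interp_exponent_le j m Hu; rewrite (gtr0_norm s0) -/D in hD.
have hu : `|u j - x| <= sigma * D + A.
  have := ler_normD (u j - x - sigma * (j%:R - m%:R)) (sigma * (j%:R - m%:R)).
  by rewrite subrK normrM (gtr0_norm s0) -/D; have := Hmu j; rewrite -/(u j); clear; lra.
have hu2 : (u j - x) ^+ 2 <= (sigma * D + A) ^+ 2.
  by rewrite -real_normK ?num_real// lerXn2r// nnegrE addr_ge0// mulr_ge0// ltW.
(* Completing the square trades the Gaussian decay for the linear decay exp(- D) demanded by Schur's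
   test; the factor 1/b cancels the overall b. *)
have sq : - g * D ^+ 2 + B * D <= - (D / b) + (B + 1 / b) ^+ 2 / (4 * g).
  rewrite -subr_ge0.
  have -> : - (D / b) + (B + 1 / b) ^+ 2 / (4 * g) - (- g * D ^+ 2 + B * D) =
    g * (D - (B + 1 / b) / (2 * g)) ^+ 2 by field; rewrite !gt_eqF.
  by rewrite mulr_ge0 ?sqr_ge0// ltW.
(* The bounds for [skap] and [shn] and the part m (x - u_j) of the Lagrange exponent combine into
   (u_j - x)^2/2 and the power r^m; the term - [lmod] supplies the shift from m to x = m + 1. *)
have E2 : X + (alpha * lmod (mu j) ^+ 2 - lmod (mu j)) + m.+1%:R ^+ 2 / (4 * alpha) =
    b * ((u j - x) ^+ 2 / 2 + (\sum_(i < m) (u j - u i) - \sum_(i < j) (u j - u i)) +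
      expR A * c3) + F + m%:R * (b * x).
  rewrite /X E1 lE /x -natr1.
  have -> : alpha * (b * u j) ^+ 2 = b * u j ^+ 2 / 2 by rewrite /b; field; rewrite gt_eqF.
  have -> : (m%:R + 1) ^+ 2 / (4 * alpha) = b * (m%:R + 1) ^+ 2 / 2.
    by rewrite /b; field; rewrite gt_eqF.
  by field.
rewrite E2 lerD2r /G.
have -> : b * ((B + 1 / b) ^+ 2 / (4 * g) + A ^+ 2 / 2 + expR A * c3) + F + - D =
  b * (- (D / b) + (B + 1 / b) ^+ 2 / (4 * g) + A ^+ 2 / 2 + expR A * c3) + F.
  by field; rewrite !gt_eqF.
rewrite lerD2r ler_pM2l// lerD2r.
move: hD hu2 sq; rewrite /g /B; move: (_ ^+ 2 / (4 * _)) (D / b); clear => S T; nra.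
Qed.

End coefficient_bound.

(** * From interpolation to the lower sampling inequality *)

Section lower_bound.
Variable R : realType.
Local Notation C := R[i].
Variable alpha : R.
Hypothesis alpha0 : 0 < alpha.
Implicit Types (z w : C) (L : set C) (a : nat -> C).

Local Notation phi := (log2_weight alpha).
Local Notation N := (fock_norm2 phi).
Local Notation hn := (hn alpha).
Local Notation tau := (tau alpha).
Local Notation kappa := (kappa alpha).
Local Notation skap := (skap alpha).
Local Notation shn := (shn alpha).

(* For the coefficient of index [m] the interpolation nodes start at an index
   [k0] proportional to [m], so that the critical radius of [z ^ m], at
   [tau = m + 1], is close to the radius of the node of index [k0 + m]. *)
Lemma node_lower (lam : nat -> C) (sigma A d : R) : injective lam ->
  (forall k, 0 < lmod (lam k)) -> 0 < d ->
  (forall i j, i <> j -> d * expR (Num.min (lmod (lam i)) (lmod (lam j))) <=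
    cabs (lam i - lam j)) ->
  0 < sigma -> sigma < 1 -> (forall k, `|tau (lam k) - sigma * k%:R| <= A) ->
  exists2 c : R, 0 < c & forall a K, exists J,
    \sum_(m < K) cabs (a m) ^+ 2 * hn m <=
    c * \sum_(j < J) (cabs (ppol a K (lam j)) / skap (lam j)) ^+ 2.
Proof.
move=> lam_inj pos d0 Hsep s0 s1 HA.
have A0 : 0 <= A + 2 by rewrite addr_ge0// (le_trans _ (HA 0%N)).
have [c c0 Hc] := coef_bound alpha0 s0 s1 A0 d0.
(* Solves sigma (theta m + m) = m. *)
pose theta := (1 - sigma) / sigma.
have theta0 : 0 <= theta by rewrite divr_ge0 ?(ltW s0)// subr_ge0 ltW.
pose k0 m := Num.truncn (theta * m%:R).
have k0_le : {homo k0 : m n / (m <= n)%N}.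
  by move=> m n mn; apply: le_truncn; rewrite ler_wpM2l// ler_nat.
(* The global index of the central node for the coefficient m. It is strictly increasing in m, so
   the column sums of the matrix stay bounded in Schur's test. *)
pose p m := (k0 m + m)%N.
have p_inj : injective p.
  move=> m n pE; apply/eqP; rewrite eqn_leq; apply/andP; split; rewrite leqNgt; apply/negP => h.
    by have := k0_le _ _ (ltnW h); move: pE h; rewrite /p; clear; lia.
  by have := k0_le _ _ (ltnW h); move: pE h; rewrite /p; clear; lia.
exists (c ^+ 2 * 16) => [|a K]; first by rewrite mulr_gt0// exprn_gt0.
pose J := (k0 K + K)%N; exists J.
pose v j := cabs (ppol a K (lam j)) / skap (lam j).
have v0 j : 0 <= v j by rewrite divr_ge0 ?cabs_ge0// ltW// skap_gt0.
have key m : (m < K)%N -> cabs (a m) * shn m <= \sum_(j < J) c * expR (- `|(p m)%:R - j%:R|) * v j.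
  move=> mK; pose mu i := lam (k0 m + i)%N.
  have mu_inj : injective mu by move=> i j /lam_inj/addnI.
  have Hmu i : `|tau (mu i) - m.+1%:R - sigma * (i%:R - m%:R)| <= A + 2.
    have tm : 0 <= theta * m%:R by rewrite mulr_ge0.
    have /andP[t1 t2] := truncn_itv tm; rewrite -/(k0 m) in t1 t2.
    have h1 : sigma * (k0 m)%:R <= (1 - sigma) * m%:R.
      by rewrite (_ : (1 - sigma) * _ = sigma * (theta * m%:R)) ?ler_pM2l// /theta; field; rewrite gt_eqF.
    have h2 : (1 - sigma) * m%:R <= sigma * ((k0 m)%:R + 1).
      rewrite (_ : (1 - sigma) * _ = sigma * (theta * m%:R)); last by rewrite /theta; field; rewrite gt_eqF.
      by rewrite ler_pM2l// natr1 ltW.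
    have := HA (k0 m + i)%N; rewrite -/(mu i) natrD -natr1 !ler_norml => /andP[g1 g2].
    by apply/andP; split; move: h1 h2 g1 g2 s0 s1; clear; lra.
  have Hs k i j (ij : i <> j) := Hsep _ _ (fun e : (k + i = k + j)%N => ij (addnI e)).
  apply: (le_trans (Hc mu a K m mu_inj mK (fun i => pos _) (Hs (k0 m)) Hmu)).
  have KJ : (k0 m + K <= J)%N by rewrite leq_add2r k0_le// ltnW.
  rewrite mulr_sumr -(subnKC KJ) big_split_ord /= big_split_ord /= -addrA.
  apply: ler_wpDl.
    by apply: sumr_ge0 => i _; rewrite mulr_ge0// mulr_ge0 ?expR_ge0// ltW.
  apply: ler_wpDr.
    by apply: sumr_ge0 => i _; rewrite mulr_ge0// mulr_ge0 ?expR_ge0// ltW.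
  apply: ler_sum => i _; rewrite mulrA /p !natrD distrC opprD addrACA subrr add0r.
  by [].
have -> : \sum_(m < K) cabs (a m) ^+ 2 * hn m = \sum_(m < K) (cabs (a m) * shn m) ^+ 2.
  by apply: eq_bigr => m _; rewrite exprMn shnE.
have -> : c ^+ 2 * 16 = (c * 4) * (c * (1%:R * 4)) by ring.
apply: (schur (w := fun (m : 'I_K) (j : 'I_J) => c * expR (- `|(p m)%:R - j%:R|))).
- by move=> m j; rewrite mulr_ge0 ?expR_ge0// ltW.
- by rewrite mulr_ge0// ltW.
- by move=> m; rewrite -mulr_sumr ler_pM2l// expsum.
- move=> j; rewrite -mulr_sumr ler_pM2l//.
  have Hp l : (count (fun i => p i == l) (iota 0 K) <= 1)%N.
    rewrite -(count_map p (pred1 l)) count_uniq_mem ?leq_b1//.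
    by rewrite map_inj_uniq ?iota_uniq.
  apply: le_trans (count_exp_sum j%:R Hp).
  rewrite -(big_mkord xpredT (fun m => expR (- `|(p m)%:R - j%:R|))) /index_iota subn0.
  by apply: ler_sum => m _; rewrite distrC.
- by move=> m; rewrite mulr_ge0 ?cabs_ge0// ltW// shn_gt0.
- by move=> m; exact: key.
Qed.

Lemma fock_tail f a K : fock phi f -> coefs f a ->
  fock phi (fun z => f z - ppol a K z) /\
  fine (N (fun z => f z - ppol a K z)) <= fine (N f) - \sum_(n < K) cabs (a n) ^+ 2 * hn n.
Proof.
move=> Ff ha; set g := fun z => _; set S := \sum_(n < K) _.
have Fg : fock phi g.
  have := fockD Ff (fockZ (-1) (fock_ppol alpha0 a K)).
  by under eq_fun do rewrite mulN1r.
split=> //; pose b n : C := a n - (if (n < K)%N then a n else 0).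
have hb : coefs g b.
  have := coefsD ha (coefsZ (-1) (coefs_ppol a K)).
  by under eq_fun do rewrite mulN1r; rewrite /b; under [X in coefs _ X]eq_fun do rewrite mulN1r.
rewrite -lee_fin -fock_norm_fin//; apply: (fock_norm_le alpha0 hb) => M.
rewrite lee_fin lerBrDr -lee_fin -fock_norm_fin//.
apply: le_trans (fock_partial alpha0 (M + K) ha); rewrite lee_fin /S.
have h0 n : 0 <= hn n by exact: ltW (hn_gt0 alpha0 n).
rewrite (big_ord_widen (M + K) (fun n => cabs (b n) ^+ 2 * hn n) (leq_addr K M)).
rewrite (big_ord_widen (M + K) (fun n => cabs (a n) ^+ 2 * hn n) (leq_addl M K)).
rewrite big_mkcond [X in _ + X]big_mkcond -big_split; apply: ler_sum => n _ /=.
rewrite /b; case: (ltnP n K) => nK; case: (n < M)%N; rewrite ?subrr ?subr0 ?cabs0 ?expr0n ?mul0r ?addr0 ?add0r//.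
by rewrite mulr_ge0 ?sqr_ge0.
Qed.

(** Let Q be the partial norm of f and F the full one. The node values of the polynomial are those
    of f minus those of the remainder, so Q <= c1 (2x + 2c (F - Q)) for every K. Solving for Q and
    then taking the supremum over K gives F <= 2 c1 x, since the terms D F cancel. *)
Lemma sampling_lower L B (lam : nat -> C) (c1 : R) : count_bd alpha L B ->
  injective lam -> (forall k, L (lam k)) -> 0 < c1 ->
  (forall a K, exists J, \sum_(m < K) cabs (a m) ^+ 2 * hn m <=
    c1 * \sum_(j < J) (cabs (ppol a K (lam j)) / skap (lam j)) ^+ 2) ->
  forall f, fock phi f ->
  ((2 * c1)^-1%:E * N f <= \esum_(l in L) (cabs (f l) ^+ 2 / kappa l)%:E)%E.
Proof.
move=> HB lam_inj lamL c10 H f Ff; have [c c0 Hc] := bessel_fock alpha0 HB.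
have [a ha] := fock_coefs Ff.
set S := \esum_(l in L) _.
have S0 : (0 <= S)%E.
  by apply: esum_ge0 => l _; rewrite lee_fin divr_ge0 ?sqr_ge0// ltW// kappa_gt0.
case ES: S S0 => [x| |]// x0; last by rewrite leey.
rewrite lee_fin in x0.
pose F := fine (N f); pose D := 2 * c1 * c.
have D0 : 0 <= D by rewrite !mulr_ge0// ltW.
suff : (N f <= ((2 * c1 * x + D * F) / (1 + D))%:E)%E.
  rewrite (fock_norm_fin Ff) -EFinM !lee_fin -/F ler_pdivlMr ?ltr_wpDr//.
  rewrite ler_pdivrMl ?mulr_gt0// mulrDr mulr1 [D * F]mulrC.
  by rewrite lerD2r.
apply: (fock_norm_le alpha0 ha) => K; rewrite lee_fin ler_pdivlMr ?ltr_wpDr//.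
have [J HJ] := H a K; have [Fg Ng] := fock_tail K Ff ha.
set Q := \sum_(n < K) _ in HJ Ng *.
pose s := map lam (iota 0 J).
have us : uniq s by rewrite map_inj_uniq ?iota_uniq.
have sL l : l \in s -> L l by case/mapP => k _ ->.
have h1 := Hc _ _ Fg us sL.
have h2 : \sum_(l <- s) cabs (f l) ^+ 2 / kappa l <= x.
  by rewrite -lee_fin -ES; exact: (esum_ge_seq (fun l => cabs (f l) ^+ 2 / kappa l) us sL).
have h3 : \sum_(j < J) (cabs (ppol a K (lam j)) / skap (lam j)) ^+ 2 <=
    2 * \sum_(l <- s) cabs (f l) ^+ 2 / kappa l +
    2 * \sum_(l <- s) cabs (f l - ppol a K l) ^+ 2 / kappa l.
  rewrite -(big_mkord xpredT (fun j => (cabs (ppol a K (lam j)) / skap (lam j)) ^+ 2)).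
  rewrite /index_iota subn0 -(big_map lam xpredT (fun l => (cabs (ppol a K l) / skap l) ^+ 2)).
  rewrite -/s -mulrDr -big_split mulr_sumr; apply: ler_sum => l _ /=.
  rewrite expr_div_n skapE// -mulrDl mulrA ler_pM2r ?invr_gt0 ?kappa_gt0//.
  have t : cabs (ppol a K l) <= cabs (f l) + cabs (f l - ppol a K l).
    by rewrite -[ppol a K l in leLHS](subKr (f l)); exact: ler_cabsB.
  have t2 : cabs (ppol a K l) ^+ 2 <= (cabs (f l) + cabs (f l - ppol a K l)) ^+ 2.
    by rewrite lerXn2r ?nnegrE ?addr_ge0 ?cabs_ge0.
  by have := sqr_ge0 (cabs (f l) - cabs (f l - ppol a K l)); move: t2; clear; nra.
have h4 : Q <= c1 * (2 * x + 2 * (c * (F - Q))).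
  apply: (le_trans HJ); rewrite ler_pM2l// (le_trans h3)// lerD// ler_wpM2l//.
  by rewrite (le_trans h1)// ler_pM2l.
by move: h4; rewrite /D; clear; lra.
Qed.

End lower_bound.

Section dense_nodes.
Variable R : realType.
Local Notation C := R[i].
Variable alpha : R.
Hypothesis alpha0 : 0 < alpha.
Implicit Types (z w : C) (L : set C).

Local Notation tau := (tau alpha).

Lemma limf_einf_gt (f : R -> \bar R) (b : \bar R) :
  (b < limf_einf f (pinfty_nbhs R))%E -> exists M, forall x, M < x -> (b < f x)%E.
Proof.
rewrite limf_einfE => /ereal_sup_gt[_ [A [M [_ MA]] <-] h].
exists M => x /MA Ax; apply: (lt_le_trans h).
by apply: ereal_inf_lbound; exists x.
Qed.

Lemma counting_gt_seq (A : set C) (b : R) : 0 <= b -> (b%:E < counting A)%E ->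
  exists s, [/\ uniq s, size s = (Num.truncn b).+1 & forall l, l \in s -> A l].
Proof.
move=> b0 h; have [X XA hX] : exists2 X : seq C, uniq X /\ (Num.truncn b < size X)%N &
    forall l, l \in X -> A l.
  move: h; rewrite /counting; case: asboolP => [fA|infA _].
    rewrite lte_fin -[X in b < X%:R]/(size (finmap.enum_fset (fset_set A))) => h.
    exists (finmap.enum_fset (fset_set A)).
      by split; [exact: finmap.fset_uniq|rewrite truncn_lt_nat].
    by move=> l; rewrite in_fset_set// inE.
  have [X XA sX] := infinite_set_fset (Num.truncn b).+1 infA.
  by exists (finmap.enum_fset X) => //; split=> //; exact: finmap.fset_uniq.
case: XA => uX sX; exists (take (Num.truncn b).+1 X); split.
- exact: take_uniq.
- by rewrite size_takel.
- by move=> l /mem_take/hX.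
Qed.

(** For a fixed large ratio s, every annulus of ratio s starting far enough out contains more than b
    = 2 alpha log s points. Taking exactly p > b of them in each of consecutive annuli, which have
    length b in [tau], gives mean spacing b/p < 1; the order within an annulus only affects the
    bounded error. *)
Lemma dense_nodes L : ((2 * alpha)%:E < lower_density L)%E ->
  exists (lam : nat -> C) (sigma A : R), [/\ injective lam,
    forall k, L (lam k) /\ 0 < lmod (lam k), 0 < sigma, sigma < 1 &
    forall k, `|tau (lam k) - sigma * k%:R| <= A].
Proof.
move=> /limf_einf_gt[M1 H1].
pose s := Num.max M1 1 + 1; have s1 : 1 < s by rewrite ltr_pwDr// le_max lexx orbT.
have : M1 < s by rewrite ltr_pwDr// le_max lexx.
move=> /H1/limf_einf_gt[M2 H]; have s0 : 0 < s by exact: lt_trans s1.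
have ls : 0 < ln s by exact: ln_gt0.
(* Being above [M2] makes the count valid in all annuli; being above 1 puts every node outside the
   unit disc, where [lmod] is log |z|. *)
pose r0 := Num.max M2 1 + 1; have r1 : 1 < r0 by rewrite ltr_pwDr// le_max lexx orbT.
have r0M : M2 < r0 by rewrite ltr_pwDr// le_max lexx.
have a20 : 0 < 2 * alpha by rewrite mulr_gt0.
pose b := 2 * alpha * ln s; have b0 : 0 < b by rewrite mulr_gt0.
pose p := (Num.truncn b).+1; have bp : b < p%:R by exact: truncnS_gt.
pose r i := r0 * s ^+ i.
have ri i : r0 <= r i by rewrite ler_peMr ?exprn_ege1 ?(ltW s1)// ltW// (lt_trans ltr01).
have /choice[e He] : forall i, exists t : seq C, [/\ uniq t, size t = p &
    forall l, l \in t -> (L `&` annulus (r i) (s * r i)) l].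
  move=> i; apply: counting_gt_seq; first exact: ltW.
  have := H (r i) (lt_le_trans r0M (ri i)).
  by rewrite inver gt_eqF// lte_pdivlMr// -EFinM.
pose lam k := nth 0 (e (k %/ p)%N) (k %% p)%N.
pose X := 2 * alpha * ln r0.
have X0 : 0 < X by rewrite mulr_gt0// ln_gt0.
have in_e k : lam k \in e (k %/ p)%N.
  by apply: mem_nth; have [_ -> _] := He (k %/ p)%N; rewrite ltn_mod.
have r00 : 0 < r0 by exact: lt_trans r1.
have lnr i : 2 * alpha * ln (r i) = X + i%:R * b.
  by rewrite /r lnM ?posrE ?exprn_gt0// lnXn// /X /b -mulr_natl; ring.
have tau_lam k : [/\ L (lam k), 0 < lmod (lam k), X + (k %/ p)%:R * b <= tau (lam k) &
    tau (lam k) < X + (k %/ p).+1%:R * b].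
  have [_ _ /(_ _ (in_e k))[Ll /andP[h1 h2]]] := He (k %/ p)%N.
  have c1 : 1 < cabs (lam k) by rewrite (lt_le_trans r1)// (le_trans (ri _) h1).
  have c0 : 0 < cabs (lam k) by exact: lt_trans c1.
  have lE : lmod (lam k) = ln (cabs (lam k)) by rewrite /lmod /logp max_l// ltW// ln_gt0.
  have ri0 : 0 < r (k %/ p)%N by exact: lt_le_trans (ri _).
  split=> //; first by rewrite lE ln_gt0.
    by rewrite -lnr /tau lE ler_pM2l// ler_ln ?posrE.
  rewrite -lnr /tau lE ltr_pM2l// ltr_ln ?posrE//; last by rewrite /r mulr_gt0// exprn_gt0.
  by rewrite /r exprS mulrCA.
exists lam, (b / p%:R), (X + b); split.
- move=> k j E; have [_ _ k1 k2] := tau_lam k; have [_ _ j1 j2] := tau_lam j.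
  have q : (k %/ p = j %/ p)%N.
    rewrite E in k1 k2; have := le_lt_trans k1 j2; have := le_lt_trans j1 k2.
    rewrite !ltrD2l !ltr_pM2r// !ltr_nat !ltnS => h1 h2.
    by apply/eqP; rewrite eqn_leq h1 h2.
  rewrite (divn_eq k p) (divn_eq j p) q; congr (_ + _)%N.
  have [ue se _] := He (j %/ p)%N; apply/eqP.
  by rewrite -(nth_uniq 0 _ _ ue) ?se ?ltn_mod//; move: E; rewrite /lam q => ->.
- by move=> k; have [] := tau_lam k.
- by rewrite divr_gt0.
- by rewrite ltr_pdivrMr// mul1r.
- move=> k; have [_ _ k1 k2] := tau_lam k.
  have kE : b / p%:R * k%:R = (k %/ p)%:R * b + (k %% p)%:R / p%:R * b.
    by rewrite {1}(divn_eq k p) natrD natrM; field; rewrite gt_eqF.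
  have m1 : (k %% p)%:R / p%:R * b <= b.
    by rewrite ler_piMl ?(ltW b0)// ler_pdivrMr// mul1r ler_nat ltnW// ltn_mod.
  have m0 : 0 <= (k %% p)%:R / p%:R * b by rewrite mulr_ge0 ?(ltW b0).
  rewrite -natr1 in k2; rewrite kE ler_norml; apply/andP.
  by split; move: k1 k2 m1 m0 X0; clear; lra.
Qed.

End dense_nodes.

Theorem theorem1p5 (R : realType) (alpha : R) (alpha_gt0 : 0 < alpha) :
  (forall L : set R[i], countable L ->
     drho_separated alpha L ->
     ((2 * alpha)%:E < lower_density L)%E ->
     sampling (log2_weight alpha) L)
  /\
  (forall L : set R[i], countable L ->
     sampling (log2_weight alpha) L ->
     (exists (n : nat) (F : 'I_n -> set R[i]),
        (forall i, drho_separated alpha (F i)) /\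
        L = \bigcup_(i in [set: 'I_n]) F i)
     /\
     (exists L' : set R[i],
        [/\ L' `<=` L,
            drho_separated alpha L' &
            ((2 * alpha)%:E <= lower_density L')%E])).

Proof.
have a0 := alpha_gt0; split=> L _ HL.
  move=> HD; have [d d0 Hd] := drho_sep a0 HL.
  have [B HB] := sep_count a0 d0 Hd.
  have [lam [sigma [A [lam_inj lamP s0 s1 HA]]]] := dense_nodes a0 HD.
  have Hsep i j : i <> j -> d * expR (Num.min (lmod (lam i)) (lmod (lam j))) <=
      cabs (lam i - lam j).
    move=> ij; apply: Hd; [exact: (lamP i).1|exact: (lamP j).1|].
    by move=> /lam_inj.
  have [c1 c10 H1] := node_lower a0 lam_inj (fun k => (lamP k).2) d0 Hsep s0 s1 HA.
  have [c2 c20 H2] := sampling_upper a0 HB.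
  have N0 f : (0 <= fock_norm2 (log2_weight alpha) f)%E.
    by apply: plane_integral_ge0 => z; rewrite mulr_ge0 ?sqr_ge0// expR_ge0.
  (* [sampling] uses one constant and its inverse, so the larger of the two bounds serves both
     inequalities. *)
  exists (Num.max (2 * c1) c2); first by rewrite lt_max c20 orbT.
  move=> f Ff /=; split.
    apply: le_trans (sampling_lower a0 HB lam_inj (fun k => (lamP k).1) c10 H1 Ff).
    apply: lee_wpmul2r => //; rewrite lee_fin lef_pV2 ?posrE ?lt_max ?c20 ?orbT ?mulr_gt0//.
    by rewrite le_max lexx.
  apply: (le_trans (H2 f Ff)); apply: lee_wpmul2r => //.
  by rewrite lee_fin le_max lexx orbT.
split.
  by have [B HB] := sampling_count a0 HL; exact: (count_finite_union a0 HB).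
have [L' [L'L sepL' HW]] := sampling_window a0 HL.
have HD := window_density a0 HW.
by exists L'.
Qed.
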